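(* There exists a unique guaranteed estimate of $l(f)=\int_Dl_0f\,dx$. It has the form $$\widehat{\widehat{l(f)}}=(y_1,\hat u_1)_{H_1}+(y_2,\hat u_2)_{H_2}+\hat c,$$ where $$\hat c=\int_D(l_0(x)-\hat z_2(x))f_0(x)\,dx,\qquad\hat u_1=\tilde Q_1C_1\mathbf p_1,\qquad\hat u_2=\tilde Q_2C_2p_2,$$ and $\mathbf p_1\in H(\mathrm{div};D)$, $\hat z_2,p_2\in L^2(D)$ are found (together with $\hat{\mathbf z}_1\in H(\mathrm{div};D)$) from the solution of the variational problem $$a^*(\hat{\mathbf z}_1,\mathbf q_1)+b(\mathbf q_1,\hat z_2)=-\int_D(C_1^tJ_{H_1}\tilde Q_1C_1\mathbf p_1,\mathbf q_1)_{\mathbb R^n}dx\quad\forall\mathbf q_1\in H(\mathrm{div};D),$$ $$-b(\hat{\mathbf z}_1,v_1)+m(\hat z_2,v_1)=\int_D(C_2^tJ_{H_2}\tilde Q_2C_2p_2)\,v_1\,dx\quad\forall v_1\in L^2(D),$$ $$a(\mathbf p_1,\mathbf q_2)+b(\mathbf q_2,p_2)=0\quad\forall\mathbf q_2\in H(\mathrm{div};D),$$ $$-b(\mathbf p_1,v_2)+m(p_2,v_2)=\int_Dv_2\,Q^{-1}(l_0-\hat z_2)\,dx\quad\forall v_2\in L^2(D).$$ This problem is uniquely solvable. The error of estimation is $$\sigma=\left(l(Q^{-1}(l_0-\hat z_2))\right)^{1/2}.$$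
   Context: All Hilbert spaces are real. $D\subset\mathbb R^n$ is an open domain with Lipschitz boundary $\Gamma$, and $H(\mathrm{div};D)=\{\mathbf q\in L^2(D)^n:\ \mathrm{div}\,\mathbf q\in L^2(D)\}$. $\mathbf A(x)=(a_{ij}(x))$ is an $n\times n$ matrix with $a_{ij}\in L^\infty(D)$ and, for some $\mu>0$, $\mu\sum_i\xi_i^2\le\sum_{i,j}a_{ij}(x)\xi_i\xi_j$ for all $x\in D$, $\xi\in\mathbb R^n$. The coefficient $c(x)$ is piecewise continuous with $0\le c_0\le c(x)\le c_1$, $c_0,c_1$ constants. Put $$a(\mathbf q_1,\mathbf q_2)=\int_D(\mathbf A^{-1}\mathbf q_1,\mathbf q_2)_{\mathbb R^n}dx,\quad a^*(\mathbf q_1,\mathbf q_2)=a(\mathbf q_2,\mathbf q_1)=\int_D((\mathbf A^{-1})^T\mathbf q_1,\mathbf q_2)_{\mathbb R^n}dx,$$ $$b(\mathbf q,v)=-\int_Dv\,\mathrm{div}\,\mathbf q\,dx,\quad m(v_1,v_2)=\int_Dc(x)v_1v_2\,dx.$$ State. For $f\in L^2(D)$ the state $(\mathbf j,\varphi)\in H(\mathrm{div};D)\times L^2(D)$ is the unique solution of $a(\mathbf j,\mathbf q)+b(\mathbf q,\varphi)=0$ for all $\mathbf q\in H(\mathrm{div};D)$ and $b(\mathbf j,v)-m(\varphi,v)=-\int_Dfv\,dx$ for all $v\in L^2(D)$ (the mixed formulation of $-\mathrm{div}(\mathbf A\,\mathbf{grad}\,\varphi)+c\varphi=f$ in $D$,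 $\varphi=0$ on $\Gamma$, $\mathbf j=-\mathbf A\,\mathbf{grad}\,\varphi$). Uncertainty sets. $f$ is unknown and belongs to $G_0=\{\tilde f\in L^2(D):(Q(\tilde f-f_0),\tilde f-f_0)_{L^2(D)}\le1\}$, where $f_0\in L^2(D)$ is given and $Q$ is a bounded positive selfadjoint operator in $L^2(D)$ with bounded inverse. $H_1,H_2$ are separable Hilbert spaces, $H=H_1\times H_2$. $(\Omega,\mathcal B,P)$ is a probability space; $\mathbb E$ is expectation, and $L^2(\Omega,X)$ is the Bochner space of square-integrable $X$-valued random variables. $G_1$ is the set of pairs $(\tilde\eta_1,\tilde\eta_2)$, $\tilde\eta_i\in L^2(\Omega,H_i)$, $\mathbb E\tilde\eta_i=0$, that are uncorrelated, i.e. $\mathbb E[(\tilde\eta_1,u_1)_{H_1}(\tilde\eta_2,u_2)_{H_2}]=0$ for all $u_1\in H_1,u_2\in H_2$, and satisfy $\mathbb E(\tilde Q_i\tilde\eta_i,\tilde\eta_i)_{H_i}\le1$, $i=1,2$; here $\tilde Q_i$ are bounded positive definite selfadjoint operators in $H_i$ with bounded inverses. Observations. $y_1=C_1\mathbf j+\eta_1$, $y_2=C_2\varphi+\eta_2$, with bounded linear $C_1:L^2(D)^n\to H_1$, $C_2:L^2(D)\to H_2$, and $(\eta_1,\eta_2)\in G_1$. $J_{H_i}:H_i\to H_i'$ is the Riesz operator, $(v,u)_{H_i}=\langle v,J_{H_i}u\rangle$; $C_1^t:H_1'\to L^2(D)^n$, $C_2^t:H_2'\to L^2(D)$ are the transposes,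 $\int_D(v,C_1^tw)_{\mathbb R^n}dx=\langle C_1v,w\rangle$, $\int_Dv\,C_2^tw\,dx=\langle C_2v,w\rangle$. Guaranteed estimate of $l(f)$. For given $l_0\in L^2(D)$ let $l(f)=\int_Dl_0f\,dx$. For $u=(u_1,u_2)\in H$, $\kappa\in\mathbb R$ set $$\sigma(u,\kappa)=\sup_{\tilde f\in G_0,(\tilde\eta_1,\tilde\eta_2)\in G_1}\mathbb E\left|l(\tilde f)-(\tilde y_1,u_1)_{H_1}-(\tilde y_2,u_2)_{H_2}-\kappa\right|^2,$$ where $(\tilde{\mathbf j},\tilde\varphi)$ is the state for $f=\tilde f$ and $\tilde y_1=C_1\tilde{\mathbf j}+\tilde\eta_1$, $\tilde y_2=C_2\tilde\varphi+\tilde\eta_2$. If $(\hat u,\hat c)$ satisfies $\sigma(\hat u,\hat c)=\inf_{u\in H,\kappa\in\mathbb R}\sigma(u,\kappa)$, then $\widehat{\widehat{l(f)}}=(y_1,\hat u_1)_{H_1}+(y_2,\hat u_2)_{H_2}+\hat c$ is called the guaranteed estimate of $l(f)$ and $\sigma=[\sigma(\hat u,\hat c)]^{1/2}$ the error of guaranteed estimation.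
   Formalization: The probability space is assumed to carry two uncorrelated centred real random variables of variance one; without this (e.g. a one-point space, where all noises vanish) uniqueness and the error formula fail. *)

(* Defs.v *)
(* MathComp / MathComp-Analysis *)
From HB Require Import structures.
From mathcomp Require Import all_boot all_order all_algebra.
From mathcomp Require Import ring lra.
From mathcomp Require Import all_classical all_reals all_analysis measurable_realfun.
Set Implicit Arguments.
Unset Strict Implicit.
Unset Printing Implicit Defensive.
Import Order.TTheory GRing.Theory Num.Theory numFieldNormedType.Exports.
Local Open Scope classical_set_scope.
Local Open Scope ring_scope.

(* Borel sigma-algebra on R^n, and the n-dimensional Lebesgue measure obtained by
   iterating the product with the one-dimensional one; lebesgue_row_box computes
   it on boxes. *)
Section borel_row.
Context {R : realType} {n : nat}.

Let borel_row : set (set 'rV[R]_n) := <<s open >>.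

Let borel_row0 : borel_row set0. Proof. exact: sigma_algebra0. Qed.

Let borel_rowC A : borel_row A -> borel_row (~` A).
Proof. exact: sigma_algebraC. Qed.

Let borel_row_bigcup (F : (set 'rV[R]_n)^nat) :
  (forall i, borel_row (F i)) -> borel_row (\bigcup_i F i).
Proof. exact: sigma_algebra_bigcup. Qed.

HB.instance Definition _ := @isMeasurable.Build default_measure_display
  'rV[R]_n borel_row borel_row0 borel_rowC borel_row_bigcup.

Lemma open_measurable_row (U : set 'rV[R]_n) : open U -> measurable U.
Proof. by move=> oU; apply: sub_sigma_algebra. Qed.

Definition row_of_tuple (t : n.-tuple (measurableTypeR R)) : 'rV[R]_n :=
  \row_i tnth t i.

Lemma open_bigcup_rat_ball (U : set 'rV[R]_n) : open U ->
  U = \bigcup_(p in [set p : n.-tuple rat * nat |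
        ball (\row_i ratr (tnth p.1 i) : 'rV[R]_n) p.2.+1%:R^-1 `<=` U])
      ball (\row_i ratr (tnth p.1 i) : 'rV[R]_n) p.2.+1%:R^-1.
Proof.
move=> oU; apply/seteqP; split => [x Ux|x [p]]; last by apply.
have /nbhs_ballP[e /= e0 eU] : nbhs x U by exact: open_nbhs_nbhs.
have [k ke] : exists k : nat, k.+1%:R^-1 < e / 2.
  have e20 : 0 < e / 2 by rewrite divr_gt0.
  have [k] := ltr_add_invr e20; rewrite add0r => ke; by exists k.
have k0 : 0 < k.+1%:R^-1 :> R by rewrite invr_gt0.
have qi i : exists q : rat, ball (x 0 i) (k.+1%:R^-1) (ratr q : R).
  have [|z [xz [q _ qz]]] := @dense_rat R (ball (x 0 i) k.+1%:R^-1) _ (ball_open _ _).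
    by exists (x 0 i); apply: ballxx.
  by exists q; rewrite qz.
pose q : n.-tuple rat := [tuple sval (cid (qi i)) | i < n].
exists (q, k) => /=.
  move=> y [_ qy]; apply: eU; split=> // i j; rewrite ord1.
  have := qy 0 j; rewrite mxE tnth_mktuple => qyj.
  have xq := svalP (cid (qi j)).
  rewrite (splitr e); apply: ball_triangle.
    exact: (le_ball (ltW ke) xq).
  exact: (le_ball (ltW ke) qyj).
split => // i j; rewrite ord1 mxE tnth_mktuple; apply: ball_sym.
exact: svalP (cid (qi j)).
Qed.

Lemma measurable_row_of_tuple : measurable_fun setT row_of_tuple.
Proof.
apply: (@measurability _ _ _ _ setT row_of_tuple open) => //.
move=> _ [U oU <-]; rewrite setTI (open_bigcup_rat_ball oU).
rewrite preimage_bigcup bigcup_mkcond; apply: countable_bigcupT_measurable => [|p]; first exact: countableP.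
case: ifPn => // _.
rewrite (_ : _ @^-1` _ = \bigcap_(i in [set: 'I_n])
    ((fun t : n.-tuple (measurableTypeR R) => tnth t i) @^-1`
       ball (ratr (tnth p.1 i) : R) p.2.+1%:R^-1)); last first.
  apply/seteqP; split => [t [_ tp] i _|t tp] /=.
    by have := tp 0 i; rewrite !mxE.
  by split => [|i j]; [rewrite invr_gt0|rewrite ord1 !mxE; exact: tp].
apply: fin_bigcap_measurable => // i _; rewrite -[X in measurable X]setTI.
apply: measurable_tnth => //; apply: open_measurable; exact: ball_open.
Qed.

End borel_row.

Definition pushforward_measure d1 d2 (T1 : measurableType d1)
    (T2 : measurableType d2) (R : realType) (m : {measure set T1 -> \bar R})
    (f : T1 -> T2) (mf : measurable_fun setT f) : {measure set T2 -> \bar R} :=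
  measure_function_pushforward__canonical__measure_function_Measure m mf.

Lemma product_measure_sigma_finite d1 d2 (T1 : measurableType d1)
    (T2 : measurableType d2) (R : realType)
    (m1 : {sigma_finite_measure set T1 -> \bar R})
    (m2 : {sigma_finite_measure set T2 -> \bar R}) :
  sigma_finite setT (m1 \x m2)%E.
Proof.
have /sigma_finiteP[F [TF ndF Foo]] := sigma_finiteT m1.
have /sigma_finiteP[G [TG ndG Goo]] := sigma_finiteT m2.
exists (fun n => F n `*` G n).
 rewrite -setXTT TF TG predeqE => -[x y]; split.
    move=> [/= [n _ Fnx] [k _ Gky]]; exists (maxn n k) => //; split.
    - by move: x Fnx; exact/subsetPset/ndF/leq_maxl.
    - by move: y Gky; exact/subsetPset/ndG/leq_maxr.
  by move=> [n _ []/= ? ?]; split; exists n.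
move=> k; have [? ?] := Foo k; have [? ?] := Goo k.
split; first exact: measurableX.
by rewrite product_measure1E// lte_mul_pinfty// ge0_fin_numE.
Qed.

Section lebesgue_tuple.
Context {R : realType}.

Let E n := (n.-tuple (measurableTypeR R)).

Definition tuple_cons n (p : measurableTypeR R * E n) : E n.+1 :=
  [tuple of p.1 :: p.2].

Lemma measurable_tuple_cons n : measurable_fun setT (@tuple_cons n).
Proof. exact: (measurable_cons measurable_fst measurable_snd). Qed.

Section step.
Context n (m : {sigma_finite_measure set (E n) -> \bar R}).

Definition tuple_measure_step :=
  pushforward (@lebesgue_measure R \x m)%E (@tuple_cons n).

HB.instance Definition _ := Measure.copy tuple_measure_step
  (pushforward_measure (@lebesgue_measure R \x m)%E (@measurable_tuple_cons n)).

Let tuple_measure_step_sigma_finite : sigma_finite setT tuple_measure_step.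
Proof.
have [F FT Ffin] := product_measure_sigma_finite (@lebesgue_measure R) m.
pose uncons (t : E n.+1) : measurableTypeR R * E n := (thead t, [tuple of behead t]).
have muncons : measurable_fun setT uncons.
  apply: measurable_fun_pair; last exact: measurable_behead.
  exact: measurable_tnth.
have consK : cancel (@tuple_cons n) uncons.
  by move=> [x t]; congr pair; exact: val_inj.
exists (fun i => uncons @^-1` F i).
  by rewrite -preimage_bigcup -FT preimage_setT.
move=> i; have [mF Fi] := Ffin i; split.
  by rewrite -[X in measurable X]setTI; exact: muncons.
rewrite /tuple_measure_step /pushforward -comp_preimage.
by rewrite (_ : uncons \o _ = id)//; apply/funext => x /=; exact: consK.
Qed.

HB.instance Definition _ := Measure_isSigmaFinite.Build _ _ _
  tuple_measure_step tuple_measure_step_sigma_finite.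

End step.

Fixpoint lebesgue_tuple n : {sigma_finite_measure set (E n) -> \bar R} :=
  if n is k.+1 then tuple_measure_step (lebesgue_tuple k)
  else dirac [tuple].

End lebesgue_tuple.

Section lebesgue_row.
Context (R : realType) (n : nat).

Definition lebesgue_row : set 'rV[R]_n -> \bar R :=
  pushforward (lebesgue_tuple n) (@row_of_tuple R n).

HB.instance Definition _ := Measure.copy lebesgue_row
  (pushforward_measure (lebesgue_tuple n) (@measurable_row_of_tuple R n)).

End lebesgue_row.

Lemma lebesgue_tuple_box (R : realType) (n : nat)
    (A : 'I_n -> set (measurableTypeR R)) : (forall i, measurable (A i)) ->
  lebesgue_tuple n [set t | forall i, A i (tnth t i)] =
  (\prod_(i < n) lebesgue_measure (A i))%E.
Proof.
elim: n A => [|n IHn] A mA.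
  by rewrite big_ord0 /= diracE mem_set// => -[].
rewrite big_ord_recl -IHn => [|i]; last exact: mA.
have mB : measurable [set t : n.-tuple (measurableTypeR R) |
    forall i, A (lift ord0 i) (tnth t i)].
  rewrite (_ : [set t | _] = \bigcap_(i in [set: 'I_n])
      ((fun t : n.-tuple (measurableTypeR R) => tnth t i) @^-1` A (lift ord0 i))).
    apply: fin_bigcap_measurable => // i _; rewrite -[X in measurable X]setTI.
    by apply: measurable_tnth => //; exact: mA.
  by apply/seteqP; split => [t tA i _|t tA i]; exact: tA.
rewrite -product_measure1E//= /tuple_measure_step /pushforward.
congr (_ _); apply/seteqP; split => [[x t] /= tA|[x t] [/= Ax tA] i].
  split; first exact: (tA ord0).
  by move=> i; have := tA (lift ord0 i); rewrite /= tnthS.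
by case: (unliftP ord0 i) => [j ->|->]; [rewrite tnthS; exact: tA|].
Qed.

Lemma lebesgue_row_box (R : realType) (n : nat) (A : 'I_n -> set R) :
  (forall i, measurable (A i)) ->
  lebesgue_row [set x : 'rV[R]_n | forall i, A i (x 0 i)] =
  (\prod_(i < n) lebesgue_measure (A i : set (measurableTypeR R)))%E.
Proof.
move=> mA; rewrite /lebesgue_row /pushforward -lebesgue_tuple_box//.
by congr (_ _); apply/seteqP; split => t tA i; have := tA i; rewrite /= mxE.
Qed.

HB.mixin Record isPreHilbert (R : realType) V & NormedModule R V := {
  inner : V -> V -> R ;
  innerC : forall u v, inner u v = inner v u ;
  innerDl : forall u v w, inner (u + v) w = inner u w + inner v w ;
  innerZl : forall a u v, inner (a *: u) v = a * inner u v ;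
  inner_norm : forall u, inner u u = `|u| ^+ 2
}.

#[short(type="preHilbertType")]
HB.structure Definition PreHilbert (R : realType) :=
  {V of NormedModule R V & isPreHilbert R V}.

#[short(type="hilbertType")]
HB.structure Definition Hilbert (R : realType) :=
  {V of PreHilbert R V & Complete V}.

(* Norm derived from the inner product: `|u| = sqrt (inner u u). *)
HB.factory Record Lmodule_isPreHilbert (R : realType) V
    & GRing.Lmodule R V := {
  inner : V -> V -> R ;
  innerC : forall u v, inner u v = inner v u ;
  innerDl : forall u v w, inner (u + v) w = inner u w + inner v w ;
  innerZl : forall a u v, inner (a *: u) v = a * inner u v ;
  inner_ge0 : forall u, 0 <= inner u u ;
  inner_eq0 : forall u, inner u u = 0 -> u = 0
}.

HB.builders Context R V & Lmodule_isPreHilbert R V.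

Let norm (u : V) : R := Num.sqrt (inner u u).

Let normX2 u : norm u ^+ 2 = inner u u.
Proof. by rewrite sqr_sqrtr ?inner_ge0. Qed.

Let norm_ge0 u : 0 <= norm u. Proof. exact: sqrtr_ge0. Qed.

Let innerZZ a u : inner (a *: u) (a *: u) = a ^+ 2 * inner u u.
Proof. by rewrite innerZl innerC innerZl mulrA expr2. Qed.

Let innerDD u v :
  inner (u + v) (u + v) = inner u u + inner u v *+ 2 + inner v v.
Proof.
rewrite innerDl (innerC u) (innerC v (u + v)) !innerDl (innerC v u).
by rewrite mulr2n !addrA.
Qed.

Let inner_le u v : inner u v <= norm u * norm v.
Proof.
have [v0|v0] := eqVneq (inner v v) 0.
  have -> : inner u v = 0.
    by rewrite (inner_eq0 v0) innerC -(scale0r (0 : V)) innerZl mul0r.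
  by rewrite mulr_ge0.
have vv0 : 0 < inner v v by rewrite lt_neqAle eq_sym v0 inner_ge0.
have [uv0|/ltW uv0] := leP (inner u v) 0.
  by rewrite (le_trans uv0)// mulr_ge0.
have := inner_ge0 (inner v v *: u + - inner u v *: v).
rewrite innerDD !innerZZ innerZl innerC innerZl (innerC v u) => h.
rewrite -(@ler_pXn2r _ 2)// ?nnegrE ?mulr_ge0// exprMn !normX2.
rewrite -(ler_pM2l vv0) -subr_ge0; apply: le_trans h _.
rewrite le_eqVlt; apply/orP; left; apply/eqP.
by rewrite sqrrN; ring.
Qed.

Let ler_normD u v : norm (u + v) <= norm u + norm v.
Proof.
rewrite -(@ler_pXn2r _ 2)// ?nnegrE ?addr_ge0// normX2 innerDD sqrrD !normX2.
by rewrite lerD2r lerD2l ler_wMn2r// inner_le.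
Qed.

Let normrZ (a : R) u : norm (a *: u) = `|a| * norm u.
Proof. by rewrite /norm innerZZ sqrtrM ?sqr_ge0// sqrtr_sqr. Qed.

Let normr0_eq0 u : norm u = 0 -> u = 0.
Proof.
by move=> u0; apply: inner_eq0; rewrite -normX2 u0 expr0n.
Qed.

HB.instance Definition _ :=
  @Lmodule_isNormed.Build R V norm ler_normD normrZ normr0_eq0.

HB.instance Definition _ := @isPreHilbert.Build R V inner innerC innerDl innerZl
  (fun u => esym (normX2 u)).

HB.end.

(* Elements of the library's LspaceType2 are classes modulo a.e. equality; the
   coercion to functions picks a representative, and the vector space operations
   are determined up to a.e. equality by L2_addE and L2_scaleE below. *)
Section L2.
Context d (T : measurableType d) (R : realType).
Variable mu : {measure set T -> \bar R}.

Definition L2 : Type := LspaceType2 mu.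

HB.instance Definition _ := gen_eqMixin L2.
HB.instance Definition _ := gen_choiceMixin L2.

Definition L2_fun (f : L2) : T -> R := (f : {mfun_ mu, T >-> measurableTypeR R}).
Local Coercion L2_fun : L2 >-> Funclass.

Lemma L2_Lfun (f : L2) : L2_fun f \in Lfun mu 2%:E.
Proof.
apply/andP; split; rewrite inE /=; last exact: (@Lebesgue_finite _ _ _ _ _ _ f).
exact: (@measurable_funPT _ _ _ _ (repr (f : {mfun_ mu, T >-> measurableTypeR R}))).
Qed.

Lemma L2_ext (f g : L2) : f = g %[ae mu] -> f = g.
Proof.
move=> fg.
have fgq : (f : {mfun_ mu, T >-> measurableTypeR R}) =
           (g : {mfun_ mu, T >-> measurableTypeR R}).
  by rewrite -(reprK (f : {mfun_ mu, T >-> measurableTypeR R}))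
     -(reprK (g : {mfun_ mu, T >-> measurableTypeR R})); apply/eqmodP/asboolP.
case: f g fg fgq => f cf [g cg] /= _ fg; rewrite fg in cf *.
case: cf => [[fin_f]]; case: cg => [[fin_g]].
by rewrite (Prop_irrelevance fin_f fin_g).
Qed.

Section mk.
Variables (f : T -> R) (fL : f \in Lfun mu 2%:E).

Let mf : measurable_fun setT (f : T -> measurableTypeR R).
Proof. by move: fL => /andP[/[!inE]]. Qed.

Let f_mfun : {mfun T >-> measurableTypeR R} :=
  HB.pack f (@isMeasurableFun.Build _ _ T (measurableTypeR R) f mf).

Let f_class : {mfun_ mu, T >-> measurableTypeR R} :=
  \pi_({mfun_ mu, T >-> measurableTypeR R})%qT f_mfun.

Let f_classE : f_class = f %[ae mu].
Proof.
by have /eqmodP/asboolP := reprK f_class.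
Qed.

Let f_class_fin : finite_norm mu 2%:E f_class.
Proof.
move: fL => /andP[_ /[!inE]/=]; rewrite /finite_norm unlock.
rewrite (_ : \int[mu]_x _ = \int[mu]_x (`|(EFin \o f) x| `^ 2))%E//.
apply: ae_eq_integral => //.
- apply: (measurableT_comp (measurable_poweR _)) => //.
  apply: measurableT_comp => //; apply/measurable_EFinP.
  exact: (@measurable_funPT _ _ _ _ (repr f_class)).
- apply: (measurableT_comp (measurable_poweR _)) => //.
  by apply: measurableT_comp => //; apply/measurable_EFinP.
- by apply: filterS f_classE => x /= fx _; rewrite fx.
Qed.

Definition mkL2 : L2 :=
  HB.pack_for (LspaceType mu (lee1n 2)) f_class
    (@isFinLebesgue.Build _ T R mu _ (lee1n 2) f_class f_class_fin).

Lemma mkL2E : mkL2 = f %[ae mu]. Proof. exact: f_classE. Qed.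
End mk.

Let Lfun2_0 : (0 : T -> R) \in Lfun mu 2%:E.
Proof. by have [] := Lfun_submod_closed mu (lee1n 2). Qed.

Let Lfun2_lin a (f g : L2) : a *: L2_fun f + L2_fun g \in Lfun mu 2%:E.
Proof.
by have [_] := Lfun_submod_closed mu (lee1n 2); apply; exact: L2_Lfun.
Qed.

Definition L2_zero := mkL2 Lfun2_0.
Definition L2_lin a f g := mkL2 (Lfun2_lin a f g).

Lemma L2_zeroE : \forall x \ae mu, L2_zero x = 0.
Proof. by apply: filterS (mkL2E Lfun2_0) => x /(_ I). Qed.

Lemma L2_linE a f g : \forall x \ae mu, L2_lin a f g x = a * f x + g x.
Proof. by apply: filterS (mkL2E (Lfun2_lin a f g)) => x /(_ I). Qed.

Lemma L2_extP (f g : L2) : (\forall x \ae mu, f x = g x) -> f = g.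
Proof. by move=> fg; apply: L2_ext; apply: filterS fg => x + _. Qed.

Let add f g := L2_lin 1 f g.
Let opp f := L2_lin (-1) f L2_zero.
Let scale a f := L2_lin a f L2_zero.

Let addE f g : \forall x \ae mu, add f g x = f x + g x.
Proof. by apply: filterS (L2_linE 1 f g) => x ->; rewrite mul1r. Qed.

Let scaleE a f : \forall x \ae mu, scale a f x = a * f x.
Proof.
by apply: filterS2 L2_zeroE (L2_linE a f L2_zero) => x -> ->; rewrite addr0.
Qed.

Let oppE f : \forall x \ae mu, opp f x = - f x.
Proof. by apply: filterS (scaleE (-1) f) => x; rewrite /scale mulN1r. Qed.

Let addA : associative add.
Proof.
move=> f g h; apply: L2_extP.
apply: filterS2 (filterI (addE f (add g h)) (addE g h))
                (filterI (addE (add f g) h) (addE f g)).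
by move=> x [-> ->] [-> ->]; rewrite addrA.
Qed.

Let addC : commutative add.
Proof.
move=> f g; apply: L2_extP; apply: filterS2 (addE f g) (addE g f).
by move=> x -> ->; rewrite addrC.
Qed.

Let add0 : left_id L2_zero add.
Proof.
move=> f; apply: L2_extP; apply: filterS2 (addE L2_zero f) L2_zeroE.
by move=> x -> ->; rewrite add0r.
Qed.

Let addN : left_inverse L2_zero opp add.
Proof.
move=> f; apply: L2_extP.
apply: filterS3 (addE (opp f) f) (oppE f) L2_zeroE.
by move=> x -> -> ->; rewrite addNr.
Qed.

HB.instance Definition _ := GRing.isZmodule.Build L2 addA addC add0 addN.

Let scaleA a b f : scale a (scale b f) = scale (a * b) f.
Proof.
apply: L2_extP.
apply: filterS3 (scaleE a (scale b f)) (scaleE b f) (scaleE (a * b) f).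
by move=> x -> -> ->; rewrite mulrA.
Qed.

Let scale1 : left_id 1 scale.
Proof.
by move=> f; apply: L2_extP; apply: filterS (scaleE 1 f) => x ->; rewrite mul1r.
Qed.

Let scaleDr : right_distributive scale +%R.
Proof.
move=> a f g; apply: L2_extP.
apply: filterS3 (filterI (scaleE a (f + g)) (addE f g))
  (addE (scale a f) (scale a g)) (filterI (scaleE a f) (scaleE a g)).
by move=> x [-> ->] -> [-> ->]; rewrite mulrDr.
Qed.

Let scaleDl f : {morph scale^~ f : a b / a + b}.
Proof.
move=> a b; apply: L2_extP.
apply: filterS3 (scaleE (a + b) f)
  (addE (scale a f) (scale b f)) (filterI (scaleE a f) (scaleE b f)).
by move=> x -> -> [-> ->]; rewrite mulrDl.
Qed.

HB.instance Definition _ :=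
  GRing.Zmodule_isLmodule.Build R L2 scaleA scale1 scaleDr scaleDl.

Lemma L2_addE (f g : L2) : \forall x \ae mu, L2_fun (f + g) x = f x + g x.
Proof. exact: addE. Qed.

Lemma L2_scaleE a (f : L2) : \forall x \ae mu, L2_fun (a *: f) x = a * f x.
Proof. exact: scaleE. Qed.

Lemma L2_mul_integrable (f g : L2) :
  mu.-integrable setT (EFin \o (fun x => f x * g x)).
Proof.
apply/Lfun1_integrable.
exact: Lfun2_mul_Lfun1 (L2_Lfun f) (L2_Lfun g).
Qed.

Let L2_measurable (f : L2) : measurable_fun setT f.
Proof. by have /andP[/[!inE]] := L2_Lfun f. Qed.

Definition L2_inner (f g : L2) : R := \int[mu]_x (f x * g x).

Lemma ae_eq_Rintegral (f g : T -> R) : measurable_fun setT f ->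
    measurable_fun setT g -> (\forall x \ae mu, f x = g x) ->
  \int[mu]_x f x = \int[mu]_x g x.
Proof.
move=> mf mg fg; congr fine; apply: ae_eq_integral => //.
- exact/measurable_EFinP.
- exact/measurable_EFinP.
- by apply: filterS fg => x /= -> .
Qed.

Let innerC f g : L2_inner f g = L2_inner g f.
Proof. by apply: eq_Rintegral => x _; rewrite mulrC. Qed.

Let innerDl f g h : L2_inner (f + g) h = L2_inner f h + L2_inner g h.
Proof.
rewrite /L2_inner -RintegralD//; [|exact: L2_mul_integrable..].
apply: ae_eq_Rintegral.
- by apply: measurable_funM; exact: L2_measurable.
- by apply: measurable_funD; apply: measurable_funM; exact: L2_measurable.
- by apply: filterS (L2_addE f g) => x ->; rewrite mulrDl.
Qed.

Let innerZl a f g : L2_inner (a *: f) g = a * L2_inner f g.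
Proof.
rewrite /L2_inner -RintegralZl//; last exact: L2_mul_integrable.
apply: ae_eq_Rintegral.
- by apply: measurable_funM; exact: L2_measurable.
- by apply: measurable_funM => //; apply: measurable_funM; exact: L2_measurable.
- by apply: filterS (L2_scaleE a f) => x ->; rewrite mulrA.
Qed.

Let inner_ge0 f : 0 <= L2_inner f f.
Proof. by apply: Rintegral_ge0 => x _; rewrite -expr2 sqr_ge0. Qed.

Let inner_eq0 f : L2_inner f f = 0 -> f = 0.
Proof.
move=> f0; apply: L2_extP.
have int0 : (\int[mu]_x `|(f x * f x)%:E| = 0)%E.
  rewrite (eq_integral (fun x => (f x * f x)%:E)); last first.
    by move=> x _; rewrite gee0_abs// lee_fin -expr2 sqr_ge0.
  rewrite -[LHS]fineK; last exact: integrable_fin_num (L2_mul_integrable f f).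
  by rewrite -[fine _]/(L2_inner f f) f0.
have mff : measurable_fun setT (fun x => (f x * f x)%:E).
  by apply/measurable_EFinP; apply: measurable_funM; exact: L2_measurable.
move/(ae_eq_integral_abs mu measurableT mff) : int0.
apply: filterS2 L2_zeroE => x f00 /(_ I) [/eqP].
by rewrite mulf_eq0 orbb => /eqP ->; rewrite f00.
Qed.

HB.instance Definition _ := @Lmodule_isPreHilbert.Build R L2
  L2_inner innerC innerDl innerZl inner_ge0 inner_eq0.

End L2.
Coercion L2_fun : L2 >-> Funclass.

(* V^n with inner product \sum_i (p_i, q_i). *)
Section nfold.
Context (R : realType) (V : preHilbertType R) (n : nat).

Definition nfold : Type := {ffun 'I_n -> V}.
HB.instance Definition _ := GRing.Lmodule.copy nfold {ffun 'I_n -> V}.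

Definition nfold_inner (p q : nfold) : R :=
  \sum_i inner ((p : {ffun 'I_n -> V}) i) ((q : {ffun 'I_n -> V}) i).
Let innerC p q : nfold_inner p q = nfold_inner q p.
Proof. by apply: eq_bigr => i _; rewrite innerC. Qed.

Let innerDl p q r :
  nfold_inner (p + q) r = nfold_inner p r + nfold_inner q r.
Proof.
by rewrite /nfold_inner -big_split; apply: eq_bigr => i _; rewrite ffunE innerDl.
Qed.

Let innerZl a p q : nfold_inner (a *: p) q = a * nfold_inner p q.
Proof.
by rewrite /nfold_inner mulr_sumr; apply: eq_bigr => i _; rewrite ffunE innerZl.
Qed.

Let inner_ge0 p : 0 <= nfold_inner p p.
Proof. by apply: sumr_ge0 => i _; rewrite inner_norm sqr_ge0. Qed.

Let inner_eq0 p : nfold_inner p p = 0 -> p = 0.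
Proof.
move=> /eqP; rewrite psumr_eq0 => [/allP p0|i _]; last first.
  by rewrite inner_norm sqr_ge0.
apply/ffunP => i; rewrite ffunE; apply/eqP.
have := p0 i; rewrite mem_index_enum inner_norm => /(_ isT).
by rewrite implyTb sqrf_eq0 normr_eq0.
Qed.

HB.instance Definition _ := @Lmodule_isPreHilbert.Build R nfold
  nfold_inner innerC innerDl innerZl inner_ge0 inner_eq0.

End nfold.

Section operators.
Context (R : realType).

Definition bounded_op (U V : normedModType R) (f : U -> V) :=
  exists K : R, forall u, `|f u| <= K * `|u|.

Definition selfadjoint (V : preHilbertType R) (f : V -> V) :=
  forall u v, inner (f u) v = inner u (f v).

Definition positive_op (V : preHilbertType R) (f : V -> V) :=
  forall u, u != 0 -> 0 < inner (f u) u.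

Definition positive_definite_op (V : preHilbertType R) (f : V -> V) :=
  exists2 alpha : R, 0 < alpha & forall u, alpha * `|u| ^+ 2 <= inner (f u) u.

Definition bounded_inverse (V : preHilbertType R) (f g : V -> V) :=
  [/\ cancel f g, cancel g f & bounded_op g].

Definition separable (T : topologicalType) :=
  exists2 A : set T, countable A & dense A.

Record dual (V : normedModType R) := Dual {
  dual_fun :> {linear V -> R^o} ;
  _ : bounded_op dual_fun }.

Section riesz.
Variable V : preHilbertType R.

Lemma inner0l (u : V) : inner 0 u = 0.
Proof. by rewrite -(scale0r (0 : V)) innerZl mul0r. Qed.

Lemma inner_lin (u : V) : linear (fun v : V => inner v u : R^o).
Proof. by move=> a v w; rewrite innerDl innerZl. Qed.

Lemma Cauchy_Schwarz (u v : V) : `|inner u v| <= `|u| * `|v|.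
Proof.
wlog uv0 : u / 0 <= inner u v => [H|].
  have [|/ltW uv0] := leP 0 (inner u v); first exact: H.
  have Nuv : inner (- u) v = - inner u v by rewrite -scaleN1r innerZl mulN1r.
  by rewrite -(normrN (inner u v)) -Nuv -(normrN u) H// Nuv oppr_ge0.
rewrite ger0_norm//; have [->|v0] := eqVneq v 0.
  by rewrite innerC inner0l mulr_ge0.
have vv0 : 0 < `|v| ^+ 2 by rewrite exprn_gt0// normr_gt0.
have : 0 <= inner (`|v| ^+ 2 *: u + - inner u v *: v)
                  (`|v| ^+ 2 *: u + - inner u v *: v).
  by rewrite inner_norm sqr_ge0.
rewrite innerDl !innerZl ![inner _ (_ + _)]innerC !innerDl !innerZl.
rewrite (innerC v u) !inner_norm => h.
rewrite -(@ler_pXn2r _ 2)// ?nnegrE ?mulr_ge0// exprMn.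
rewrite -(ler_pM2l vv0) -subr_ge0; apply: le_trans h _.
by rewrite le_eqVlt; apply/orP; left; apply/eqP; ring.
Qed.

Let inner_linear (u : V) : {linear V -> R^o} :=
  HB.pack (fun v : V => inner v u : R^o)
    (GRing.isLinear.Build R V R^o _ (fun v : V => inner v u : R^o) (inner_lin u)).

Let inner_bounded (u : V) : bounded_op (inner_linear u).
Proof. by exists `|u| => v; rewrite mulrC; exact: Cauchy_Schwarz. Qed.

Definition riesz (u : V) : dual V := Dual (@inner_bounded u).

Lemma rieszE (u v : V) : riesz u v = inner v u. Proof. by []. Qed.

End riesz.

(* The transpose C^t : V' -> U, with U identified with its dual as in
   \int v (C^t w) = <C v, w>. For U complete and C bounded the defining set is a
   singleton (Riesz), so the default value 0 is irrelevant. *)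
Definition transpose (U : preHilbertType R) (V : normedModType R) (C : U -> V)
    (w : dual V) : U :=
  xget 0 [set g | forall v, inner v g = w (C v)].

End operators.

Section domains.
Context (R : realType) (n : nat).

Definition dotmul (u v : 'rV[R]_n) : R := \sum_i u 0 i * v 0 i.

(* Near each boundary point, in orthonormal coordinates with last axis nu, D is
   the strict epigraph of a Lipschitz function of the other coordinates: gamma is
   constant along nu, hence a function on the hyperplane orthogonal to nu. *)
Definition lipschitz_boundary (D : set 'rV[R]_n) :=
  forall x0, (closure D `\` D°) x0 ->
  exists (nu : 'rV[R]_n) (gamma : 'rV[R]_n -> R) (L r : R),
  [/\ dotmul nu nu = 1,
      0 < r,
      L.-lipschitz gamma,
      (forall x t, gamma (x + t *: nu) = gamma x) &
      forall x, ball x0 r x -> (D x <-> gamma x < dotmul x nu)].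

Record lipschitzDomain := LipschitzDomain {
  dom :> set 'rV[R]_n ;
  dom_open : open dom ;
  dom_connected : connected dom ;
  dom_nonempty : dom !=set0 ;
  dom_lipschitz : lipschitz_boundary dom }.

(* 'D_(delta_mx 0 i) is the partial derivative with respect to the i-th
   coordinate; s lists the coordinates of an iterated partial derivative. *)
Definition partials (phi : 'rV[R]_n -> R) (s : seq 'I_n) : 'rV[R]_n -> R :=
  foldr (fun i g => 'D_(delta_mx 0 i) g) phi s.

Definition smooth (phi : 'rV[R]_n -> R) := forall s,
  continuous (partials phi s) /\
  forall i x, derivable (partials phi s) x (delta_mx 0 i).

Definition test_function (D : set 'rV[R]_n) (phi : 'rV[R]_n -> R) :=
  let supp := closure [set x | phi x != 0] in
  [/\ smooth phi, compact supp & supp `<=` D].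

(* Continuous on each of finitely many disjoint open pieces that fill D up to a
   Lebesgue-null set. *)
Definition piecewise_continuous (D : set 'rV[R]_n) (c : 'rV[R]_n -> R) :=
  exists (k : nat) (U : 'I_k -> set 'rV[R]_n),
  [/\ forall i, open (U i) /\ U i `<=` D,
      trivIset setT U,
      lebesgue_row (D `\` \bigcup_i U i) = 0%E &
      forall i x, U i x -> {for x, continuous c}].

End domains.

Section Hdiv.
Context (R : realType) (n : nat) (D : lipschitzDomain R n).

(* Lebesgue measure of A `&` D: L2 (lebesgue_on D) is L^2(D), values outside D
   being irrelevant. *)
Definition lebesgue_on : {measure set 'rV[R]_n -> \bar R} :=
  mrestr (@lebesgue_row R n) (open_measurable_row (@dom_open R n D)).

Local Notation mu := lebesgue_on.

Definition weak_divergence (q : nfold (L2 mu) n) (d : L2 mu) :=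
  forall phi, test_function D phi ->
    \int[mu]_x (\sum_i q i x * 'D_(delta_mx 0 i) phi x) =
    - \int[mu]_x (d x * phi x).

(* H(div; D): the weak divergence, unique when it exists, is carried along. *)
Record Hdiv := MkHdiv {
  field_of :> nfold (L2 mu) n ;
  div : L2 mu ;
  divP : weak_divergence field_of div }.

End Hdiv.

Notation L2D D := (L2 (lebesgue_on D)).
Notation L2Dn D n := (nfold (L2 (lebesgue_on D)) n).

Section mixed_problem.
Context (R : realType) (n : nat) (D : lipschitzDomain R n).
Variables (A : 'rV[R]_n -> 'M[R]_n) (c : 'rV[R]_n -> R).

Local Notation mu := (lebesgue_on D).
Local Notation H := (Hdiv D).

(* a_ij in L^infinity(D); the values of A outside D are irrelevant, and on D the
   matrix A x is invertible, so that invmx (A x) is its inverse. *)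
Definition elliptic :=
  (forall i j, (fun x => A x i j) \in Lfun mu +oo%E) /\
  exists2 m0 : R, 0 < m0 &
    forall x, dom D x -> forall xi : 'I_n -> R,
      m0 * (\sum_i xi i ^+ 2) <= \sum_i \sum_j A x i j * xi i * xi j.

Definition value_at (q : L2Dn D n) (x : 'rV[R]_n) : 'cV[R]_n :=
  \col_i q i x.

Definition form_a (q1 q2 : H) : R :=
  \int[mu]_x \sum_i (invmx (A x) *m value_at q1 x) i 0 * value_at q2 x i 0.

Definition form_astar (q1 q2 : H) : R := form_a q2 q1.

Definition form_b (q : H) (v : L2D D) : R := - \int[mu]_x (v x * div q x).

Definition form_m (v1 v2 : L2D D) : R := \int[mu]_x (c x * v1 x * v2 x).

Definition is_state (f : L2D D) (j : H) (phi : L2D D) :=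
  (forall q, form_a j q + form_b q phi = 0) /\
  (forall v, form_b j v - form_m phi v = - \int[mu]_x (f x * v x)).

End mixed_problem.

Section bochner.
Context d (Omega : measurableType d) (R : realType) (P : probability Omega R).

(* Omega supports two uncorrelated centred real random variables of variance 1. *)
Definition uncorrelated_pair := exists x1 x2 : Omega -> R,
  [/\ x1 \in Lfun P 2%:E /\ x2 \in Lfun P 2%:E,
      ('E_P[x1] = 0)%E /\ ('E_P[x2] = 0)%E,
      ('E_P[(x1 \* x1)%R] = 1)%E /\ ('E_P[(x2 \* x2)%R] = 1)%E &
      ('E_P[(x1 \* x2)%R] = 0)%E].

Variable V : normedModType R.

Definition simple (s : Omega -> V) :=
  finite_set (range s) /\ forall v, measurable (s @^-1` [set v]).

Definition simple_integral (s : Omega -> V) : V :=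
  \sum_(v \in range s) fine (P (s @^-1` [set v])) *: v.

Definition strongly_measurable (X : Omega -> V) :=
  exists2 s : nat -> Omega -> V, forall k, simple (s k) &
    forall w, s k w @[k --> \oo] --> X w.

(* X is Bochner integrable with integral m. *)
Definition bochner_mean (X : Omega -> V) (m : V) :=
  exists s : nat -> Omega -> V,
  [/\ forall k, simple (s k),
      (\int[P]_w (`|X w - s k w|)%:E)%E @[k --> \oo] --> 0%E &
      simple_integral (s k) @[k --> \oo] --> m].

Definition bochner_L2 (X : Omega -> V) :=
  strongly_measurable X /\ (\int[P]_w (`|X w| ^+ 2)%:E < +oo)%E.

End bochner.

Section estimation.
Context (R : realType) (n : nat) (D : lipschitzDomain R n).
Local Notation mu := (lebesgue_on D).
Context (H1 H2 : hilbertType R).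
Context dO (Omega : measurableType dO) (P : probability Omega R).
Variables (A : 'rV[R]_n -> 'M[R]_n) (c : 'rV[R]_n -> R).
Variables (Q : L2D D -> L2D D) (f0 l0 : L2D D).
Variables (Q1 : H1 -> H1) (Q2 : H2 -> H2).
Variables (C1 : L2Dn D n -> H1) (C2 : L2D D -> H2).

Definition G0 (f : L2D D) := inner (Q (f - f0)) (f - f0) <= 1.

Definition G1 (eta1 : Omega -> H1) (eta2 : Omega -> H2) :=
  [/\ bochner_L2 P eta1 /\ bochner_L2 P eta2,
      bochner_mean P eta1 0 /\ bochner_mean P eta2 0,
      forall u1 u2, ('E_P[fun w => (inner (eta1 w) u1 * inner (eta2 w) u2)%R] = 0)%E &
      ('E_P[fun w => inner (Q1 (eta1 w)) (eta1 w)] <= 1)%E /\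
      ('E_P[fun w => inner (Q2 (eta2 w)) (eta2 w)] <= 1)%E].

Definition functional_l (f : L2D D) : R := \int[mu]_x (l0 x * f x).

Definition sigma (u1 : H1) (u2 : H2) (kappa : R) : \bar R :=
  ereal_sup [set e | exists f eta1 eta2 (j : Hdiv D) (phi : L2D D),
    [/\ G0 f, G1 eta1 eta2, is_state A c f j phi &
      e = ('E_P[fun w => (`|functional_l f - inner (C1 j + eta1 w) u1
                          - inner (C2 phi + eta2 w) u2 - kappa| ^+ 2)%R])%E]].

Definition optimal (u1 : H1) (u2 : H2) (kappa : R) :=
  sigma u1 u2 kappa =
  ereal_inf [set e | exists v1 v2 k, e = sigma v1 v2 k].

Definition estimate (u1 : H1) (u2 : H2) (kappa : R) : H1 -> H2 -> R :=
  fun y1 y2 => inner y1 u1 + inner y2 u2 + kappa.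

Definition guaranteed_estimate (e : H1 -> H2 -> R) :=
  exists u1 u2 kappa, optimal u1 u2 kappa /\ e = estimate u1 u2 kappa.

Definition estimation_error (u1 : H1) (u2 : H2) (kappa : R) : \bar R :=
  sqrte (sigma u1 u2 kappa).

Definition optimality_system (Qinv : L2D D -> L2D D)
    (z1 : Hdiv D) (z2 : L2D D) (p1 : Hdiv D) (p2 : L2D D) :=
  [/\ forall q1, form_astar A z1 q1 + form_b q1 z2 =
        - inner (transpose C1 (riesz (Q1 (C1 p1)))) (q1 : L2Dn D n),
      forall v1, - form_b z1 v1 + form_m c z2 v1 =
        inner (transpose C2 (riesz (Q2 (C2 p2)))) v1,
      forall q2, form_a A p1 q2 + form_b q2 p2 = 0 &
      forall v2, - form_b p1 v2 + form_m c p2 v2 = inner v2 (Qinv (l0 - z2))].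

End estimation.

(* Main.v *)
(* Let V be the orthogonal complement of the graph of the weak divergence.  By
   the uniform boundedness principle, solvability of the state problem for every
   right-hand side yields a Poincare inequality on V, so the adjoint problem is
   solvable by Lax-Milgram on V.  With r = Q^-1 (l0 - z2), S the state operator
   and K the observation form, the optimality system becomes the coercive
   symmetric equation (Q + S^* K S) r = l0.

   Duality of the state and adjoint problems gives
   l(f) - (C1 j, u1^) - (C2 phi, u2^) = (l0 - z2, f) for every state (j, phi),
   so sigma(u^, c^) <= l(r) by Cauchy-Schwarz in the Q- and Q_i-forms.
   Conversely, for arbitrary (u, k) the data f0 +- r / sqrt (Q r, r), with noises
   proportional to Q_i^-1 u_i, show that
   sigma(u, k) >= l(r) + sum_i (Q_i^-1 (u_i - u_i^), u_i - u_i^) + d^2,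
   where d is the error at f0 without noise; this gives optimality, uniqueness
   and the error formula at once. *)
From HB Require Import structures.
Require Import Defs.
From mathcomp Require Import all_boot all_order all_algebra.
From mathcomp Require Import ring lra finmap.
From mathcomp Require Import all_classical all_reals all_analysis
  measurable_realfun ess_sup_inf.
Set Implicit Arguments.
Unset Strict Implicit.
Unset Printing Implicit Defensive.
Import Order.TTheory GRing.Theory Num.Theory numFieldNormedType.Exports.
Local Open Scope classical_set_scope.
Local Open Scope ring_scope.

(** The coefficient [c] may vanish, so the forms of the problem do not by themselves bound the
    potential in L^2(D); the inequality on V supplies that bound. It applies because a state
    satisfies (A^-1 j, -phi) in V: V is the closed graph of the gradient with zero boundary values,
    and on it the mixed problem becomes an ordinary coercive problem in the potential. The
    divergence is expressed throughout as orthogonality to the pairs (grad phi, phi) of test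
    functions, so H(div; D) is handled as a closed subspace of a Hilbert sum.

    The lower bound for sigma rests on three elementary facts. The larger of (d + t e)^2 and (d - t
    e)^2 is at least d^2 + t^2 e^2, which is why both signs of the perturbation are used. The least
    favourable noises are scalar random variables times fixed vectors, so two uncorrelated variables
    of unit variance realise both of them at once. Finally, with rho = (Q r, r), e^2 / rho >= rho -
    2 del for e = rho - del; this completes the squares in u without any minimisation over u. *)

Section prehilbert.
Context {R : realType} {V : preHilbertType R}.
Implicit Types u v w : V.

Lemma innerDr u v w : inner u (v + w) = inner u v + inner u w.
Proof. by rewrite innerC innerDl !(innerC _ u). Qed.

Lemma innerZr a u v : inner u (a *: v) = a * inner u v.
Proof. by rewrite innerC innerZl innerC. Qed.

Lemma innerNl u v : inner (- u) v = - inner u v.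
Proof. by rewrite -scaleN1r innerZl mulN1r. Qed.

Lemma innerNr u v : inner u (- v) = - inner u v.
Proof. by rewrite innerC innerNl innerC. Qed.

Lemma innerBl u v w : inner (u - v) w = inner u w - inner v w.
Proof. by rewrite innerDl innerNl. Qed.

Lemma innerBr u v w : inner u (v - w) = inner u v - inner u w.
Proof. by rewrite innerDr innerNr. Qed.

Lemma inner0r u : inner u 0 = 0.
Proof. by rewrite innerC inner0l. Qed.

Lemma inner_ge0 u : 0 <= inner u u.
Proof. by rewrite inner_norm sqr_ge0. Qed.

Lemma inner_eq0 u : inner u u = 0 -> u = 0.
Proof.
by move=> /eqP; rewrite inner_norm sqrf_eq0 normr_eq0 => /eqP.
Qed.

Lemma inner_inj u v : (forall w, inner u w = inner v w) -> u = v.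
Proof.
move=> uv; apply/eqP; rewrite -subr_eq0; apply/eqP/inner_eq0.
by rewrite innerBl uv subrr.
Qed.

Lemma inner_le u v : inner u v <= `|u| * `|v|.
Proof. exact: le_trans (ler_norm _) (Cauchy_Schwarz u v). Qed.

Lemma continuous_inner v : continuous (inner^~ v : V -> R).
Proof.
move=> u; apply/cvgrPdist_lt => e e0.
have d0 : 0 < e / (`|v| + 1) by rewrite divr_gt0// ltr_wpDl.
near=> w; rewrite -innerBl (le_lt_trans (Cauchy_Schwarz _ _))//.
have : `|u - w| < e / (`|v| + 1).
  by near: w; apply: (@cvgr_dist_lt _ _ _ (nbhs u) _ id).
rewrite ltr_pdivlMr ?ltr_wpDl//; apply: le_lt_trans.
by rewrite ler_wpM2l// lerDl.
Unshelve. all: by end_near. Qed.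

Lemma closed_orthogonal (T : set V) :
  closed [set u | forall t, T t -> inner u t = 0].
Proof.
rewrite (_ : [set u | _] = \bigcap_(t in T) [set u | inner u t = 0])//.
apply: closed_bigI => t _; apply: (@preimage_closed _ _ (inner^~ t) [set 0]).
  by move=> u _; exact: continuous_inner.
exact: closed_eq.
Qed.

End prehilbert.

Lemma hilbert_cauchy_cvg (R : realType) (V : hilbertType R) (u : nat -> V) :
  (forall e, 0 < e -> exists N, forall m n, (N <= m)%N -> (N <= n)%N ->
     `|u m - u n| <= e) ->
  cvg (u n @[n --> \oo]).
Proof.
move=> uC; apply: cauchy_cvg; apply/cauchy_exP => e e0.
have [N uN] := uC (e / 2) (divr_gt0 e0 (ltr0Sn _ 1)).
exists (u N); exists N => //= m Nm.
rewrite -ball_normE /ball_/= (le_lt_trans (uN _ _ (leqnn N) Nm))//.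
by rewrite gtr_pMr// invf_lt1// ltr1n.
Qed.

(** * Variational problems in Hilbert spaces *)

Section variational.
Context {R : realType} {V : hilbertType R}.
Implicit Types (u v w : V) (W : set V) (b : V -> V -> R) (l : V -> R).

Definition is_subspace W := W 0 /\ forall a u v, W u -> W v -> W (a *: u + v).

Definition bilinear_form b :=
  (forall a u v w, b (a *: u + v) w = a * b u w + b v w) /\
  (forall a u v w, b w (a *: u + v) = a * b w u + b w v).

Definition linear_form l := forall a u v, l (a *: u + v) = a * l u + l v.

(** First-order condition at a minimum. The step [- d / (g + 1)] is the minimiser of the parabola up
    to a shift of [g] by 1, which covers [g = 0]; there the value is - d^2 (g + 2) / (g + 1)^2. *)
Lemma quadratic_ge0 (d g : R) : 0 <= g ->
  (forall t, 0 <= t * d *+ 2 + t ^+ 2 * g) -> d = 0.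
Proof.
move=> g0 /(_ (- d / (g + 1))) h.
have g1 : 0 < g + 1 by rewrite ltr_wpDl.
have : 0 <= - (d ^+ 2 * (g + 2)).
  have -> : - (d ^+ 2 * (g + 2)) = (g + 1) ^+ 2 *
      (- d / (g + 1) * d *+ 2 + (- d / (g + 1)) ^+ 2 * g).
    by field; rewrite gt_eqF.
  by rewrite mulr_ge0 ?sqr_ge0.
rewrite oppr_ge0 pmulr_lle0; last by rewrite ltr_wpDl.
by move=> d0; apply/eqP; rewrite -sqrf_eq0 eq_le d0 sqr_ge0.
Qed.

(* The solution minimises [b v v - 2 * l v] over [W]. *)
Lemma symmetric_lax_milgram W b l (alpha K : R) :
  closed W -> is_subspace W -> bilinear_form b -> linear_form l ->
  (forall u v, b u v = b v u) ->
  0 < alpha -> (forall u, W u -> alpha * `|u| ^+ 2 <= b u u) ->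
  (forall u v, `|b u v| <= K * `|u| * `|v|) -> (forall u, `|l u| <= K * `|u|) ->
  exists2 u, W u & forall v, W v -> b u v = l v.
Proof.
move=> clW [W0 WD] [bl br] ll bC alpha0 bco bb lb.
pose J v := b v v - l v *+ 2.
have Jlb v : W v -> - (K ^+ 2 / alpha) <= J v.
  move=> Wv; have := bco v Wv; have := le_trans (ler_norm _) (lb v).
  rewrite /J => h1 h2.
  have : 0 <= alpha * (`|v| - K / alpha) ^+ 2 by rewrite mulr_ge0 ?sqr_ge0// ltW.
  rewrite (_ : alpha * _ = alpha * `|v| ^+ 2 - K * `|v| *+ 2 + K ^+ 2 / alpha).
    by lra.
  by field; rewrite gt_eqF.
pose S := [set J v | v in W].
have Sinf : has_inf S.
  split; first by exists (J 0), 0.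
  by exists (- (K ^+ 2 / alpha)) => _ [v Wv <-]; exact: Jlb.
pose m := inf S.
have mJ v : W v -> m <= J v by move=> Wv; apply: ge_inf; [case: Sinf|exists v].
have JD u v t : J (u + t *: v) = J u + t * (b u v - l v) *+ 2 + t ^+ 2 * b v v.
  rewrite /J (addrC u) bl br !br (bC v u) ll; ring.
have /choice[u_ uP] : forall k : nat, exists u, W u /\ J u < m + k.+1%:R^-1.
  move=> k; have [|_ [v Wv <-] Jv] := @inf_adherent _ S k.+1%:R^-1 _ Sinf.
    by rewrite invr_gt0.
  by exists v.
have uW k : W (u_ k) := (uP k).1.
(* Parallelogram identity for [J]: its value at the midpoint of [u] and [v] is at least [m], so a
   minimising sequence is Cauchy. *)
have J2 u v : W u -> W v -> alpha * `|u - v| ^+ 2 <= (J u + J v - m *+ 2) *+ 2.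
  move=> Wu Wv; have Wd : W (u - v).
    by rewrite -[u]scale1r -scaleN1r addrC; apply: WD; rewrite ?scale1r.
  have Wh : W (v + 2^-1 *: (u - v)) by rewrite addrC; apply: WD.
  have := JD v (u - v) 1; rewrite scale1r subrKC => ->.
  by apply: le_trans (bco _ Wd) _; have := mJ _ Wh; rewrite JD; lra.
have cu : cvg (u_ k @[k --> \oo]).
  apply: hilbert_cauchy_cvg => e e0.
  have [N Ne] : exists N : nat, N.+1%:R^-1 <= alpha * e ^+ 2 / 4.
    have h : 0 < alpha * e ^+ 2 / 4 by rewrite !mulr_gt0// exprn_gt0.
    have [k] := ltr_add_invr h; rewrite add0r => /ltW ke; by exists k.
  exists N => i j Ni Nj; rewrite -(@ler_pXn2r _ 2)// ?nnegrE ?(ltW e0)//.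
  rewrite -(ler_pM2l alpha0); apply: le_trans (J2 _ _ (uW i) (uW j)) _.
  have Hk k : (N <= k)%N -> J (u_ k) <= m + alpha * e ^+ 2 / 4.
    move=> Nk; apply: ltW; apply: lt_le_trans (uP k).2 _; rewrite lerD2l.
    by apply: le_trans Ne; rewrite lef_pV2 ?posrE// ler_nat.
  have := Hk i Ni; have := Hk j Nj; lra.
pose u := lim (u_ k @[k --> \oo]).
have Wu : W u by apply: closed_cvg cu => //; exact: nearW.
exists u => // v Wv; apply/eqP; rewrite -subr_eq0; apply/eqP.
have bvv : 0 <= b v v.
  by apply: le_trans (bco _ Wv); rewrite mulr_ge0 ?sqr_ge0 ?ltW.
apply: (quadratic_ge0 bvv) => t.
have K0 : 0 <= K * `|v| := le_trans (normr_ge0 _) (lb v).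
apply/ler_addgt0Pr => e e0.
(* Only the term [b (u_ k) v] is passed to the limit. [M] is chosen so that replacing [u_ k] by [u]
   in it costs at most [e / 2]; the other half pays for the gap 1/(k+1) between [J (u_ k)] and
   [m]. *)
pose M := (`|t| * (K * `|v|)) *+ 2 + 1.
have M0 : 0 < M by rewrite ltr_wpDl// mulrn_wge0// mulr_ge0.
have eM : 0 < e / 2 / M by rewrite !divr_gt0.
have [N1 _ HN1] : \forall k \near \oo, `|u - u_ k| < e / 2 / M.
  exact: cvgr_dist_lt.
have [N2 N2e] : exists N : nat, N.+1%:R^-1 < e / 2.
  by have [|k] := @ltr_add_invr _ 0 (e / 2); rewrite ?divr_gt0// add0r; exists k.
pose k := maxn N1 N2.
have := mJ (u_ k + t *: v); rewrite addrC => /(_ (WD _ _ _ Wv (uW k))).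
rewrite addrC JD => h1; have h2 := (uP k).2.
have h3 : k.+1%:R^-1 < e / 2.
  apply: le_lt_trans N2e; rewrite lef_pV2 ?posrE// ler_nat ltnS.
  exact: leq_maxr.
have h4 : `|t * (b u v - b (u_ k) v)| *+ 2 <= e / 2.
  have -> : b u v - b (u_ k) v = b (u - u_ k) v.
    by rewrite -(scaleN1r (u_ k)) (addrC u) bl mulN1r addrC.
  have /ltW := HN1 k (leq_maxl _ _); rewrite ler_pdivlMr// => h.
  rewrite normrM; have := ler_wpM2l (normr_ge0 t) (bb (u - u_ k) v).
  move=> h5; apply: le_trans h; apply: le_trans (_ : (`|t| * (K * `|u - u_ k| * `|v|)) *+ 2 <= _).
    by rewrite lerMn2r h5 orbT.
  rewrite /M mulrDr mulr1 -[leLHS]addr0 lerD//.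
  by rewrite le_eqVlt; apply/orP; left; apply/eqP; ring.
have := ler_norm (- (t * (b u v - b (u_ k) v))); rewrite normrN => h5.
move: h1 h2 h3 h4 h5; move: (k.+1%:R^-1) (b u v) (b (u_ k) v) => x y z.
by clear; lra.
Qed.

Lemma riesz_subspace W l K : closed W -> is_subspace W -> linear_form l ->
  (forall u, `|l u| <= K * `|u|) ->
  exists2 u, W u & forall v, W v -> inner u v = l v.
Proof.
move=> clW sW ll lb.
(* One constant has to bound both the form, where 1 suffices, and [l], where [|K|] does. *)
apply: (@symmetric_lax_milgram W _ l 1 (`|K| + 1)) => //.
- split=> [a u v w|a u v w]; first by rewrite innerDl innerZl.
  by rewrite innerDr innerZr.
- exact: innerC.
- by move=> u _; rewrite mul1r inner_norm.
- move=> u v; apply: le_trans (Cauchy_Schwarz _ _) _.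
  by rewrite ler_wpM2r// ler_peMl// lerDr.
- move=> u; apply: le_trans (lb u) _; rewrite ler_wpM2r//.
  by apply: le_trans (ler_norm _) _; rewrite lerDl.
Qed.

(** Without symmetry there is no functional to minimise. The solution is the fixed point of u + tau
    * rho u, where rho u in [W] represents the residual l - b u; this map is a contraction for small
    tau. *)
Lemma lax_milgram W b l (alpha K : R) :
  closed W -> is_subspace W -> bilinear_form b -> linear_form l ->
  0 < alpha -> (forall u, W u -> alpha * `|u| ^+ 2 <= b u u) ->
  (forall u v, `|b u v| <= K * `|u| * `|v|) -> (forall u, `|l u| <= K * `|u|) ->
  exists2 u, W u & forall v, W v -> b u v = l v.
Proof.
move=> clW sW [bl br] ll alpha0 bco bb lb.
have [W0 WD] := sW.
(* Raising the bound to at least [alpha] keeps [alpha / k <= 1], so that the contraction constant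
   [q] below is the root of a nonnegative number. *)
pose k := Num.max `|K| alpha.
have k0 : 0 < k by rewrite lt_max alpha0 orbT.
have ak : alpha <= k by rewrite le_max lexx orbT.
have Kk : K <= k by rewrite le_max ler_norm.
have rP u : exists w, W w /\ forall v, W v -> inner w v = l v - b u v.
  have [||w Ww wP] := @riesz_subspace W (fun v => l v - b u v) (k + k * `|u|) clW sW.
  - by move=> a v w; rewrite ll br; ring.
  - move=> v; apply: le_trans (ler_normB _ _) _; rewrite mulrDl lerD//.
      by apply: le_trans (lb v) _; rewrite ler_wpM2r.
    by apply: le_trans (bb u v) _; rewrite !ler_wpM2r.
  - by exists w.
have {rP}[rho rhoP] := choice rP.
(* This value minimises 1 - 2 tau alpha + tau^2 k^2, the bound for the squared Lipschitz constant,
   and makes it 1 - (alpha / k)^2. *)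
pose tau := alpha / k ^+ 2.
pose f u := u + tau *: rho u.
have Wf : {homo f : u / W u >-> W u}.
  by move=> u Wu; rewrite /f addrC; apply: WD => //; exact: (rhoP u).1.
pose F : {fun W >-> W} := HB.pack f (isFun.Build _ _ W W f Wf).
pose q := Num.sqrt (1 - (alpha / k) ^+ 2).
have ak1 : alpha / k <= 1 by rewrite ler_pdivrMr// mul1r.
have ak0 : 0 < alpha / k by rewrite divr_gt0.
have q2 : 0 <= 1 - (alpha / k) ^+ 2.
  by rewrite subr_ge0 expr_le1// ltW.
have q0 : 0 <= q by exact: sqrtr_ge0.
have [||u Wu uF] := @banach_fixed_point R V W F _ clW.
- exists (NngNum q0); split => /=.
    rewrite -sqrtr1 ltr_sqrt// ltrBlDr ltrDl exprn_gt0//.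
  move=> [u v] [/= Wu Wv].
  pose d := u - v; pose t := rho v - rho u.
  have Wdiff x y : W x -> W y -> W (x - y).
    by move=> Wx Wy; rewrite addrC -scaleN1r; apply: WD.
  have Wd : W d by exact: Wdiff.
  have Wt : W t by apply: Wdiff; [exact: (rhoP v).1|exact: (rhoP u).1].
  have tE w : W w -> inner t w = b d w.
    move=> Ww; rewrite /t innerBl (rhoP u).2// (rhoP v).2// /d.
    by rewrite -(scaleN1r v) (addrC u) bl; ring.
  have tk : `|t| <= k * `|d|.
    have [->|t0] := eqVneq t 0; first by rewrite normr0 mulr_ge0// ltW.
    have t0' : 0 < `|t| by rewrite normr_gt0.
    rewrite -(ler_pM2r t0') -expr2 -inner_norm tE//.
    apply: le_trans (ler_norm _) _; apply: le_trans (bb d t) _.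
    by rewrite !ler_wpM2r.
  have -> : f u - f v = d - tau *: t.
    rewrite /f /d /t scalerBr opprB opprD !addrA; congr (_ + _).
    by rewrite -!addrA; congr (_ + _); rewrite addrC.
  rewrite -[leLHS]/`|_| -(@ler_pXn2r _ 2)// ?nnegrE ?mulr_ge0//.
  rewrite exprMn sqr_sqrtr// -inner_norm.
  rewrite (innerBl d) !(innerBr _ d) !innerZl !innerZr (innerC d t) tE// !inner_norm.
  have h1 := bco d Wd.
  have h2 : `|t| ^+ 2 <= k ^+ 2 * `|d| ^+ 2.
    by rewrite -exprMn ler_pXn2r// nnegrE ?mulr_ge0// ltW.
  have tau0 : 0 < tau by rewrite divr_gt0// exprn_gt0.
  have h3 := ler_wpM2l (ltW tau0) h1.
  have h4 := ler_wpM2l (sqr_ge0 tau) h2.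
  have h5 : tau ^+ 2 * (k ^+ 2 * `|d| ^+ 2) = tau * (alpha * `|d| ^+ 2).
    by rewrite /tau; field; rewrite gt_eqF.
  have h6 : (alpha / k) ^+ 2 * `|d| ^+ 2 = tau * (alpha * `|d| ^+ 2).
    by rewrite /tau; field; rewrite gt_eqF.
  rewrite mulrBl h6; move: h3 h4 h5; move: (b d d) (`|d|) (`|t|) => x y z.
  lra.
- by exists 0.
- exists u => // v Wv; apply/eqP; rewrite eq_sym -subr_eq0 -(rhoP u).2//.
  have : tau *: rho u = 0.
    by apply: (addrI u); rewrite addr0 [RHS]uF.
  move/eqP; rewrite scaler_eq0 gt_eqF ?divr_gt0 ?exprn_gt0//= => /eqP ->.
  by rewrite inner0l.
Qed.

End variational.

(** * Completeness of finite direct sums *)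

Section completeness.
Context {R : realType}.

(** A Cauchy filter contains balls of radius 2^-(k+2) for every k. Two consecutive ones meet, so
    their centres form a sequence of the required speed, and its limit is a limit of the filter.
    Completeness of the spaces below is thereby reduced to such sequences. *)
Lemma fast_cauchy_complete (V : normedModType R) :
  (forall u : nat -> V, (forall k, `|u k.+1 - u k| <= 2^-1 ^+ k) ->
     cvg (u k @[k --> \oo])) ->
  forall F : set_system V, ProperFilter F -> cauchy F -> cvg F.
Proof.
move=> fast F FF /cauchyP FC.
have h0 k : 0 < 2^-1 ^+ k.+2 :> R by rewrite exprn_gt0// invr_gt0.
have /choice[u uF] k : exists x, F (ball x (2^-1 ^+ k.+2)) by exact: FC.
have /fast cu : forall k, `|u k.+1 - u k| <= 2^-1 ^+ k.
  move=> k; have [x []] := filter_ex (filterI (uF k) (uF k.+1)).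
  rewrite -ball_normE /ball_/= => h1 h2; rewrite -(subrKA x).
  apply: le_trans (ler_normD _ _) _; rewrite (distrC x).
  have hk : 0 < 2^-1 ^+ k :> R by rewrite exprn_gt0// invr_gt0.
  move: h1 h2; rewrite !exprS; lra.
apply/cvg_ex; exists (lim (u k @[k --> \oo])); apply/cvgrPdist_lt => e e0.
have e2 : 0 < e / 2 by rewrite divr_gt0.
have [N1 _ HN1] := cvgr_dist_lt _ _ cu _ e2.
have [N2 _ HN2] : \forall k \near \oo, (2^-1 : R) ^+ k < e / 2.
  have half1 : `|2^-1 : R| < 1 by rewrite ger0_norm// invf_lt1// ltr1n.
  have h := cvg_expr half1.
  apply: filterS (cvgr_dist_lt _ _ h _ e2) => k.
  by rewrite sub0r normrN ger0_norm// exprn_ge0.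
pose k := maxn N1 N2.
apply: filterS (uF k) => x; rewrite -ball_normE /ball_/= => h.
rewrite -(subrKA (u k)) (splitr e); apply: le_lt_trans (ler_normD _ _) _.
apply: ltrD; first by apply: HN1; exact: leq_maxl.
apply: lt_trans h _; apply: HN2 => /=; rewrite /k.
by rewrite (leq_trans (leq_maxr N1 N2))// -addn2 leq_addr.
Qed.

Lemma fast_cauchy_cvg (V : completeNormedModType R) (u : nat -> V) :
  (forall k, `|u k.+1 - u k| <= 2^-1 ^+ k) -> cvg (u k @[k --> \oo]).
Proof.
move=> uk; have -> : (fun k => u k) = (fun k => u 0%N + series (telescope u) k).
  by apply/funext => k; rewrite -eq_sum_telescope.
apply: is_cvgD; first exact: is_cvg_cst.
apply: normed_cvg; apply: (@series_le_cvg _ _ (geometric (1 : R) 2^-1)).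
- by move=> k /=.
- by move=> k /=; rewrite mul1r exprn_ge0.
- by move=> k /=; rewrite mul1r; exact: uk.
- by apply: is_cvg_geometric_series; rewrite ger0_norm// invf_lt1// ltr1n.
Qed.

End completeness.

Section nfold_complete.
Context {R : realType} {V : hilbertType R} {n : nat}.

Local Notation V_n := (nfold V n).

Lemma nfold_normE (p : V_n) :
  `|p| ^+ 2 = \sum_i `|(p : {ffun 'I_n -> V}) i| ^+ 2.
Proof. by rewrite -inner_norm; apply: eq_bigr => i _; rewrite inner_norm. Qed.

Lemma nfold_norm_le (p : V_n) i : `|(p : {ffun 'I_n -> V}) i| <= `|p|.
Proof.
rewrite -(@ler_pXn2r _ 2)// ?nnegrE// nfold_normE (bigD1 i)//= lerDl.
by rewrite sumr_ge0// => j _; exact: sqr_ge0.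
Qed.

Lemma nfold_cauchy_cvg (F : set_system V_n) :
  ProperFilter F -> cauchy F -> cvg F.
Proof.
apply: fast_cauchy_complete => u uk.
have cu i : cvg ((u k : {ffun 'I_n -> V}) i @[k --> \oo]).
  apply: fast_cauchy_cvg => k; apply: le_trans (uk k).
  by apply: le_trans (nfold_norm_le _ i); rewrite !ffunE.
pose l : V_n := [ffun i => lim ((u k : {ffun 'I_n -> V}) i @[k --> \oo])].
apply/cvg_ex; exists l; apply/cvgrPdist_lt => e e0.
(* With [n.+1] in place of [n] the sum of the [n] squared errors stays strictly below [e ^+ 2], and
   [n = 0] is covered. *)
have d0 : 0 < Num.sqrt (e ^+ 2 / n.+1%:R) by rewrite sqrtr_gt0 divr_gt0// exprn_gt0.
have : \forall k \near \oo, forall i, `|(l : {ffun _ -> _}) i - (u k : {ffun 'I_n -> V}) i| <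
    Num.sqrt (e ^+ 2 / n.+1%:R).
  apply: filter_forall => i; rewrite ffunE; exact: cvgr_dist_lt.
apply: filterS => k lk; rewrite -(@ltr_pXn2r _ 2)// ?nnegrE ?(ltW e0)//.
rewrite nfold_normE.
apply: (@le_lt_trans _ _ (\sum_(i < n) e ^+ 2 / n.+1%:R)).
  apply: ler_sum => i _; rewrite !ffunE.
  have /ltW := lk i; rewrite ffunE => h.
  rewrite -[leRHS]sqr_sqrtr; last by rewrite divr_ge0// sqr_ge0.
  by rewrite ler_pXn2r// nnegrE.
rewrite sumr_const card_ord -[_ *+ n]mulr_natr mulrAC ltr_pdivrMr// ltr_pM2l ?exprn_gt0//.
by rewrite ltr_nat.
Qed.

HB.instance Definition _ := Uniform_isComplete.Build V_n nfold_cauchy_cvg.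

End nfold_complete.

Section prodh.
Context {R : realType} (U V : preHilbertType R).

(** An alias is used because the product type already carries the max norm, while orthogonality
    requires the Hilbert sum. *)
Definition prodh : Type := (U * V)%type.
HB.instance Definition _ := GRing.Lmodule.copy prodh (U * V)%type.

Definition prodh_inner (p q : prodh) : R := inner p.1 q.1 + inner p.2 q.2.

Let innerC p q : prodh_inner p q = prodh_inner q p.
Proof. by rewrite /prodh_inner innerC (innerC p.2). Qed.

Let innerDl p q r : prodh_inner (p + q) r = prodh_inner p r + prodh_inner q r.
Proof. by rewrite /prodh_inner !innerDl addrACA. Qed.

Let innerZl a p q : prodh_inner (a *: p) q = a * prodh_inner p q.
Proof. by rewrite /prodh_inner !innerZl mulrDr. Qed.

Let innerpp_ge0 p : 0 <= prodh_inner p p.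
Proof. exact: addr_ge0 (inner_ge0 _) (inner_ge0 _). Qed.

Let innerpp_eq0 p : prodh_inner p p = 0 -> p = 0.
Proof.
move=> /eqP; rewrite paddr_eq0 ?inner_ge0// => /andP[/eqP/inner_eq0 p1].
by move=> /eqP/inner_eq0 p2; rewrite [p]surjective_pairing p1 p2.
Qed.

HB.instance Definition _ := @Lmodule_isPreHilbert.Build R prodh
  prodh_inner innerC innerDl innerZl innerpp_ge0 innerpp_eq0.

Lemma prodh_innerE (p q : prodh) : inner p q = inner p.1 q.1 + inner p.2 q.2.
Proof. by []. Qed.

Lemma prodh_normE (p : prodh) : `|p| ^+ 2 = `|p.1| ^+ 2 + `|p.2| ^+ 2.
Proof. by rewrite -!inner_norm. Qed.

Lemma prodh_norm1_le (p : prodh) : `|p.1| <= `|p|.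
Proof. by rewrite -(@ler_pXn2r _ 2)// ?nnegrE// prodh_normE lerDl sqr_ge0. Qed.

Lemma prodh_norm2_le (p : prodh) : `|p.2| <= `|p|.
Proof. by rewrite -(@ler_pXn2r _ 2)// ?nnegrE// prodh_normE lerDr sqr_ge0. Qed.

End prodh.

Section prodh_complete.
Context {R : realType} {U V : hilbertType R}.

Lemma prodh_cauchy_cvg (F : set_system (prodh U V)) :
  ProperFilter F -> cauchy F -> cvg F.
Proof.
apply: fast_cauchy_complete => u uk.
have cu1 : cvg ((u k).1 @[k --> \oo]).
  by apply: fast_cauchy_cvg => k; exact: le_trans (prodh_norm1_le _) (uk k).
have cu2 : cvg ((u k).2 @[k --> \oo]).
  by apply: fast_cauchy_cvg => k; exact: le_trans (prodh_norm2_le _) (uk k).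
pose l : prodh U V := (lim ((u k).1 @[k --> \oo]), lim ((u k).2 @[k --> \oo])).
apply/cvg_ex; exists l; apply/cvgrPdist_lt => e e0.
have d0 : 0 < e / 2 by rewrite divr_gt0.
apply: filterS2 (cvgr_dist_lt _ _ cu1 _ d0) (cvgr_dist_lt _ _ cu2 _ d0) => k h1 h2.
rewrite -(@ltr_pXn2r _ 2)// ?nnegrE ?(ltW e0)// prodh_normE /=.
have := normr_ge0 (l.1 - (u k).1); have := normr_ge0 (l.2 - (u k).2).
move: h1 h2; rewrite /=; move: (`|_|) (`|_|) => x y; nra.
Qed.

HB.instance Definition _ := Uniform_isComplete.Build (prodh U V) prodh_cauchy_cvg.

End prodh_complete.

(** * Abstract mixed problems *)

Section positive_forms.
Context {R : realType}.

Lemma form_Cauchy_Schwarz (V : lmodType R) (b : V -> V -> R) :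
  (forall a u v w, b (a *: u + v) w = a * b u w + b v w) ->
  (forall u v, b u v = b v u) -> (forall u, 0 <= b u u) ->
  forall u v, b u v ^+ 2 <= b u u * b v v.
Proof.
move=> bl bC b0 u v.
have h t : 0 <= b v v + t * b u v *+ 2 + t ^+ 2 * b u u.
  have := b0 (t *: u + v); rewrite bl [b u (_ + _)]bC [b v (_ + _)]bC !bl (bC v u).
  by move=> /le_trans; apply; rewrite le_eqVlt; apply/orP; left; apply/eqP; ring.
(* In the degenerate case the parabola in [t] is affine; a nonzero slope would let it reach -1,
   which is how the value of [t] below is chosen. *)
have [u0|u0] := eqVneq (b u u) 0.
  have [->|y0] := eqVneq (b u v) 0; first by rewrite expr0n/= mulr_ge0.
  have := h (- (b v v + 1) / (b u v *+ 2)); rewrite u0.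
  have -> : b v v + - (b v v + 1) / (b u v *+ 2) * b u v *+ 2 +
    (- (b v v + 1) / (b u v *+ 2)) ^+ 2 * 0 = -1 by field.
  by rewrite ler0N1.
have p : 0 < b u u by rewrite lt_neqAle eq_sym u0 b0.
have := mulr_ge0 (ltW p) (h (- b u v / b u u)).
have -> : b u u * (b v v + - b u v / b u u * b u v *+ 2 +
  (- b u v / b u u) ^+ 2 * b u u) = b u u * b v v - b u v ^+ 2 by field.
by rewrite subr_ge0.
Qed.

Lemma positive_op_ge0 (V : preHilbertType R) (Q : {linear V -> V}) :
  positive_op Q -> forall u, 0 <= inner (Q u) u.
Proof.
move=> Q0 u; have [->|/Q0/ltW//] := eqVneq u 0.
by rewrite linear0 inner0l.
Qed.

Lemma positive_definite_positive (V : preHilbertType R) (Q : V -> V) :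
  positive_definite_op Q -> positive_op Q.
Proof.
move=> [a a0 aQ] u u0; apply: lt_le_trans (aQ u).
by rewrite mulr_gt0// exprn_gt0// normr_gt0.
Qed.

Lemma positive_op_Cauchy_Schwarz (V : preHilbertType R) (Q : {linear V -> V}) :
  selfadjoint Q -> positive_op Q ->
  forall u v, inner (Q u) v ^+ 2 <= inner (Q u) u * inner (Q v) v.
Proof.
move=> Qsa Q0; apply: (@form_Cauchy_Schwarz V (fun u v => inner (Q u) v)).
- by move=> a u v w; rewrite linearP innerDl innerZl.
- by move=> u v; rewrite Qsa innerC.
- exact: positive_op_ge0.
Qed.

Lemma bounded_op_ge0 (U V : normedModType R) (f : U -> V) : bounded_op f ->
  exists2 K, 0 <= K & forall u, `|f u| <= K * `|u|.
Proof.
move=> [K fK]; exists `|K| => // u; apply: le_trans (fK u) _.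
by rewrite ler_wpM2r// ler_norm.
Qed.

(** Cauchy-Schwarz in the [Q]-form, applied to u and Q u, gives |Q u|^2 <= K (Q u, u), and the
    bounded inverse gives |u| <= J |Q u|. The added 1 only keeps the constant invertible. *)
Lemma positive_op_definite (V : preHilbertType R) (Q Qinv : {linear V -> V}) :
  bounded_op Q -> selfadjoint Q -> positive_op Q -> bounded_inverse Q Qinv ->
  positive_definite_op Q.
Proof.
move=> /bounded_op_ge0[K K0 QK] Qsa Q0 [QinvK _ /bounded_op_ge0[J J0 QJ]].
have d0 : 0 < K * J ^+ 2 + 1 by rewrite ltr_wpDl// mulr_ge0// sqr_ge0.
exists (K * J ^+ 2 + 1)^-1 => [|u]; first by rewrite invr_gt0.
rewrite ler_pdivrMl// mulrC; have h0 := positive_op_ge0 Q0 u.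
have h : `|Q u| ^+ 2 <= K * inner (Q u) u.
  have [->|Qu0] := eqVneq (Q u) 0.
    by rewrite normr0 expr0n/= inner0l mulr0.
  have p : 0 < `|Q u| ^+ 2 by rewrite exprn_gt0// normr_gt0.
  rewrite -(ler_pM2r p) -expr2 -{1}inner_norm.
  apply: le_trans (positive_op_Cauchy_Schwarz Qsa Q0 u (Q u)) _.
  rewrite -mulrA (mulrC K) -mulrA ler_wpM2l// (mulrC _ K) expr2 mulrA.
  by apply: le_trans (inner_le _ _) _; rewrite ler_wpM2r.
have h2 : `|u| ^+ 2 <= J ^+ 2 * `|Q u| ^+ 2.
  rewrite -exprMn ler_pXn2r// ?nnegrE ?mulr_ge0//.
  by rewrite -{1}(QinvK u).
apply: le_trans h2 _; have := ler_wpM2l (sqr_ge0 J) h; lra.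
Qed.

Lemma le_of_affine (x y k : R) : 0 <= k ->
  (forall e, 0 < e -> x <= y + k * e) -> x <= y.
Proof.
move=> k0 h; apply/ler_addgt0Pr => e e0.
have k1 : 0 < k + 1 by rewrite ltr_wpDl.
apply: le_trans (h (e / (k + 1)) (divr_gt0 e0 k1)) _; rewrite lerD2l.
by rewrite mulrA ler_pdivrMr// mulrC ler_wpM2l ?(ltW e0)// lerDl.
Qed.

End positive_forms.

Section mixed.
Context {R : realType} {L M : hilbertType R} (T : set (prodh L M)).
Local Notation E := (prodh L M).

(* [T] collects the pairs (grad phi, phi) of test functions, so that [annih T]
   is the graph of the weak divergence and [annih (annih T)] is that of the
   gradient with zero boundary values. *)
Definition annih (S : set E) : set E := [set e | forall t, S t -> inner e t = 0].

Local Notation G := (annih T).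
Local Notation V := (annih G).

Lemma annih_annih S : S `<=` annih (annih S).
Proof. by move=> t St g gS; rewrite innerC; exact: gS. Qed.

Lemma subspace_annih S : is_subspace (annih S).
Proof.
split=> [t _|a u v Su Sv t St]; first by rewrite inner0l.
by rewrite innerDl innerZl Su// Sv// mulr0 addr0.
Qed.

(** The divergence is not an operator on [L]: the second equation, div q = g2 - c phi, is membership
    in its graph. [B] stands for A^-1 in the state problem and for its transpose in the adjoint
    one. *)
Definition mixed (B : L -> L) (c : M -> M) (g1 : L) (g2 : M) (q : L) (phi : M) :=
  (forall e, G e -> inner (B q) e.1 - inner phi e.2 = - inner g1 e.1) /\
  G (q, g2 - c phi).

Lemma mixed_lin (B : {linear L -> L}) (c : {linear M -> M}) a f q phi f' q' phi' :
  mixed B c 0 f q phi -> mixed B c 0 f' q' phi' ->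
  mixed B c 0 (a *: f + f') (a *: q + q') (a *: phi + phi').
Proof.
move=> [h1 h2] [h1' h2']; split=> [e Ge|].
  rewrite linearP !innerDl !innerZl.
  have := h1 e Ge; have := h1' e Ge; rewrite inner0l oppr0.
  move=> /eqP; rewrite subr_eq0 => /eqP-> /eqP; rewrite subr_eq0 => /eqP->.
  by rewrite subrr.
rewrite linearP.
rewrite (_ : (_, _) = a *: ((q, f - c phi) : E) + ((q', f' - c phi') : E)).
  by apply: (subspace_annih T).2.
by congr (_, _); rewrite /= scalerBr addrACA opprD.
Qed.

(** Each solution provides an element of the graph, which is a legitimate test element in the first
    equation of the other problem. Subtracting the two resulting equations cancels the [B] and [c]
    terms. *)
Lemma mixed_duality (B Bt : L -> L) (c : M -> M) f q phi g1 g2 z1 z2 :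
  (forall u v, inner (B u) v = inner u (Bt v)) -> selfadjoint c ->
  mixed B c 0 f q phi -> mixed Bt c g1 g2 z1 z2 ->
  inner z2 f = inner g1 q + inner g2 phi.
Proof.
move=> BBt csa [h1 h2] [h1' h2'].
have /= := h1 _ h2'; have /= := h1' _ h2.
rewrite !innerBr -(csa phi) (innerC (c phi)) inner0l.
by rewrite (innerC phi g2) (innerC (Bt z1)) -BBt; lra.
Qed.

(** The functionals (., e.2), for e in V of energy at most 1, are pointwise bounded: if (q, phi)
    solves the problem for f, then (q, f - c phi) is orthogonal to e, so (f, e.2) = (c phi, e.2) -
    (e.1, q), and the energy controls both terms. Their uniform bound is the inequality on the unit
    energy ball, and homogeneity does the rest. *)
Lemma mixed_poincare (B : L -> L) (c : {linear M -> M}) :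
  selfadjoint c -> (forall u, 0 <= inner (c u) u) ->
  (forall f, exists q phi, mixed B c 0 f q phi) ->
  exists2 K, 0 <= K &
    forall e, V e -> `|e.2| ^+ 2 <= K * (`|e.1| ^+ 2 + inner (c e.2) e.2).
Proof.
move=> csa c0 solv.
pose en (e : E) := `|e.1| ^+ 2 + inner (c e.2) e.2.
pose F : set (M -> R^o) := [set g | exists e, [/\ V e, en e <= 1 & g = inner^~ e.2]].
have : uniform_bounded F.
  apply: Banach_Steinhauss => [_ [e [_ _ ->]]|f]; last first.
    have [q [phi [_ Gq]]] := solv f.
    exists (`|q| + (inner (c phi) phi + 1)) => _ [e [Ve ene ->]].
    have := Ve _ Gq; rewrite prodh_innerE/= innerBr.
    rewrite (innerC e.2 f) (innerC e.2 (c phi)) => h.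
    have -> : inner f e.2 = inner (c phi) e.2 - inner e.1 q by lra.
    have ce := c0 e.2; have e1 := sqr_ge0 `|e.1|.
    apply: le_trans (ler_normB _ _) _; rewrite addrC lerD//.
      apply: le_trans (Cauchy_Schwarz _ _) _; rewrite ler_piMl//.
      rewrite -(@ler_pXn2r _ 2)// ?nnegrE// expr1n; move: ene; rewrite /en; lra.
    (* Nonnegativity of [c] at both arguments bounds 2 |(c phi, e.2)| by (c phi, phi) + (c e.2,
       e.2). *)
    have := c0 (phi + e.2); have := c0 (phi - e.2).
    rewrite !linearD linearN/= !innerDl !innerDr !innerNr !innerNl.
    rewrite (csa e.2 phi) (innerC e.2 (c phi)) => h1 h2.
    have := c0 phi; move: ene; rewrite /en ler_norml => h3 h4.
    by apply/andP; split; lra.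
  split=> [r|a u v]; last by rewrite innerDl innerZl.
  exists (r * `|e.2|) => x xr; apply: le_trans (Cauchy_Schwarz _ _) _.
  by rewrite ler_wpM2r.
move=> /(_ 1)[K FK].
have h e : V e -> en e <= 1 -> `|e.2| <= K.
  move=> Ve ene.
  have {}FK := FK (inner^~ e.2) (ex_intro _ e (And3 Ve ene erefl)).
  have [e20|e20] := eqVneq e.2 0.
    by rewrite e20 normr0; apply: le_trans (FK 0 _) => //; rewrite normr0.
  have := FK (`|e.2|^-1 *: e.2); rewrite normrZ innerZl inner_norm normfV normr_id.
  have n0 : `|e.2| != 0 by rewrite normr_eq0.
  rewrite mulVf// lexx => /(_ isT); rewrite expr2 mulrA mulVf// mul1r.
  by rewrite normr_id.
have en0 e : 0 <= en e by rewrite addr_ge0// sqr_ge0.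
exists (K ^+ 2) => [|e Ve]; first exact: sqr_ge0.
apply: (le_of_affine (sqr_ge0 K)) => eps eps0; rewrite -mulrDr -/(en e).
(* The energy of [e] may be zero before the inequality is known, so the scaling uses energy plus
   [eps]. *)
pose s := Num.sqrt (en e + eps).
have s0 : 0 < s by rewrite sqrtr_gt0 ltr_wpDl.
have s2 : s ^+ 2 = en e + eps by rewrite sqr_sqrtr// addr_ge0// ltW.
have := h (s^-1 *: e); rewrite /en /= !normrZ linearZ/= innerZl innerZr.
rewrite normfV gtr0_norm// => h'; have {h'} : s^-1 * `|e.2| <= K.
  apply: h'.
    rewrite -[_ *: e]addr0; apply: (subspace_annih G).2 => //.
    exact: (subspace_annih G).1.
  rewrite exprMn mulrA -expr2 -mulrDr exprVn s2 -/(en e) ler_pdivrMl.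
    by rewrite mulr1 lerDl ltW.
  by rewrite -s2 exprn_gt0.
rewrite ler_pdivrMl// -s2 -exprMn => h2.
have Ks0 : 0 <= s * K by exact: le_trans h2.
by rewrite mulrC ler_pXn2r// nnegrE.
Qed.

(** Origin of the coercivity constant min(alpha, 1) / (K + 1). Here x, y, z stand for |e.1|^2, (c
    e.2, e.2) and |e.2|^2 with e in V, and the hypothesis on z is the Poincare inequality. *)
Lemma mixed_energy_le (alpha K x y z : R) : 0 < alpha -> 0 <= K ->
  0 <= x -> 0 <= y -> z <= K * (x + y) ->
  Num.min alpha 1 / (K + 1) * (x + z) <= alpha * x + y.
Proof.
move=> a0 K0 x0 y0 zK; have K1 : 0 < K + 1 by rewrite ltr_wpDl.
have m0 : 0 <= Num.min alpha 1 by rewrite le_min ltW//=.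
have h1 : Num.min alpha 1 * x <= alpha * x by rewrite ler_wpM2r// ge_min lexx.
have h2 : Num.min alpha 1 * y <= y by rewrite ler_piMl// ge_min lexx orbT.
rewrite mulrAC ler_pdivrMr//.
apply: (@le_trans _ _ (Num.min alpha 1 * ((K + 1) * (x + y)))).
  by rewrite ler_wpM2l//; lra.
by rewrite mulrCA mulrC ler_wpM2r ?(ltW K1)// mulrDr lerD.
Qed.

(** The flux is eliminated. Lax-Milgram on V solves the primal problem with the form (A e.1, e'.1) +
    (c e.2, e'.2), the element e playing the role of (- grad phi, - phi); then q = A (e.1 - g1). *)
Lemma mixed_exists (A : {linear L -> L}) (B : {linear L -> L}) (c : {linear M -> M}) K :
  bounded_op A -> bounded_op c -> positive_definite_op A -> cancel A B ->
  (forall u, 0 <= inner (c u) u) -> 0 <= K ->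
  (forall e, V e -> `|e.2| ^+ 2 <= K * (`|e.1| ^+ 2 + inner (c e.2) e.2)) ->
  forall g1 g2, exists q phi, mixed B c g1 g2 q phi.
Proof.
move=> /bounded_op_ge0[KA KA0 AK] /bounded_op_ge0[Kc Kc0 cK] [alpha a0 Aa] AB c0 K0 PK g1 g2.
pose b (e e' : E) := inner (A e.1) e'.1 + inner (c e.2) e'.2.
pose l (e : E) := inner (A g1) e.1 - inner g2 e.2.
pose C := KA + Kc + (`|A g1| + `|g2|).
have [||||||e Ve eb] := @lax_milgram R E V b l (Num.min alpha 1 / (K + 1)) C
  (@closed_orthogonal _ _ G) (subspace_annih _).
- split=> a u v w; rewrite /b/= ?linearP ?innerDl ?innerDr ?innerZl ?innerZr; ring.
- by move=> a u v; rewrite /l/= ?innerDr ?innerZr; ring.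
- by rewrite divr_gt0// ?lt_min ?a0//= ltr_wpDl.
- move=> u Vu; rewrite prodh_normE.
  apply: le_trans (mixed_energy_le a0 K0 (sqr_ge0 _) (c0 _) (PK _ Vu)) _.
  by rewrite lerD2r.
- move=> u v; rewrite /b; apply: le_trans (ler_normD _ _) _.
  have uv0 : 0 <= `|u| * `|v| by rewrite mulr_ge0.
  apply: (@le_trans _ _ ((KA + Kc) * (`|u| * `|v|))).
    rewrite mulrDl lerD//; apply: le_trans (Cauchy_Schwarz _ _) _; rewrite mulrA.
      apply: ler_pM => //; last exact: prodh_norm1_le.
      by apply: le_trans (AK _) _; rewrite ler_wpM2l// prodh_norm1_le.
    apply: ler_pM => //; last exact: prodh_norm2_le.
    by apply: le_trans (cK _) _; rewrite ler_wpM2l// prodh_norm2_le.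
  by rewrite -(mulrA C) ler_wpM2r// lerDl addr_ge0.
- move=> u; rewrite /l; apply: le_trans (ler_normB _ _) _.
  apply: (@le_trans _ _ ((`|A g1| + `|g2|) * `|u|)).
    rewrite mulrDl lerD//; apply: le_trans (Cauchy_Schwarz _ _) _.
      by rewrite ler_wpM2l// prodh_norm1_le.
    by rewrite ler_wpM2l// prodh_norm2_le.
  by rewrite ler_wpM2r// lerDr addr_ge0.
exists (A (e.1 - g1)), (- e.2); split => [g Gg|t Tt].
  have := Ve _ Gg; rewrite prodh_innerE AB innerBl innerNl; lra.
(* Test pairs belong to V, so the primal equation tested with them says that the flux has the
   prescribed weak divergence. *)
have := eb _ (annih_annih Tt); rewrite /b /l prodh_innerE/=.
by rewrite linearB linearN/= opprK innerBl innerDl; lra.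
Qed.

(** Testing the first equation with the solution's own graph element gives (B q, q) + (c phi, phi) =
    (phi, f). Since (B q, - phi) lies in V, the left side dominates |B q|^2 + |phi|^2. Taking f = 0
    also yields uniqueness. *)
Lemma mixed_bounded (A B : {linear L -> L}) (c : {linear M -> M}) K :
  bounded_op A -> positive_definite_op A -> cancel B A ->
  (forall u, 0 <= inner (c u) u) -> 0 <= K ->
  (forall e, V e -> `|e.2| ^+ 2 <= K * (`|e.1| ^+ 2 + inner (c e.2) e.2)) ->
  exists2 C, 0 <= C & forall f q phi, mixed B c 0 f q phi ->
    `|q| <= C * `|f| /\ `|phi| <= C * `|f|.
Proof.
move=> /bounded_op_ge0[KA KA0 AK] [alpha a0 Aa] BA c0 K0 PK.
pose g := Num.min alpha 1 / (K + 1).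
have g0 : 0 < g by rewrite divr_gt0// ?lt_min ?a0//= ltr_wpDl.
have gV : 0 <= g^-1 by rewrite invr_ge0 ltW.
exists ((KA + 1) * g^-1) => [|f q phi [h1 h2]].
  by rewrite mulr_ge0// addr_ge0.
have Ve : V (B q, - phi).
  move=> e Ge; rewrite prodh_innerE/= innerNl.
  by rewrite h1// inner0l oppr0.
have h : g * (`|B q| ^+ 2 + `|phi| ^+ 2) <= `|phi| * `|f|.
  have := h1 _ h2; rewrite /= inner0l oppr0 innerBr (innerC phi (c phi)) => e0.
  have := PK _ Ve; rewrite /= normrN linearN innerNl innerNr opprK => P.
  apply: le_trans (mixed_energy_le a0 K0 (sqr_ge0 _) (c0 phi) P) _.
  apply: le_trans (inner_le phi f).
  have := Aa (B q); rewrite BA (innerC q); lra.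
have hphi : `|phi| <= g^-1 * `|f|.
  have [->|p0] := eqVneq phi 0; first by rewrite normr0 mulr_ge0.
  have p0' : 0 < `|phi| by rewrite normr_gt0.
  rewrite ler_pdivlMl// -(ler_pM2l p0'); apply: le_trans h.
  by rewrite mulrCA -expr2 ler_wpM2l ?(ltW g0)// lerDr sqr_ge0.
have hB : `|B q| <= g^-1 * `|f|.
  rewrite -(@ler_pXn2r _ 2)// ?nnegrE ?mulr_ge0//.
  apply: (@le_trans _ _ (g^-1 * (`|phi| * `|f|))).
    rewrite ler_pdivlMl//; apply: le_trans h.
    by rewrite ler_wpM2l ?(ltW g0)// lerDl sqr_ge0.
  by rewrite expr2 -[leRHS]mulrA ler_wpM2l// [leLHS]mulrC ler_wpM2l.
split.
  rewrite -{1}(BA q); apply: le_trans (AK _) _; rewrite -mulrA.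
  by apply: ler_pM => //; rewrite lerDl.
by apply: le_trans hphi _; rewrite -mulrA ler_peMl ?mulr_ge0// lerDr.
Qed.

End mixed.

(** * Existence for the abstract optimality system *)

Section optimality.
Context {R : realType} {L M : hilbertType R} (T : set (prodh L M)).

Definition bounded_form (V : normedModType R) (b : V -> V -> R) :=
  exists2 K, 0 <= K & forall u v, `|b u v| <= K * (`|u| * `|v|).

Lemma riesz_representation (V : hilbertType R) (l : V -> R) K :
  linear_form l -> (forall u, `|l u| <= K * `|u|) ->
  exists u, forall v, inner u v = l v.
Proof.
move=> ll lb; have sT : is_subspace (@setT V) by split.
have [u _ uP] := riesz_subspace (@closedT V) sT ll lb.
by exists u => v; exact: uP.
Qed.

Lemma bounded_form_representation (V : hilbertType R) (b : V -> V -> R) :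
  bilinear_form b -> bounded_form b -> forall u, exists g, forall v, inner g v = b u v.
Proof.
move=> [_ br] [K K0 bK] u; apply: (@riesz_representation V (b u) (K * `|u|)).
  by move=> a v w; rewrite br.
by move=> v; rewrite -mulrA.
Qed.

(* With [S] the solution operator of the state equation, the system amounts to
   the coercive symmetric equation [(Q + S^* K S) r = l0] for [r = Q^-1 (l0 - z2)]. *)
Lemma optimality_exists (A B At Bt : {linear L -> L}) (c : {linear M -> M})
    (Q : {linear M -> M}) (k1 : L -> L -> R) (k2 : M -> M -> R) (l0 : M) :
  bounded_op A -> bounded_op At -> bounded_op c ->
  positive_definite_op A -> positive_definite_op At ->
  cancel B A -> cancel At Bt -> (forall u v, inner (B u) v = inner u (Bt v)) ->
  selfadjoint c -> (forall u, 0 <= inner (c u) u) ->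
  (forall f, exists q phi, mixed T B c 0 f q phi) ->
  bounded_op Q -> selfadjoint Q -> positive_definite_op Q ->
  bilinear_form k1 -> (forall u v, k1 u v = k1 v u) -> (forall u, 0 <= k1 u u) ->
  bounded_form k1 ->
  bilinear_form k2 -> (forall u v, k2 u v = k2 v u) -> (forall u, 0 <= k2 u u) ->
  bounded_form k2 ->
  exists r q phi g1 g2 z1 z2,
    [/\ mixed T B c 0 r q phi, forall v, inner g1 v = k1 q v,
        forall v, inner g2 v = k2 phi v, mixed T Bt c g1 g2 z1 z2 &
        Q r = l0 - z2].
Proof.
move=> bA bAt bc pA pAt BA AtBt BBt csa c0 solv /bounded_op_ge0[KQ KQ0 QK] Qsa
  [aQ aQ0 aQP] k1b k1C k10 k1K k2b k2C k20 k2K.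
have [K K0 PK] := mixed_poincare csa c0 solv.
have [C C0 CP] := mixed_bounded bA pA BA c0 K0 PK.
have /choice[S SP] : forall f, exists s : L * M, mixed T B c 0 f s.1 s.2.
  by move=> f; have [q [phi h]] := solv f; exists (q, phi).
have S_uniq f q phi : mixed T B c 0 f q phi -> S f = (q, phi).
  move=> h; have := mixed_lin (-1) (SP f) h.
  rewrite !scaleN1r addNr => /CP; rewrite normr0 mulr0 !normr_le0 => -[].
  rewrite !addr_eq0 !eqr_opp => /eqP h1 /eqP h2.
  by rewrite [S f]surjective_pairing h1 h2.
have SL a f f' : S (a *: f + f') = (a *: (S f).1 + (S f').1, a *: (S f).2 + (S f').2).
  exact/S_uniq/mixed_lin.
have [K1 K10 K1P] := k1K; have [K2 K20 K2P] := k2K.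
pose b (f f' : M) := inner (Q f) f' + k1 (S f).1 (S f').1 + k2 (S f).2 (S f').2.
have S1 f : `|(S f).1| <= C * `|f| by have [] := CP _ _ _ (SP f).
have S2 f : `|(S f).2| <= C * `|f| by have [] := CP _ _ _ (SP f).
pose KK := KQ + K1 * C ^+ 2 + K2 * C ^+ 2 + `|l0|.
have [||||||||r _ rP] := @symmetric_lax_milgram R M setT b (inner l0) aQ KK closedT.
- by split.
- split=> [a u v w|a u v w]; rewrite /b SL/= ?linearP ?innerDl ?innerDr ?innerZl ?innerZr.
    rewrite k1b.1 k2b.1; ring.
  rewrite k1b.2 k2b.2; ring.
- by move=> a u v; rewrite innerDr innerZr.
- by move=> u v; rewrite /b Qsa innerC (k1C (S u).1) (k2C (S u).2).
- exact: aQ0.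
- by move=> u _; apply: le_trans (aQP u) _; rewrite /b -addrA lerDl addr_ge0.
- move=> u v; have uv0 : 0 <= `|u| * `|v| by rewrite mulr_ge0.
  have SS x y : x <= C * `|u| -> y <= C * `|v| -> 0 <= x -> 0 <= y ->
      x * y <= C ^+ 2 * (`|u| * `|v|).
    by move=> hx hy x0 y0; rewrite expr2 mulrACA ler_pM.
  rewrite -mulrA /b /KK !mulrDl.
  apply: le_trans (ler_normD _ _) _; rewrite -[leLHS]addr0; apply: lerD; last first.
    by rewrite mulr_ge0.
  apply: lerD.
    apply: le_trans (ler_normD _ _) _; apply: lerD.
      apply: le_trans (Cauchy_Schwarz _ _) _; rewrite mulrA.
      by rewrite ler_wpM2r.
    by apply: le_trans (K1P _ _) _; rewrite -mulrA ler_wpM2l// SS.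
  by apply: le_trans (K2P _ _) _; rewrite -mulrA ler_wpM2l// SS.
- move=> u; apply: le_trans (Cauchy_Schwarz _ _) _; rewrite ler_wpM2r// lerDr.
  by rewrite !addr_ge0// mulr_ge0// sqr_ge0.
have [g1 g1P] := bounded_form_representation k1b k1K (S r).1.
have [g2 g2P] := bounded_form_representation k2b k2K (S r).2.
have [z1 [z2 zP]] := mixed_exists bAt bc pAt AtBt c0 K0 PK g1 g2.
exists r, (S r).1, (S r).2, g1, g2, z1, z2; split => //.
(* By duality (z2, f) = k1 (S r).1 (S f).1 + k2 (S r).2 (S f).2, which is exactly the part of
   [b r f] other than (Q r, f). *)
apply: inner_inj => f; rewrite innerBl -rP// /b.
rewrite (mixed_duality BBt csa (SP f) zP) g1P g2P.
ring.
Qed.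

End optimality.

(** * Completeness of L2 *)

Section L2_complete.
Context d (T : measurableType d) (R : realType) (mu : {measure set T -> \bar R}).
Local Notation L2mu := (L2 mu).

Lemma L2_measurable (f : L2mu) : measurable_fun setT (f : T -> R).
Proof. by have /andP[/[!inE]] := L2_Lfun f. Qed.

Lemma Lfun2P (f : T -> R) : measurable_fun setT f ->
  (\int[mu]_x ((f x) ^+ 2)%:E < +oo)%E -> f \in Lfun mu 2%:E.
Proof.
move=> mf fi; apply/andP; split; rewrite inE//= /finite_norm unlock.
apply: poweR_lty; apply: le_lt_trans fi; rewrite le_eqVlt; apply/orP; left.
apply/eqP; apply: eq_integral => x _ /=.
by rewrite powR_mulrn// real_normK// num_real.
Qed.

Lemma L2_sqr_integral (f : L2mu) :
  (\int[mu]_x ((f x) ^+ 2)%:E = (`|f| ^+ 2)%:E)%E.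
Proof.
rewrite -inner_norm -[RHS]/(fine (\int[mu]_x (f x * f x)%:E))%:E fineK//.
exact: integrable_fin_num (L2_mul_integrable f f).
Qed.

Lemma L2_subE (f g : L2mu) : \forall x \ae mu, L2_fun (f - g) x = f x - g x.
Proof.
apply: filterS2 (L2_addE f (- g)) (L2_scaleE (-1) g) => x.
by rewrite scaleN1r mulN1r => -> ->.
Qed.

Lemma L2_sqr_integral_ae (f : L2mu) (g : T -> R) : measurable_fun setT g ->
  (\forall x \ae mu, f x = g x) ->
  (\int[mu]_x ((g x) ^+ 2)%:E = (`|f| ^+ 2)%:E)%E.
Proof.
move=> mg fg; rewrite -L2_sqr_integral; apply: ae_eq_integral => //.
- by apply/measurable_EFinP; exact: measurable_funX.
- by apply/measurable_EFinP; apply: measurable_funX; exact: L2_measurable.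
- by apply: filterS fg => x ->.
Qed.

Lemma limn_einf_ge0 (u : nat -> \bar R) : (forall k, 0 <= u k)%E -> (0 <= limn_einf u)%E.
Proof.
move=> u0; rewrite limn_einf_lim; apply: lime_ge; first exact: is_cvg_einfs.
by apply: nearW => k; apply: le_ereal_inf_tmp => _ [m /= _ <-].
Qed.

Lemma limn_einf_le (u : nat -> \bar R) C : (forall k, u k <= C)%E -> (limn_einf u <= C)%E.
Proof.
move=> uC; rewrite limn_einf_lim; apply: lime_le; first exact: is_cvg_einfs.
apply: nearW => k; apply: le_trans (uC k).
by apply: ereal_inf_lbound; exists k => /=.
Qed.

Lemma measurable_fun_limn_einf (w : nat -> T -> \bar R) :
  (forall k, measurable_fun setT (w k)) ->
  measurable_fun setT (fun x => limn_einf (w^~ x)).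
Proof.
move=> mw; rewrite (_ : (fun x => _) = fun x => (- limn_esup (fun k => - w k x))%E).
  apply: measurableT_comp => //; apply: measurable_fun_limn_esup => k.
  exact: measurableT_comp.
apply/funext => x; rewrite -limn_einfN; congr limn_einf.
by apply/funext => k /=; rewrite oppeK.
Qed.

Lemma fast_cauchy_dist (V : normedModType R) (u : nat -> V) :
  (forall k, `|u k.+1 - u k| <= 2^-1 ^+ k) ->
  forall k m, `|u (m + k)%N - u k| <= 2 * 2^-1 ^+ k.
Proof.
move=> uk k m.
suff : `|u (m + k)%N - u k| <= 2 * 2^-1 ^+ k - 2 * 2^-1 ^+ (m + k).
  by move=> /le_trans; apply; rewrite gerBl mulr_ge0// exprn_ge0.
elim: m => [|m IH]; first by rewrite add0n subrr normr0 subrr.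
rewrite -(subrKA (u (m + k)%N)) addSn; apply: le_trans (ler_normD _ _) _.
apply: le_trans (lerD (uk _) IH) _; rewrite exprS; lra.
Qed.

(** The series of 2^k |u_(k+1) - u_k|^2 has integral at most the sum of 2^-k, hence is finite almost
    everywhere, say with sum H. Then |u_(k+1) - u_k| <= sqrt H * 2^(-k/2) pointwise, a convergent
    geometric series. Working with squares keeps the argument valid for infinite measures. *)
Lemma fast_cauchy_ae_cvg (u : nat -> L2mu) :
  (forall k, `|u k.+1 - u k| <= 2^-1 ^+ k) ->
  \forall x \ae mu, cvg (u k x @[k --> \oo]).
Proof.
move=> uk.
pose t k x : \bar R := (2 ^+ k * (u k.+1 x - u k x) ^+ 2)%:E.
have mdiff k : measurable_fun setT (fun x => u k.+1 x - u k x).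
  by apply: measurable_funB; exact: L2_measurable.
have t0 k x : (0 <= t k x)%E by rewrite lee_fin mulr_ge0// ?sqr_ge0// exprn_ge0.
have mt k : measurable_fun setT (t k).
  apply/measurable_EFinP; apply: measurable_funM => //.
  exact: measurable_funX.
pose h x := (\sum_(0 <= k <oo) t k x)%E.
have mh : measurable_fun setT h by apply: ge0_emeasurable_sum.
have h0 x : (0 <= h x)%E by apply: nneseries_ge0.
have ih : mu.-integrable setT h.
  apply/integrableP; split => //.
  under eq_integral do rewrite gee0_abs//.
  rewrite integral_nneseries//.
  have H := @cvg_geometric_eseries_half R 2 0.
  apply: le_lt_trans (_ : (_ <= \sum_(0 <= k <oo)
      ((2 / (2 ^ (k + 1))%:R)%:E))%E) _; last first.
    by rewrite (cvg_lim _ H)// ltry.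
  apply: lee_nneseries => [k _ _|k _]; first exact: integral_ge0.
  rewrite /t; under eq_integral do rewrite EFinM.
  rewrite ge0_integralZl//; last 2 first.
  - by apply/measurable_EFinP; exact: measurable_funX.
  - by move=> x _; rewrite lee_fin sqr_ge0.
  rewrite (@L2_sqr_integral_ae (u k.+1 - u k))//; last exact: L2_subE.
  rewrite -EFinM lee_fin addn1 natrX [in leRHS]exprS (_ : 2 / (2 * 2 ^+ k) = (2 ^+ k)^-1); last first.
    by field; rewrite expf_neq0.
  apply: (@le_trans _ _ (2 ^+ k * (2^-1 ^+ k) ^+ 2)).
    by rewrite ler_wpM2l ?exprn_ge0// ler_pXn2r ?nnegrE ?exprn_ge0.
  by rewrite expr2 mulrA -exprMn divff// expr1n mul1r exprVn.
apply: filterS (integrable_ae measurableT ih) => x /(_ I) hx.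
pose H := fine (h x).
have tH k : 2 ^+ k * (u k.+1 x - u k x) ^+ 2 <= H.
  rewrite -lee_fin fineK// -[leLHS]/(t k x) /h.
  rewrite (nneseries_split 0 k.+1)// big_nat_recr//= add0n.
  apply: le_trans (leeDl _ _); last exact: nneseries_ge0.
  by rewrite leeDr// sume_ge0.
have H0 : 0 <= H by exact: fine_ge0.
have -> : (fun k => u k x) = (fun k => u 0%N x + series (telescope (fun k => u k x)) k).
  by apply/funext => k; rewrite -eq_sum_telescope.
apply: is_cvgD; first exact: is_cvg_cst.
apply: (@normed_cvg _ R^o).
apply: (@series_le_cvg _ _ (geometric (Num.sqrt H) (Num.sqrt 2^-1))).
- by move=> k /=.
- by move=> k /=; rewrite mulr_ge0// exprn_ge0.
- move=> k /=; rewrite -(@ler_pXn2r _ 2)// ?nnegrE ?mulr_ge0// ?exprn_ge0//.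
  rewrite exprMn sqr_sqrtr// -exprM mulnC exprM sqr_sqrtr//.
  rewrite real_normK ?num_real// exprVn ler_pdivlMr ?exprn_gt0//.
  by rewrite mulrC.
- apply: is_cvg_geometric_series; rewrite ger0_norm// -[ltRHS]sqrtr1.
  by rewrite ltr_sqrt// invf_lt1// ltr1n.
Qed.

Lemma L2_cauchy_cvg (F : set_system L2mu) : ProperFilter F -> cauchy F -> cvg F.
Proof.
apply: fast_cauchy_complete => u uk.
have ucv := fast_cauchy_ae_cvg uk.
(* The upper limit is measurable on the whole space and equals the limit wherever the sequence
   converges. *)
pose f x := fine (limn_esup (fun k => (u k x)%:E)).
have mf : measurable_fun setT f.
  apply: (measurableT_comp (@fine_measurable _ _ measurableT)).
  apply: measurable_fun_limn_esup => k.
  by apply/measurable_EFinP; exact: L2_measurable.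
have fE : \forall x \ae mu, u k x @[k --> \oo] --> f x.
  apply: filterS ucv => x cux.
  have h : (u k x)%:E @[k --> \oo] --> (lim (u k x @[k --> \oo]))%:E.
    by apply: cvg_EFin => //; apply: nearW.
  rewrite /f is_cvg_limn_esupE; last by apply/cvg_ex; eexists; exact: h.
  by rewrite (cvg_lim _ h).
have mfu k : measurable_fun setT (fun x => f x - u k x).
  by apply: measurable_funB => //; exact: L2_measurable.
(* Fatou's lemma turns almost everywhere convergence into convergence in L2. *)
have fu k : (\int[mu]_x ((f x - u k x) ^+ 2)%:E <= ((2 * 2^-1 ^+ k) ^+ 2)%:E)%E.
  pose w m x := ((u (m + k)%N x - u k x) ^+ 2)%:E.
  have mw m : measurable_fun setT (fun x => u (m + k)%N x - u k x).
    by apply: measurable_funB; exact: L2_measurable.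
  apply: le_trans (_ : (_ <= \int[mu]_x limn_einf (w^~ x))%E) _.
    apply: ae_ge0_le_integral => //.
    - by move=> x _; rewrite lee_fin sqr_ge0.
    - by apply/measurable_EFinP; exact: measurable_funX.
    - by move=> x _; apply: limn_einf_ge0 => m; rewrite lee_fin sqr_ge0.
    - apply: measurable_fun_limn_einf => m.
      by apply/measurable_EFinP; exact: measurable_funX.
    - apply: filterS fE => x fx _.
      have h : w m x @[m --> \oo] --> ((f x - u k x) ^+ 2)%:E.
        apply: cvg_EFin; first exact: nearW.
        have fk : u (m + k)%N x @[m --> \oo] --> f x.
          by rewrite (cvg_shiftn k (fun m => u m x)).
        by rewrite /comp /=; apply: cvgM; apply: cvgB => //; exact: cvg_cst.
      rewrite is_cvg_limn_einfE; last by apply/cvg_ex; eexists; exact: h.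
      by rewrite (cvg_lim _ h).
  apply: le_trans (fatou _ _ _ _) _ => //.
  - by move=> m; apply/measurable_EFinP; exact: measurable_funX.
  - by move=> m x _; rewrite lee_fin sqr_ge0.
  apply: limn_einf_le => m; rewrite (@L2_sqr_integral_ae (u (m + k)%N - u k))//.
    by rewrite lee_fin ler_pXn2r ?nnegrE ?mulr_ge0 ?exprn_ge0// fast_cauchy_dist.
  exact: L2_subE.
(* Fatou bounds differences only, so the limit class is built as (f - u_0) + u_0. *)
have f0 : (fun x => f x - u 0%N x) \in Lfun mu 2%:E.
  by apply: Lfun2P => //; apply: le_lt_trans (fu 0%N) _; rewrite ltry.
pose l : L2mu := mkL2 f0 + u 0%N.
have lE : \forall x \ae mu, l x = f x.
  apply: filterS2 (L2_addE (mkL2 f0) (u 0%N)) (mkL2E f0) => x -> /(_ I) ->.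
  by rewrite subrK.
apply/cvg_ex; exists l; apply/cvgrPdist_le => e e0.
have half1 : `|2^-1 : R| < 1 by rewrite ger0_norm// invf_lt1// ltr1n.
have e2 : 0 < e / 2 by rewrite divr_gt0.
apply: filterS (cvgr_dist_lt _ _ (cvg_expr half1) _ e2) => k.
rewrite sub0r normrN ger0_norm ?exprn_ge0// => ke.
apply: (@le_trans _ _ (2 * 2^-1 ^+ k)); last first.
  by move: ke; lra.
rewrite -(@ler_pXn2r _ 2)// ?nnegrE ?mulr_ge0 ?exprn_ge0//.
rewrite -lee_fin -(@L2_sqr_integral_ae _ (fun x => f x - u k x))//.
by apply: filterS2 (L2_subE l (u k)) lE => x -> ->.
Qed.

HB.instance Definition _ := Uniform_isComplete.Build L2mu L2_cauchy_cvg.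

End L2_complete.

(** * Multiplication operators on L2 *)

Section ae_integral.
Context d (T : measurableType d) (R : realType) (mu : {measure set T -> \bar R}).
Local Open Scope ereal_scope.
Import HBNNSimple.

(* The integral of a function that need not be measurable is a supremum of
   integrals of simple functions, hence it ignores null sets. *)
Lemma ge0_ae_le_integral (f g : T -> \bar R) :
  (forall x, 0 <= f x) -> (forall x, 0 <= g x) ->
  (\forall x \ae mu, f x <= g x) -> \int[mu]_x f x <= \int[mu]_x g x.
Proof.
move=> f0 g0 [N [mN N0 fgN]]; rewrite !ge0_integralTE//.
apply: ge_ereal_sup => _ [h /= hf <-].
have mNC : measurable (~` N) by exact: measurableC.
apply: ereal_sup_ubound; exists (proj_nnsfun h mNC) => /=.
  move=> x; rewrite mindicE; have [|xN] := boolP (x \in ~` N).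
    rewrite inE /= => xN; rewrite mulr1; apply: le_trans (hf x) _.
    by apply: contrapT => /fgN.
  by rewrite mulr0.
rewrite -!integralT_nnsfun; apply: ae_eq_integral => //; first exact/measurable_EFinP.
  exact/measurable_EFinP.
exists N; split => // x /= hx; apply: contrapT => xN; apply: hx => _.
by rewrite mindicE mem_set ?mulr1.
Qed.

Lemma ae_eq_integralT (f g : T -> \bar R) :
  (\forall x \ae mu, f x = g x) -> \int[mu]_x f x = \int[mu]_x g x.
Proof.
move=> fg; rewrite (integralE _ _ f) (integralE _ _ g).
congr (_ - _); apply/eqP; rewrite eq_le; apply/andP; split;
  apply: ge0_ae_le_integral; try exact: funepos_ge0; try exact: funeneg_ge0;
  by apply: filterS fg => x; rewrite ?funeposE ?funenegE => ->.
Qed.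

End ae_integral.

Section ae_Rintegral.
Context d (T : measurableType d) (R : realType) (mu : {measure set T -> \bar R}).

Lemma ae_eq_RintegralT (f g : T -> R) :
  (\forall x \ae mu, f x = g x) -> \int[mu]_x f x = \int[mu]_x g x.
Proof.
by move=> fg; congr fine; apply: ae_eq_integralT; apply: filterS fg => x ->.
Qed.

Lemma ae_Rintegral_ge0 (f : T -> R) :
  (\forall x \ae mu, 0 <= f x) -> 0 <= \int[mu]_x f x.
Proof.
move=> f0; rewrite (@ae_eq_RintegralT _ (fun x => `|f x|)).
  exact: Rintegral_ge0.
by apply: filterS f0 => x /ger0_norm ->.
Qed.

Lemma Rintegral_sum (I : Type) (s : seq I) (f : I -> T -> R) :
  (forall i, mu.-integrable setT (EFin \o f i)) ->
  \int[mu]_x (\sum_(i <- s) f i x) = \sum_(i <- s) \int[mu]_x f i x.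
Proof.
move=> fi; have H : forall s : seq I, mu.-integrable setT (EFin \o (fun x => \sum_(i <- s) f i x)).
  move=> s'; rewrite (_ : EFin \o _ = fun x => (\sum_(i <- s') (EFin \o f i) x)%E).
    exact: integrable_sum.
  by apply/funext => x /=; rewrite sumEFin.
elim: s => [|i s IH].
  rewrite big_nil -[RHS](@Rintegral_set0 _ _ _ mu (cst 0)).
  under eq_Rintegral do rewrite big_nil.
  by rewrite Rintegral_set0 /Rintegral integral0.
rewrite big_cons -IH -RintegralD//.
by apply: eq_Rintegral => x _; rewrite big_cons.
Qed.

End ae_Rintegral.

Section multiplication.
Context d (T : measurableType d) (R : realType) (mu : {measure set T -> \bar R}).
Local Notation L2mu := (L2 mu).

(** A total version of [mkL2], so that multiplication operators need no proof argument. The default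
    0 is taken only when [h] agrees almost everywhere with no class. *)
Definition L2_of (h : T -> R) : L2mu :=
  xget 0 [set l : L2mu | \forall x \ae mu, l x = h x].

Lemma L2_ofE (h h' : T -> R) : h' \in Lfun mu 2%:E -> (\forall x \ae mu, h x = h' x) ->
  \forall x \ae mu, L2_of h x = h x.
Proof.
move=> hL hh'; rewrite /L2_of; case: xgetP => [l -> //|/(_ (mkL2 hL))] /=; case.
by apply: filterS2 hh' (mkL2E hL) => x -> /(_ I).
Qed.

(** Measurability is asked of an almost everywhere equal copy [g']: [c] is constrained only on the
    domain, with continuity only off a null set, and [invmx] takes a default value at singular
    matrices, which may occur outside the domain. *)
Definition ae_bounded (g : T -> R) := exists K (g' : T -> R),
  [/\ 0 <= K, measurable_fun setT g', \forall x \ae mu, g x = g' x &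
      \forall x \ae mu, `|g x| <= K].

Definition L2_mul (g : T -> R) (f : L2mu) : L2mu := L2_of (fun x => g x * f x).

Lemma L2_mulE g f : ae_bounded g -> \forall x \ae mu, L2_mul g f x = g x * f x.
Proof.
move=> [K [g' [K0 mg' gg' gK]]].
apply: (@L2_ofE _ (fun x => g' x * f x)); last by apply: filterS gg' => x ->.
have mgf : measurable_fun setT (fun x => g' x * f x).
  by apply: measurable_funM => //; exact: L2_measurable.
apply: Lfun2P => //; apply: le_lt_trans (_ : (_ <= (`|K *: f| ^+ 2)%:E)%E) _; last exact: ltry.
rewrite -L2_sqr_integral; apply: ge0_ae_le_integral.
- by move=> x; rewrite lee_fin sqr_ge0.
- by move=> x; rewrite lee_fin sqr_ge0.
- apply: filterS3 gg' gK (L2_scaleE K f) => x <- gx ->.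
  by rewrite lee_fin !exprMn ler_wpM2r ?sqr_ge0// -[leLHS]real_normK ?num_real// ler_pXn2r.
Qed.

Lemma aeI (P Q : T -> Prop) : (\forall x \ae mu, P x) -> (\forall x \ae mu, Q x) ->
  \forall x \ae mu, P x /\ Q x.
Proof. by move=> hP hQ; apply: filterS2 hP hQ => x. Qed.

Lemma L2_mul_linear g : ae_bounded g -> linear (L2_mul g).
Proof.
move=> bg a u v; apply: L2_extP.
apply: filterS3 (aeI (L2_mulE (a *: u + v) bg) (L2_addE (a *: u) v))
  (aeI (L2_scaleE a u) (L2_addE (a *: L2_mul g u) (L2_mul g v)))
  (aeI (L2_scaleE a (L2_mul g u)) (aeI (L2_mulE u bg) (L2_mulE v bg))) => x.
by move=> [-> ->] [-> ->] [-> [-> ->]]; ring.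
Qed.

Lemma L2_le_norm (f g : L2mu) : (\forall x \ae mu, `|f x| <= `|g x|) -> `|f| <= `|g|.
Proof.
move=> fg; rewrite -(@ler_pXn2r _ 2)// ?nnegrE// -lee_fin -!L2_sqr_integral.
apply: ge0_ae_le_integral.
- by move=> x; rewrite lee_fin sqr_ge0.
- by move=> x; rewrite lee_fin sqr_ge0.
- apply: filterS fg => x h; rewrite lee_fin -[leLHS]real_normK ?num_real//.
  by rewrite -[leRHS]real_normK ?num_real// ler_pXn2r.
Qed.

Lemma L2_mul_bounded g : ae_bounded g -> bounded_op (L2_mul g).
Proof.
move=> bg; have [K [_ [K0 _ _ gK]]] := bg; exists K => f.
apply: (@le_trans _ _ `|K *: f|); last by rewrite normrZ ger0_norm.
apply: L2_le_norm; apply: filterS3 gK (L2_mulE f bg) (L2_scaleE K f) => x h -> ->.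
by rewrite !normrM ler_wpM2r// (ger0_norm K0).
Qed.

Lemma L2_innerE (f g : L2mu) (h : T -> R) :
  (\forall x \ae mu, f x * g x = h x) -> inner f g = \int[mu]_x h x.
Proof. by move=> fgh; rewrite -(ae_eq_RintegralT fgh). Qed.

Lemma L2_inner_mul g (u v : L2mu) : ae_bounded g ->
  inner (L2_mul g u) v = \int[mu]_x (g x * u x * v x).
Proof. by move=> bg; apply: L2_innerE; apply: filterS (L2_mulE u bg) => x ->. Qed.

Lemma L2_mul_selfadjoint g : ae_bounded g -> selfadjoint (L2_mul g).
Proof.
move=> bg u v; rewrite L2_inner_mul// innerC L2_inner_mul//.
by apply: eq_Rintegral => x _; ring.
Qed.

Lemma L2_mul_ge0 g u : ae_bounded g -> (\forall x \ae mu, 0 <= g x) ->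
  0 <= inner (L2_mul g u) u.
Proof.
move=> bg g0; rewrite L2_inner_mul//; apply: ae_Rintegral_ge0.
by apply: filterS g0 => x gx; rewrite -mulrA mulr_ge0// -expr2 sqr_ge0.
Qed.

End multiplication.

Section matrix_multiplication.
Context d (T : measurableType d) (R : realType) (mu : {measure set T -> \bar R}).
Context (n : nat).
Local Notation L := (nfold (L2 mu) n).
Implicit Types F : T -> 'M[R]_n.

Definition ae_bounded_mx F := forall i j, ae_bounded mu (fun x => F x i j).

Definition L2_mulmx F (q : L) : L := [ffun i => \sum_j L2_mul (fun x => F x i j) (q j)].

Lemma L2_sumE (I : Type) (s : seq I) (f : I -> L2 mu) :
  \forall x \ae mu, L2_fun (\sum_(i <- s) f i) x = \sum_(i <- s) f i x.
Proof.
elim: s => [|i s IH].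
  by rewrite big_nil; apply: filterS (L2_zeroE mu) => x; rewrite big_nil.
rewrite big_cons; apply: filterS2 IH (L2_addE (f i) (\sum_(j <- s) f j)) => x h ->.
by rewrite big_cons h.
Qed.

Lemma L2_mulmxE F (q : L) : ae_bounded_mx F ->
  \forall x \ae mu, forall i, L2_mulmx F q i x = \sum_j F x i j * q j x.
Proof.
move=> bF; apply: filter_forall => i; rewrite ffunE.
have h : \forall x \ae mu, forall j, L2_mul (fun x => F x i j) (q j) x = F x i j * q j x.
  by apply: filter_forall => j; exact: L2_mulE.
have h2 := L2_sumE (index_enum 'I_n) (fun j => L2_mul (fun x => F x i j) (q j)).
by apply: filterS2 h h2 => x hx h2x; rewrite [LHS]h2x; apply: eq_bigr => j _; rewrite hx.
Qed.

Lemma L2_mulmx_linear F : ae_bounded_mx F -> linear (L2_mulmx F).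
Proof.
move=> bF a u v; apply/ffunP => i; rewrite !ffunE scaler_sumr -big_split/=.
by apply: eq_bigr => j _; rewrite !ffunE L2_mul_linear.
Qed.

Lemma L2_mulmx_bounded F : ae_bounded_mx F -> bounded_op (L2_mulmx F).
Proof.
move=> bF.
have /choice[K KP] : forall i, exists K : 'I_n -> R, forall j,
    0 <= K j /\ forall u : L2 mu, `|L2_mul (fun x => F x i j) u| <= K j * `|u|.
  move=> i; have /choice[K KP] : forall j, exists K : R,
      0 <= K /\ forall u : L2 mu, `|L2_mul (fun x => F x i j) u| <= K * `|u|.
    by move=> j; have [K K0 KP] := bounded_op_ge0 (L2_mul_bounded (bF i j)); exists K.
  by exists K.
pose C i := \sum_j K i j.
exists (\sum_i C i) => q.
have C0 i : 0 <= C i by apply: sumr_ge0 => j _; exact: (KP i j).1.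
have S0 : 0 <= \sum_i C i by apply: sumr_ge0 => i _.
have h i : `|L2_mulmx F q i| <= C i * `|q|.
  rewrite ffunE /C mulr_suml; apply: le_trans (ler_norm_sum _ _ _) _.
  apply: ler_sum => j _; apply: le_trans ((KP i j).2 _) _.
  by rewrite ler_wpM2l ?(KP i j).1//; exact: nfold_norm_le.
rewrite -(@ler_pXn2r _ 2)// ?nnegrE ?mulr_ge0// nfold_normE.
apply: (@le_trans _ _ (\sum_i (C i * `|q|) ^+ 2)).
  by apply: ler_sum => i _; rewrite ler_pXn2r ?nnegrE ?mulr_ge0//; exact: h.
under eq_bigr do rewrite exprMn.
rewrite -mulr_suml exprMn ler_wpM2r ?sqr_ge0// expr2 mulr_suml.
apply: ler_sum => i _; rewrite expr2 ler_wpM2l//.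
by rewrite (bigD1 i)//= lerDl sumr_ge0.
Qed.

Lemma nfold_L2_innerE (p q : L) (h : T -> R) :
  (\forall x \ae mu, \sum_i p i x * q i x = h x) -> inner p q = \int[mu]_x h x.
Proof.
move=> ph; rewrite -(ae_eq_RintegralT ph) Rintegral_sum//.
by move=> i; exact: L2_mul_integrable.
Qed.

Lemma L2_mulmx_inner F (p q : L) : ae_bounded_mx F ->
  inner (L2_mulmx F p) q = \int[mu]_x \sum_i \sum_j F x i j * p j x * q i x.
Proof.
move=> bF; apply: nfold_L2_innerE; apply: filterS (L2_mulmxE p bF) => x h.
by apply: eq_bigr => i _; rewrite h mulr_suml.
Qed.

Lemma L2_mulmx_adjoint F (p q : L) : ae_bounded_mx F ->
  inner (L2_mulmx F p) q = inner p (L2_mulmx (fun x => (F x)^T) q).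
Proof.
move=> bF; have bFt : ae_bounded_mx (fun x => (F x)^T).
  move=> i j; rewrite (_ : (fun x => _) = (fun x => F x j i))//.
  by apply/funext => x; rewrite mxE.
rewrite L2_mulmx_inner// innerC L2_mulmx_inner//; apply: eq_Rintegral => x _.
rewrite exchange_big; apply: eq_bigr => j _; apply: eq_bigr => i _.
by rewrite mxE; ring.
Qed.

Lemma L2_mulmxK F F' : ae_bounded_mx F -> ae_bounded_mx F' ->
  (\forall x \ae mu, F x *m F' x = 1%:M) -> cancel (L2_mulmx F') (L2_mulmx F).
Proof.
move=> bF bF' FF' q; apply/ffunP => i; apply: L2_extP.
apply: filterS3 FF' (L2_mulmxE (L2_mulmx F' q) bF) (L2_mulmxE q bF') => x h1 h2 h3.
rewrite [LHS]h2.
transitivity (\sum_j \sum_k F x i j * (F' x j k * q k x)).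
  by apply: eq_bigr => j _; rewrite -mulr_sumr; congr (_ * _); exact: h3.
rewrite exchange_big/=.
transitivity (\sum_j (F x *m F' x) i j * q j x).
  by apply: eq_bigr => j _; rewrite mxE mulr_suml; apply: eq_bigr => k _; rewrite mulrA.
rewrite h1 (bigD1 i)//= big1 ?addr0 ?mxE ?eqxx ?mul1r// => j ji.
by rewrite mxE eq_sym (negbTE ji) mul0r.
Qed.

Lemma L2_mulmx_coercive F m0 : ae_bounded_mx F -> 0 < m0 ->
  (\forall x \ae mu, forall xi : 'I_n -> R,
     m0 * (\sum_i xi i ^+ 2) <= \sum_i \sum_j F x i j * xi i * xi j) ->
  positive_definite_op (L2_mulmx F).
Proof.
move=> bF m00 Fm; exists m0 => // q.
rewrite -inner_norm -innerZl -subr_ge0 -innerBl.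
have h : \forall x \ae mu, forall i, (L2_mulmx F q - m0 *: q) i x =
    L2_mulmx F q i x - m0 * q i x.
  apply: filter_forall => i.
  have -> : (L2_mulmx F q - m0 *: q) i = L2_mulmx F q i - m0 *: (q i : L2 mu).
    by rewrite !ffunE.
  apply: filterS2 (L2_subE (L2_mulmx F q i) (m0 *: (q i : L2 mu)))
    (L2_scaleE m0 (q i)) => x e1 e2.
  by rewrite [LHS]e1 [X in _ - X]e2.
rewrite (@nfold_L2_innerE _ _ (fun x => \sum_i (L2_mulmx F q i x - m0 * q i x) * q i x)).
  apply: ae_Rintegral_ge0; apply: filterS2 Fm (L2_mulmxE q bF) => x /(_ (q^~ x)) Fx Fq.
  under eq_bigr do rewrite Fq mulrBl.
  rewrite sumrB subr_ge0; apply: le_trans (le_trans Fx _).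
    by rewrite mulr_sumr; apply: ler_sum => i _; rewrite -mulrA -expr2.
  apply: ler_sum => i _; rewrite mulr_suml; apply: ler_sum => j _.
  by rewrite -!mulrA (mulrC (q i x)).
by apply: filterS h => x hx; apply: eq_bigr => i _; rewrite hx.
Qed.

End matrix_multiplication.

(** * The weak divergence and the coefficients *)

Section borel_row_functions.
Context {R : realType} {n : nat}.

Lemma open_continuous_measurable_row (U : set 'rV[R]_n) (f : 'rV[R]_n -> R) :
  open U -> (forall x, U x -> {for x, continuous f}) -> measurable_fun U f.
Proof.
move=> oU fU; apply: (measurability _ (RGenOpens.measurableE R)).
move=> _ [_ [a [b ->] <-]]; apply: open_measurable_row.
rewrite openE => x [Ux fx]; apply: filterI; first exact: open_nbhs_nbhs.
by apply: (fU x Ux); apply: open_nbhs_nbhs; split.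
Qed.

Lemma continuous_measurable_row (f : 'rV[R]_n -> R) :
  continuous f -> measurable_fun setT f.
Proof.
by move=> cf; apply: open_continuous_measurable_row; [exact: openT|move=> x _; exact: cf].
Qed.

Lemma lebesgue_row_compact (K : set 'rV[R]_n) : compact K ->
  exists2 B, measurable B /\ K `<=` B & (lebesgue_row B < +oo)%E.
Proof.
move=> /compact_bounded[M [_ MK]].
have /choice[C CP] : forall i : 'I_n, exists C, forall x, K x -> `|x 0 i| <= C.
  move=> i; have KM := MK (M + 1) (ltr_pwDr ltr01 (lexx M)).
  exists (M + 1) => x Kx; apply: le_trans (KM x Kx).
  rewrite /Num.norm/= mx_normrE; exact: (le_bigmax _ (fun ij => `|x ij.1 ij.2|) (0, i)).
pose A i : set R := `[- C i, C i]%classic.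
have mA i : measurable (A i) by exact: measurable_itv.
exists [set x : 'rV[R]_n | forall i, A i (x 0 i)].
  split.
    rewrite (_ : [set x : 'rV[R]_n | _] = \bigcap_(i in [set: 'I_n]) ((fun x : 'rV[R]_n => x 0 i) @^-1` A i)).
      apply: fin_bigcap_measurable => // i _; rewrite -[X in measurable X]setTI.
      by apply: continuous_measurable_row => //; exact: coord_continuous.
    by apply/seteqP; split => [x xA i _|x xA i]; exact: xA.
  by move=> x Kx i; rewrite /A /= in_itv/= -ler_norml CP.
rewrite lebesgue_row_box// ltey_eq; apply/orP; left.
apply: (big_ind (fun e => e \is a fin_num)%E) => // [x y|i _]; first exact: fin_numM.
by rewrite lebesgue_measure_itv /=; case: ifP.
Qed.

Lemma compact_support_Lfun2 (mu : {measure set 'rV[R]_n -> \bar R})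
    (K : set 'rV[R]_n) (f : 'rV[R]_n -> R) :
  (forall B, measurable B -> (mu B <= lebesgue_row B)%E) ->
  compact K -> continuous f -> (forall x, ~ K x -> f x = 0) ->
  f \in Lfun mu 2%:E.
Proof.
move=> mul cK cf f0.
have [B [mB KB] Bfin] := lebesgue_row_compact cK.
have mf := continuous_measurable_row cf.
have [C CP] : exists C, forall x, `|f x| <= C.
  have /compact_bounded[M [_ MK]] : compact (f @` K).
    by apply: continuous_compact cK; exact: continuous_subspaceT.
  exists (`|M| + 1) => x; have [Kx|/f0 ->] := pselect (K x); last first.
    by rewrite normr0 addr_ge0.
  have M1 : M < `|M| + 1 by rewrite ltr_pwDr// ler_norm.
  by apply: (MK _ M1); exists x.
apply: Lfun2P => //.
apply: (@le_lt_trans _ _ (\int[mu]_x ((C ^+ 2)%:E * (\1_B x)%:E))%E).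
  apply: ge0_le_integral => //.
  - by move=> x _; rewrite lee_fin sqr_ge0.
  - by apply/measurable_EFinP; exact: measurable_funX.
  - by apply/measurable_EFinP; apply: measurable_funM => //; exact: measurable_indic.
  - move=> x _; rewrite -EFinM lee_fin indicE; have [Bx|Bx] := boolP (x \in B).
      rewrite mulr1 -[leLHS]real_normK ?num_real// ler_pXn2r// nnegrE//.
      exact: le_trans (CP x).
    by rewrite f0 ?expr0n/= ?mulr0// => /KB; rewrite -inE; apply/negP.
rewrite ge0_integralZl//; last 2 first.
- by apply/measurable_EFinP; exact: measurable_indic.
- by rewrite lee_fin sqr_ge0.
rewrite integral_indic// setIT lte_mul_pinfty ?lee_fin ?sqr_ge0//.
exact: le_lt_trans (mul _ mB) Bfin.
Qed.

End borel_row_functions.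

Section test_functions.
Context {R : realType} {n : nat} (D : lipschitzDomain R n).
Local Notation mu := (lebesgue_on D).

Lemma lebesgue_on_le B : measurable B -> (mu B <= lebesgue_row B)%E.
Proof.
move=> mB; apply: le_measure; rewrite ?inE//.
apply: measurableI => //; exact: open_measurable_row (@dom_open R n D).
Qed.

Lemma ae_dom : \forall x \ae mu, dom D x.
Proof.
have mD := open_measurable_row (@dom_open R n D).
exists (~` dom D); split => //; first exact: measurableC.
by rewrite /lebesgue_on /= /mrestr setICl measure0.
Qed.

Variable phi : 'rV[R]_n -> R.
Hypothesis tphi : test_function D phi.

Lemma test_function_Lfun2 : phi \in Lfun mu 2%:E.
Proof.
have [sphi cphi _] := tphi; apply: (compact_support_Lfun2 _ cphi).
- exact: lebesgue_on_le.
- exact: (sphi [::]).1.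
- by move=> x xK; apply: contrapT => /eqP phix; apply: xK; exact: subset_closure.
Qed.

Lemma test_partial_Lfun2 i : 'D_(delta_mx 0 i) phi \in Lfun mu 2%:E.
Proof.
have [sphi cphi _] := tphi; apply: (compact_support_Lfun2 _ cphi).
- exact: lebesgue_on_le.
- exact: (sphi [:: i]).1.
- move=> x xK; rewrite (@near_eq_derive _ _ _ _ (cst 0)) ?derive_cst//.
  have oC : open (~` closure [set x | phi x != 0]) by rewrite openC; exact: closed_closure.
  apply: filterS (open_nbhs_nbhs (conj oC xK)) => y yK.
  by apply: contrapT => /eqP phix; apply: yK; exact: subset_closure.
Qed.

End test_functions.

Section weak_divergence_graph.
Context {R : realType} {n : nat} (D : lipschitzDomain R n).
Local Notation mu := (lebesgue_on D).

Local Notation LD := (nfold (L2 mu : hilbertType R) n : hilbertType R).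
Local Notation MD := (L2 mu : hilbertType R).

Definition test_pairs : set (prodh LD MD) := [set t : prodh LD MD | exists phi, [/\ test_function D phi,
    forall i, \forall x \ae mu, t.1 i x = 'D_(delta_mx 0 i) phi x &
    \forall x \ae mu, t.2 x = phi x]].

(** The integral identity defining the weak divergence is (q, grad phi) + (v, phi) = 0, that is,
    orthogonality in the Hilbert sum. This is what makes the abstract mixed theory applicable to
    [Hdiv]. *)
Lemma weak_divergenceP (q : nfold (L2 mu) n) (v : L2 mu) :
  weak_divergence q v <-> annih test_pairs (q, v).
Proof.
have key (t : prodh LD MD) phi :
    (forall i, \forall x \ae mu, t.1 i x = 'D_(delta_mx 0 i) phi x) ->
    (\forall x \ae mu, t.2 x = phi x) ->
    inner ((q, v) : prodh _ _) t =
    \int[mu]_x (\sum_i q i x * 'D_(delta_mx 0 i) phi x) + \int[mu]_x (v x * phi x).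
  move=> t1 t2; rewrite prodh_innerE/=; congr (_ + _).
    have {}t1 : \forall x \ae mu, forall i, t.1 i x = 'D_(delta_mx 0 i) phi x.
      exact: filter_forall.
    apply: nfold_L2_innerE; apply: filterS t1 => x h.
    by apply: eq_bigr => i _; rewrite h.
  by apply: L2_innerE; apply: filterS t2 => x h; congr (_ * _); exact: h.
split=> [qv t [phi [tphi t1 t2]]|qv phi tphi].
  by rewrite (key _ _ t1 t2) qv// addNr.
have t1 i : \forall x \ae mu,
    L2_of mu ('D_(delta_mx 0 i) phi) x = 'D_(delta_mx 0 i) phi x.
  by apply: L2_ofE (test_partial_Lfun2 tphi i) _; exact: nearW.
have t2 : \forall x \ae mu, L2_of mu phi x = phi x.
  by apply: L2_ofE (test_function_Lfun2 tphi) _; exact: nearW.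
pose t : prodh LD MD :=
  ([ffun i => L2_of mu ('D_(delta_mx 0 i) phi)], L2_of mu phi).
have t1' i : \forall x \ae mu, t.1 i x = 'D_(delta_mx 0 i) phi x.
  by rewrite ffunE; exact: t1.
apply/eqP; rewrite -addr_eq0 -(key t)//; apply/eqP/qv.
by exists phi.
Qed.

Lemma Hdiv_ext (p q : Hdiv D) : field_of p = field_of q -> div p = div q -> p = q.
Proof.
case: p => p dp wp; case: q => q dq wq /= pq dpq; subst.
by congr MkHdiv; exact: Prop_irrelevance.
Qed.

End weak_divergence_graph.

Section coefficients.
Context {R : realType} {n : nat} (D : lipschitzDomain R n).
Local Notation mu := (lebesgue_on D).

Lemma ae_bounded_Lfun_infty (f : 'rV[R]_n -> R) : f \in Lfun mu +oo%E -> ae_bounded mu f.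
Proof.
move=> /andP[/[!inE]/= mf]; rewrite /finite_norm unlock => h.
suff [K KP] : exists K : R, \forall x \ae mu, `|f x| <= K.
  exists `|K|, f; split => //; first exact: nearW.
  by apply: filterS KP => x h'; exact: le_trans h' (ler_norm _).
(* If the whole space is null, any bound holds almost everywhere; otherwise [mu0] lets the [+oo]
   norm unfold to an essential supremum. *)
have [mu0|] := ltP 0%E (mu setT); last first.
  rewrite measure_le0 => /eqP mu0; exists 0; exists setT; split => //.
move: h; rewrite mu0 => h.
have := ess_sup_ge mu (abse \o (EFin \o f)).
move: h; case: (ess_sup _ _) => [r _ H|//|_ H].
  by exists r; apply: filterS H => x /=; rewrite lee_fin.
by exists 0; apply: filterS H.
Qed.

Lemma ae_bounded_piecewise_continuous (c : 'rV[R]_n -> R) c0 c1 :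
  piecewise_continuous (dom D) c -> 0 <= c0 ->
  (forall x, dom D x -> c0 <= c x <= c1) -> ae_bounded mu c.
Proof.
move=> [k [U [oU _ U0 cU]]] c00 c01.
pose W := \bigcup_i U i.
have oW : open W by apply: bigcup_open => i _; exact: (oU i).1.
have mW : measurable W := open_measurable_row oW.
have mD := open_measurable_row (@dom_open R n D).
(* The measurable copy is the extension by zero of [c] from the open union [W] of the pieces; what
   it changes inside the domain is a null set. *)
exists `|c1|, (c \_ W); split => //.
- apply/(measurable_restrictT _ mW).
  by apply: (open_continuous_measurable_row oW) => x [i _ Uix]; exact: cU Uix.
- exists (~` W); split.
  + exact: measurableC.
  + by rewrite /lebesgue_on /= /mrestr setIC -setDE.
  + by move=> x /= + Wx; apply; rewrite patchE mem_set.
- apply: filterS (ae_dom D) => x Dx; have /andP[h1 h2] := c01 x Dx.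
  rewrite ger0_norm; first exact: le_trans h2 (ler_norm _).
  exact: le_trans h1.
Qed.

(** The inverse is rewritten as x * (x^2)^-1, with a real power of a nonnegative number. At 0 both
    sides vanish because [0^-1 = 0]. *)
Lemma measurable_inv d (T : measurableType d) (f : T -> R) :
  measurable_fun setT f -> measurable_fun setT (fun x => (f x)^-1).
Proof.
move=> mf; rewrite (_ : (fun x => _) = fun x => f x * (f x ^+ 2) `^ (-1)).
  apply: measurable_funM => //.
  apply: (measurableT_comp (measurable_powR _)) => //.
  exact: measurable_funX.
apply/funext => x; rewrite powR_inv1 ?sqr_ge0//.
have [->|fx0] := eqVneq (f x) 0; first by rewrite invr0 mul0r.
by field.
Qed.

Lemma measurable_det d (T : measurableType d) m (F : T -> 'M[R]_m) :
  (forall i j, measurable_fun setT (fun x => F x i j)) ->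
  measurable_fun setT (fun x => \det (F x)).
Proof.
move=> mF; apply: measurable_sum => s; apply: measurable_funM => //.
by apply: measurable_prod => i _.
Qed.

Variable A : 'rV[R]_n -> 'M[R]_n.
Hypothesis hA : elliptic D A.

Lemma elliptic_quadratic x (v : 'rV[R]_n) :
  \sum_i \sum_j A x i j * v 0 i * v 0 j = (v *m A x *m v^T) 0 0.
Proof.
rewrite mxE exchange_big; apply: eq_bigr => j _; rewrite !mxE mulr_suml.
by apply: eq_bigr => i _; rewrite (mulrC (A x i j)).
Qed.

Lemma elliptic_unitmx x : dom D x -> A x \in unitmx.
Proof.
move=> Dx; have [_ [m0 m00 /(_ x Dx) Am]] := hA.
rewrite unitmxE unitfE; apply/det0P => -[v v0 vA].
have := Am (v 0); rewrite elliptic_quadratic vA mul0mx mxE pmulr_rle0// => h.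
case/eqP: v0; apply/rowP => i; rewrite mxE; apply/eqP; rewrite -sqrf_eq0 eq_le sqr_ge0 andbT.
apply: le_trans h; rewrite (bigD1 i)//= lerDl.
by apply: sumr_ge0 => j _; exact: sqr_ge0.
Qed.

(** For the column v = A^-1 e_j, ellipticity gives m0 |v|^2 <= (A v, v) = v_j <= |v|, hence |v| <= 1
    / m0; no bound on the entries of A enters. *)
Lemma elliptic_inverse_le : exists K, forall x, dom D x -> forall i j,
  `|invmx (A x) i j| <= K.
Proof.
have [_ [m0 m00 Am]] := hA; exists m0^-1 => x Dx i j.
pose v := (col j (invmx (A x)))^T.
pose s := \sum_i v 0 i ^+ 2.
have s0 : 0 <= s by apply: sumr_ge0 => k _; exact: sqr_ge0.
have vs k : v 0 k ^+ 2 <= s.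
  by rewrite /s (bigD1 k)//= lerDl; apply: sumr_ge0 => l _; exact: sqr_ge0.
have h : m0 * s <= v 0 j.
  apply: le_trans (Am x Dx (v 0)) _; rewrite elliptic_quadratic -mulmxA.
  have -> : A x *m v^T = delta_mx j 0.
    by rewrite /v trmxK colE mulmxA mulmxV ?elliptic_unitmx// mul1mx.
  by rewrite -colE mxE lexx.
have h1 : s <= m0^-1 ^+ 2.
  have h2 : (m0 * s) ^+ 2 <= s.
    apply: le_trans (vs j); rewrite ler_pXn2r ?nnegrE//.
      by rewrite mulr_ge0// ltW.
    by apply: le_trans h; rewrite mulr_ge0// ltW.
  have [->|sn0] := eqVneq s 0; first exact: sqr_ge0.
  have sp : 0 < s by rewrite lt_neqAle eq_sym sn0.
  rewrite exprVn -[leRHS]mul1r ler_pdivlMr ?exprn_gt0//.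
  by rewrite -(ler_pM2r sp) mul1r; apply: le_trans h2; rewrite exprMn expr2; lra.
rewrite -(@ler_pXn2r _ 2)// ?nnegrE ?invr_ge0 ?(ltW m00)//.
apply: le_trans h1; rewrite real_normK ?num_real//.
by have := vs i; rewrite /v !mxE.
Qed.

Lemma elliptic_ae_bounded : ae_bounded_mx mu A.
Proof. by have [AL _] := hA => i j; exact: ae_bounded_Lfun_infty. Qed.

Lemma elliptic_inverse_ae_bounded : ae_bounded_mx mu (fun x => invmx (A x)).
Proof.
move=> i j; have [K KP] := elliptic_inverse_le.
have mA k l : measurable_fun setT (fun x => A x k l).
  by have [AL _] := hA; have /andP[/[!inE]] := AL k l.
(* Cramer's formula is measurable everywhere and coincides with [invmx] on the domain, where [A x]
   is invertible. *)
exists `|K|, (fun x => (\det (A x))^-1 * (\adj (A x)) i j); split => //.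
- apply: measurable_funM; first by apply: measurable_inv; exact: measurable_det.
  rewrite (_ : (fun x => _) = (fun x => (-1) ^+ (j + i) * \det (row' j (col' i (A x))))).
    apply: measurable_funM => //; apply: measurable_det => k l.
    rewrite (_ : (fun x => _) = (fun x => A x (lift j k) (lift i l)))//.
    by apply/funext => x; rewrite !mxE.
  by apply/funext => x; rewrite mxE.
- apply: filterS (ae_dom D) => x Dx.
  by rewrite /invmx elliptic_unitmx// !mxE.
- by apply: filterS (ae_dom D) => x Dx; apply: le_trans (KP x Dx i j) (ler_norm _).
Qed.

End coefficients.

(** * The optimality system *)

Section mixed_problem_operators.
Context {R : realType} {n : nat} (D : lipschitzDomain R n).
Local Notation mu := (lebesgue_on D).
Local Notation LD := (nfold (L2 mu : hilbertType R) n : hilbertType R).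
Local Notation MD := (L2 mu : hilbertType R).
Local Notation T := (@test_pairs R n D).

Lemma mulmx_operator (F : 'rV[R]_n -> 'M[R]_n) : ae_bounded_mx mu F ->
  exists f : {linear LD -> LD}, forall q, f q = L2_mulmx (mu := mu) F q.
Proof.
move=> bF.
pose f : {linear LD -> LD} := HB.pack (L2_mulmx (mu := mu) F : LD -> LD)
  (GRing.isLinear.Build R LD LD _ (L2_mulmx (mu := mu) F) (L2_mulmx_linear bF)).
by exists f.
Qed.

Lemma mul_operator (g : 'rV[R]_n -> R) : ae_bounded mu g ->
  exists f : {linear MD -> MD}, forall q, f q = L2_mul (mu := mu) g q.
Proof.
move=> bg.
pose f : {linear MD -> MD} := HB.pack (L2_mul (mu := mu) g : MD -> MD)
  (GRing.isLinear.Build R MD MD _ (L2_mul (mu := mu) g) (L2_mul_linear bg)).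
by exists f.
Qed.

(** [oA] and [oAt] are multiplication by A and its transpose, [oB] and [oBt] by their inverses, [oc]
    by c. The forms involve A^-1 while ellipticity gives coercivity of A, so both families are
    carried along. *)
Lemma mixed_operators (A : 'rV[R]_n -> 'M[R]_n) (c : 'rV[R]_n -> R) (c0 c1 : R) :
  elliptic D A -> piecewise_continuous (dom D) c -> 0 <= c0 ->
  (forall x, dom D x -> c0 <= c x <= c1) ->
  exists (oA oB oAt oBt : {linear LD -> LD}) (oc : {linear MD -> MD}),
  [/\ [/\ bounded_op oA, bounded_op oAt, bounded_op oc,
          positive_definite_op oA & positive_definite_op oAt],
      [/\ cancel oB oA, cancel oAt oBt &
          forall u v, inner (oB u) v = inner u (oBt v)],
      selfadjoint oc /\ (forall u, 0 <= inner (oc u) u),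
      (forall q1 q2 : Hdiv D, form_a A q1 q2 = inner (oB (field_of q1)) (field_of q2 : LD)) &
      (forall v1 v2 : L2D D, form_m c v1 v2 = inner (oc v1) (v2 : MD))].
Proof.
move=> hA hc hc0 hc01.
have bc := ae_bounded_piecewise_continuous hc hc0 hc01.
have bA := elliptic_ae_bounded hA.
have bB := elliptic_inverse_ae_bounded hA.
have tr F : ae_bounded_mx mu F -> ae_bounded_mx mu (fun x => (F x)^T).
  move=> bF i j; rewrite (_ : (fun x => _) = (fun x => F x j i))//.
  by apply/funext => x; rewrite mxE.
have [oA oAE] := mulmx_operator bA.
have [oB oBE] := mulmx_operator bB.
have [oAt oAtE] := mulmx_operator (tr _ _ bA).
have [oBt oBtE] := mulmx_operator (tr _ _ bB).
have [oc ocE] := mul_operator bc.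
have bdd F (o : {linear LD -> LD}) : ae_bounded_mx mu F ->
    (forall q, o q = L2_mulmx (mu := mu) F q) -> bounded_op o.
  move=> bF oE; have [K KP] := L2_mulmx_bounded bF.
  by exists K => q; rewrite oE; exact: KP.
have [_ [m0 m00 Am]] := hA.
have pd F (o : {linear LD -> LD}) : ae_bounded_mx mu F ->
    (forall q, o q = L2_mulmx (mu := mu) F q) ->
    (forall x, dom D x -> forall xi : 'I_n -> R,
      m0 * (\sum_i xi i ^+ 2) <= \sum_i \sum_j F x i j * xi i * xi j) ->
    positive_definite_op o.
  move=> bF oE Fm; have [|a a0 aP] := L2_mulmx_coercive bF m00.
    by apply: filterS (ae_dom D) => x; exact: Fm.
  by exists a => // q; rewrite oE; exact: aP.
exists oA, oB, oAt, oBt, oc; split.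
- split.
  + exact: bdd bA oAE.
  + exact: bdd (tr _ _ bA) oAtE.
  + have [K KP] := L2_mul_bounded bc.
    by exists K => q; rewrite ocE; exact: KP.
  + exact: pd bA oAE Am.
  + apply: pd (tr _ _ bA) oAtE _ => x Dx xi; apply: le_trans (Am x Dx xi) _.
    rewrite exchange_big; apply: ler_sum => i _; apply: ler_sum => j _.
    by rewrite mxE mulrAC.
- split.
  + move=> q; rewrite oAE oBE; apply: (L2_mulmxK bA bB).
    by apply: filterS (ae_dom D) => x Dx; rewrite mulmxV// (elliptic_unitmx hA).
  + move=> q; rewrite oBtE oAtE; apply: (L2_mulmxK (tr _ _ bB) (tr _ _ bA)).
    apply: filterS (ae_dom D) => x Dx.
    by rewrite -trmx_mul mulmxV ?(elliptic_unitmx hA)// trmx1.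
  + by move=> u v; rewrite oBE oBtE; exact: L2_mulmx_adjoint.
- split; first by move=> u v; rewrite !ocE; exact: L2_mul_selfadjoint.
  move=> u; rewrite ocE; apply: (L2_mul_ge0 u bc).
  by apply: filterS (ae_dom D) => x Dx; have /andP[+ _] := hc01 x Dx; exact: le_trans.
- move=> q1 q2; rewrite oBE; apply/esym/nfold_L2_innerE.
  apply: filterS (L2_mulmxE (field_of q1) bB) => x h.
  apply: eq_bigr => i _; rewrite [X in X * _]h !mxE; congr (_ * _).
  by apply: eq_bigr => j _; rewrite mxE.
- by move=> v1 v2; rewrite ocE; apply/esym/L2_inner_mul.
Qed.

Variables (oB : LD -> LD) (oc : MD -> MD).

Lemma annih_Hdiv (e : prodh LD MD) : annih T e ->
  exists q : Hdiv D, field_of q = e.1 :> LD /\ div q = e.2 :> MD.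
Proof. by case: e => q v /weak_divergenceP h; exists (MkHdiv h). Qed.

Lemma Hdiv_annih (q : Hdiv D) : annih T ((field_of q, div q) : prodh LD MD).
Proof. by apply/weak_divergenceP; exact: divP. Qed.

(** An element of [Hdiv] stores its divergence, so the second equation tested with every v is an
    identity for [div q], and graph membership then comes from the record itself. *)
Lemma mixed_Hdiv (q : Hdiv D) (phi : MD) (g1 : LD) (g2 : MD) :
  (mixed T oB oc g1 g2 (field_of q) phi /\ div q = g2 - oc phi) <->
  (forall q' : Hdiv D, inner (oB (field_of q)) (field_of q' : LD) -
     inner phi (div q' : MD) = - inner g1 (field_of q' : LD)) /\
  (forall v : MD, inner (div q : MD) v + inner (oc phi) v = inner g2 v).
Proof.
split=> [[[h1 h2] dq]|[h1 h2]].
  split=> [q'|v]; first exact: (h1 _ (Hdiv_annih q')).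
  by rewrite dq innerBl subrK.
have dq : div q = g2 - oc phi.
  by apply: inner_inj => v; rewrite innerBl -h2 addrK.
split => //; split; last by rewrite -dq; exact: Hdiv_annih.
by move=> e /annih_Hdiv[q' [<- <-]].
Qed.

End mixed_problem_operators.

Lemma transposeE (R : realType) (U : hilbertType R) (V : preHilbertType R)
    (C : {linear U -> V}) : bounded_op C ->
  forall u q, inner (transpose C (riesz u)) q = inner (C q) u.
Proof.
move=> /bounded_op_ge0[K K0 CK] u q.
have [|v|g gP] := @riesz_representation R U (fun v => inner (C v) u) (K * `|u|).
- by move=> a v w; rewrite linearP innerDl innerZl.
- apply: le_trans (Cauchy_Schwarz _ _) _; rewrite mulrAC.
  by rewrite ler_wpM2r.
(* The Riesz representative [g] shows that the defining set is inhabited, which excludes the default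
   of [xget]. *)
rewrite /transpose; case: xgetP => [h -> /= hP|/(_ g)/= []].
  by rewrite innerC hP.
by move=> v; rewrite innerC gP.
Qed.

Section optimality_system_theory.
Context {R : realType} {n : nat} (D : lipschitzDomain R n).
Local Notation mu := (lebesgue_on D).
Local Notation LD := (nfold (L2 mu : hilbertType R) n : hilbertType R).
Local Notation MD := (L2 mu : hilbertType R).
Local Notation T := (@test_pairs R n D).
Variables (A : 'rV[R]_n -> 'M[R]_n) (c : 'rV[R]_n -> R).
Variables (oA oB oAt oBt : {linear LD -> LD}) (oc : {linear MD -> MD}).
Hypotheses (bA : bounded_op oA) (bAt : bounded_op oAt) (bc : bounded_op oc).
Hypotheses (pA : positive_definite_op oA) (pAt : positive_definite_op oAt).
Hypotheses (BA : cancel oB oA) (AtBt : cancel oAt oBt).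
Hypothesis BBt : forall u v, inner (oB u) v = inner u (oBt v).
Hypotheses (csa : selfadjoint oc) (c_ge0 : forall u, 0 <= inner (oc u) u).
Hypothesis formaE : forall q1 q2 : Hdiv D,
  form_a A q1 q2 = inner (oB (field_of q1)) (field_of q2 : LD).
Hypothesis formmE : forall v1 v2 : L2D D, form_m c v1 v2 = inner (oc v1) (v2 : MD).

Lemma is_stateP (f : MD) (j : Hdiv D) (phi : MD) :
  is_state A c f j phi <->
  mixed T oB oc 0 f (field_of j) phi /\ div j = f - oc phi.
Proof.
rewrite mixed_Hdiv; split=> -[h1 h2]; split=> [q|v].
- by have := h1 q; rewrite formaE inner0l oppr0.
- have := h2 v; rewrite formmE -[form_b j v]/(- inner v (div j : MD)).
  rewrite -[\int[_]_x _]/(inner f v) (innerC v) => h.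
  by apply: oppr_inj; rewrite opprD h.
- by have := h1 q; rewrite formaE inner0l oppr0.
- rewrite formmE -[form_b j v]/(- inner v (div j : MD)).
  by rewrite -[\int[_]_x _]/(inner f v) (innerC v) -h2 opprD.
Qed.

(** [Hdiv] has no module structure here; the combined flux is rebuilt as a record from its
    membership in the graph. *)
Lemma is_state_lin a (f f' : MD) (j j' : Hdiv D) (phi phi' : MD) :
  is_state A c f j phi -> is_state A c f' j' phi' ->
  exists2 j2 : Hdiv D, field_of j2 = a *: (field_of j : LD) + field_of j' :> LD &
    is_state A c (a *: f + f') j2 (a *: phi + phi').
Proof.
move=> /is_stateP[h dj] /is_stateP[h' dj'].
have h2 := mixed_lin a h h'.
have [j2 [e1 e2]] := annih_Hdiv h2.2.
by exists j2 => //; apply/is_stateP; rewrite e1 e2.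
Qed.

Variables (H1 H2 : hilbertType R).
Variables (Q1 : {linear H1 -> H1}) (Q2 : {linear H2 -> H2}).
Variables (C1 : {linear LD -> H1}) (C2 : {linear MD -> H2}).
Variables (l0 : MD) (Q Qinv : {linear MD -> MD}).
Hypotheses (bC1 : bounded_op C1) (bC2 : bounded_op C2).

Local Notation g1 p1 := (transpose C1 (riesz (Q1 (C1 (field_of p1))))).
Local Notation g2 p2 := (transpose C2 (riesz (Q2 (C2 p2)))).

Lemma optimality_systemP (z1 p1 : Hdiv D) (z2 p2 : MD) :
  optimality_system A c l0 Q1 Q2 C1 C2 Qinv z1 z2 p1 p2 <->
  (mixed T oBt oc (g1 p1) (g2 p2) (field_of z1) z2 /\ div z1 = g2 p2 - oc z2) /\
  is_state A c (Qinv (l0 - z2)) p1 p2.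
Proof.
rewrite is_stateP !mixed_Hdiv.
split=> [[h1 h2 h3 h4]|[[h1 h2] [h3 h4]]]; split.
- split=> [q|v].
    by have := h1 q; rewrite /form_astar formaE BBt innerC.
  have := h2 v; rewrite formmE -[form_b z1 v]/(- inner v (div z1 : MD)) opprK.
  by rewrite (innerC v).
- split=> [q|v].
    by have := h3 q; rewrite formaE inner0l oppr0.
  have := h4 v; rewrite formmE -[form_b p1 v]/(- inner v (div p1 : MD)) opprK.
  by rewrite (innerC v) (innerC v).
- by move=> q; rewrite /form_astar formaE BBt innerC; exact: h1.
- move=> v; rewrite formmE -[form_b z1 v]/(- inner v (div z1 : MD)) opprK.
  by rewrite (innerC v); exact: h2.
- by move=> q; have := h3 q; rewrite formaE inner0l oppr0.
- move=> v; rewrite formmE -[form_b p1 v]/(- inner v (div p1 : MD)) opprK.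
  by rewrite (innerC v) (innerC v); exact: h4.
Qed.

(** Duality of the state and adjoint problems with the transposes evaluated. In the estimation
    argument the adjoint equations enter only through this identity. *)
Lemma optimality_system_identity (z1 p1 j : Hdiv D) (z2 p2 f phi : MD) :
  optimality_system A c l0 Q1 Q2 C1 C2 Qinv z1 z2 p1 p2 ->
  is_state A c f j phi ->
  inner z2 f = inner (C1 (field_of j)) (Q1 (C1 (field_of p1))) +
               inner (C2 phi) (Q2 (C2 p2)).
Proof.
move=> /optimality_systemP[[mz _] _] /is_stateP[mj _].
by rewrite (mixed_duality BBt csa mj mz) !transposeE.
Qed.

Hypotheses (state_wp : forall f : L2D D,
  exists! s : Hdiv D * L2D D, is_state A c f s.1 s.2).
Hypotheses (Q_bounded : bounded_op Q) (Q_sa : selfadjoint Q) (Q_pos : positive_op Q).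
Hypothesis Q_inv : bounded_inverse Q Qinv.
Hypotheses (Q1_bounded : bounded_op Q1) (Q1_sa : selfadjoint Q1) (Q1_pos : positive_op Q1).
Hypotheses (Q2_bounded : bounded_op Q2) (Q2_sa : selfadjoint Q2) (Q2_pos : positive_op Q2).

Lemma observation_form (U H : hilbertType R) (C : {linear U -> H}) (S : {linear H -> H}) :
  bounded_op C -> bounded_op S -> selfadjoint S -> positive_op S ->
  let k u v := inner (S (C u)) (C v) in
  [/\ bilinear_form k, forall u v, k u v = k v u, forall u, 0 <= k u u & bounded_form k].
Proof.
move=> /bounded_op_ge0[K K0 CK] /bounded_op_ge0[J J0 SJ] Ssa Spos k; split.
- by split=> a u v w; rewrite /k !linearP ?innerDl ?innerDr ?innerZl ?innerZr.
- by move=> u v; rewrite /k Ssa innerC.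
- by move=> u; exact: positive_op_ge0.
- exists (J * K * K) => [|u v]; first by rewrite !mulr_ge0.
  apply: le_trans (Cauchy_Schwarz _ _) _; rewrite mulrACA; apply: ler_pM => //.
  by apply: le_trans (SJ _) _; rewrite -mulrA ler_wpM2l.
Qed.

Lemma optimality_system_exists : exists (z1 p1 : Hdiv D) (z2 p2 : MD),
  optimality_system A c l0 Q1 Q2 C1 C2 Qinv z1 z2 p1 p2.
Proof.
have solv f : exists q phi, mixed T oB oc 0 f q phi.
  have [[j phi] [/is_stateP[h _] _]] := state_wp f.
  by exists (field_of j), phi.
have [k1b k1C k10 k1K] := observation_form bC1 Q1_bounded Q1_sa Q1_pos.
have [k2b k2C k20 k2K] := observation_form bC2 Q2_bounded Q2_sa Q2_pos.
have pQ := positive_op_definite Q_bounded Q_sa Q_pos Q_inv.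
have [r [q [phi [h1 [h2 [z1 [z2 [mq h1P h2P mz Qr]]]]]]]] :=
  optimality_exists l0 bA bAt bc pA pAt BA AtBt BBt csa c_ge0 solv Q_bounded Q_sa pQ
    k1b k1C k10 k1K k2b k2C k20 k2K.
have [p1 [p1E dp1]] := annih_Hdiv mq.2.
have [y1 [y1E dy1]] := annih_Hdiv mz.2.
have [QQinv _ _] := Q_inv.
exists y1, p1, z2, phi; apply/optimality_systemP.
have e1 : h1 = g1 p1.
  by apply: inner_inj => v; rewrite h1P transposeE// p1E innerC.
have e2 : h2 = g2 phi by apply: inner_inj => v; rewrite h2P transposeE// innerC.
rewrite is_stateP -e1 -e2 -Qr QQinv p1E y1E dp1 dy1.
by split.
Qed.

(** Both identities are tested on the state for r - r'. They give (Q (r - r'), r - r') = (z2' - z2,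
    r - r'), which is minus a sum of nonnegative [Q1]- and [Q2]-forms of observation differences;
    positivity of [Q] forces r = r'. Then [z2] follows by applying [Q], and the state (p1, p2) from
    its uniqueness. *)
Lemma optimality_system_unique (z1 p1 z1' p1' : Hdiv D) (z2 p2 z2' p2' : MD) :
  optimality_system A c l0 Q1 Q2 C1 C2 Qinv z1 z2 p1 p2 ->
  optimality_system A c l0 Q1 Q2 C1 C2 Qinv z1' z2' p1' p2' ->
  [/\ z1 = z1', z2 = z2', p1 = p1' & p2 = p2'].
Proof.
move=> os os'; have /optimality_systemP[[mz dz] sp] := os.
have /optimality_systemP[[mz' dz'] sp'] := os'.
have [_ QinvQ _] := Q_inv.
pose r := Qinv (l0 - z2); pose r' := Qinv (l0 - z2').
have [j jE sj] := is_state_lin (-1) sp' sp.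
have i1 := optimality_system_identity os sj.
have i2 := optimality_system_identity os' sj.
have rE : -1 *: r' + r = 0.
  apply/eqP/negPn/negP => /Q_pos; rewrite linearP /= !QinvQ scaleN1r.
  rewrite (_ : - (l0 - z2') + (l0 - z2) = z2' - z2); last first.
    by rewrite opprB addrA subrK.
  rewrite innerBl i1 i2 jE !linearP/=.
  set a := C1 _; set a' := C1 _; set b := C2 _; set b' := C2 _.
  have := positive_op_ge0 Q1_pos (a - a'); have := positive_op_ge0 Q2_pos (b - b').
  rewrite !linearB/= !innerBl !innerBr !innerDl !innerZl.
  rewrite !(Q1_sa _ a) !(Q1_sa _ a') !(Q2_sa _ b) !(Q2_sa _ b').
  by rewrite ?(innerC a) ?(innerC a') ?(innerC b) ?(innerC b'); lra.
have rr' : r = r' by move: rE; rewrite scaleN1r addrC => /subr0_eq.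
have z2E : z2 = z2'.
  have : Q r = Q r' by rewrite rr'.
  by rewrite !QinvQ => /addrI/oppr_inj.
have [s [_ us]] := state_wp r.
have e : (p1, p2) = (p1', p2').
  by rewrite -(us (p1, p2) sp) -(us (p1', p2'))//= -/r rr'.
have [p1E p2E] : p1 = p1' /\ p2 = p2' by case: e.
split => //; subst p1' p2' z2'.
apply: Hdiv_ext; last by rewrite dz dz'.
(* Potentials and sources now agree, so subtracting the adjoint equations tested with the difference
   d of the fluxes leaves (oBt d, d) = 0. As (oB d, d) = (oA (oB d), oB d), coercivity of [oA] gives
   oB d = 0. *)
pose e0 : prodh LD MD := (field_of z1, div z1); pose e1 : prodh LD MD := (field_of z1', div z1').
have Ge : annih T (-1 *: e1 + e0) by apply: (subspace_annih T).2; exact: Hdiv_annih.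
have h1 := mz.1 _ Ge; have h2 := mz'.1 _ Ge.
have h : inner (oBt (field_of z1 - field_of z1')) (field_of z1 - field_of z1' : LD) = 0.
  move: h1 h2; set e2 := -1 *: e1 + e0.
  have -> : e2.1 = field_of z1 - field_of z1' by rewrite /e2 /= scaleN1r addrC.
  by rewrite linearB innerBl => h1 h2; lra.
move: h; rewrite innerC -BBt; set d : LD := _ - _ => h.
have oB0 : oB d = 0.
  have [a a0 aP] := pA; apply/eqP; rewrite -normr_eq0 -sqrf_eq0 eq_le sqr_ge0 andbT.
  by have := aP (oB d); rewrite BA innerC h pmulr_rle0.
have d0 : d = 0 by rewrite -(BA d) oB0 linear0.
by move/subr0_eq: d0.
Qed.

End optimality_system_theory.

(** * Second moments of Hilbert-valued noises *)

Section bochner_theory.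
Context d (Omega : measurableType d) (R : realType) (P : probability Omega R).
Context (H : preHilbertType R).
Implicit Types (X s : Omega -> H) (u v : H).

Lemma simple_measurable_comp s (g : H -> R) : simple s ->
  measurable_fun setT (fun w => g (s w)).
Proof.
move=> [fs ms] _ Y mY; rewrite setTI.
rewrite (_ : _ @^-1` _ = \bigcup_(v in [set v | range s v /\ Y (g v)]) s @^-1` [set v]).
  apply: fin_bigcup_measurable => [|v _]; last exact: ms.
  by apply: sub_finite_set fs => v [].
apply/seteqP; split => [w Yw|w [v [_ Yv] /= swv]]; last by rewrite /preimage/= swv.
by exists (s w) => //; split => //; exists w.
Qed.

(** [H] carries no sigma-algebra, so real functions of a noise are shown measurable as pointwise
    limits along the approximating simple functions. *)
Lemma strongly_measurable_comp X (g : H -> R) : strongly_measurable X -> continuous g ->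
  measurable_fun setT (fun w => g (X w)).
Proof.
move=> [s ss sX] cg; apply: (@measurable_fun_cvg _ _ _ _ (fun k w => g (s k w))) => [k|w _].
  exact: simple_measurable_comp.
by apply: continuous_cvg (sX w); exact: cg.
Qed.

Lemma strongly_measurable_simple_comp X s (g : H -> H -> R) :
  strongly_measurable X -> simple s -> (forall v, continuous (g^~ v)) ->
  measurable_fun setT (fun w => g (X w) (s w)).
Proof.
move=> mX [fs ms] cg _ Y mY; rewrite setTI.
rewrite (_ : _ @^-1` _ = \bigcup_(v in range s)
    (s @^-1` [set v] `&` (fun w => g (X w) v) @^-1` Y)).
  apply: fin_bigcup_measurable => // v _; apply: measurableI; first exact: ms.
  rewrite -[X in measurable X]setTI.
  exact: (strongly_measurable_comp mX (cg v)).
apply/seteqP; split => [w Yw|w [v _ [/= swv]]]; last by rewrite /preimage/= swv.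
by exists (s w) => //; exists w.
Qed.

Lemma bochner_L2_inner X u : bochner_L2 P X -> (fun w => inner (X w) u) \in Lfun P 2%:E.
Proof.
move=> [mX X2].
have m1 := strongly_measurable_comp mX (@continuous_inner _ _ u).
have m2 : measurable_fun setT (fun w => `|X w|).
  by apply: strongly_measurable_comp mX _; exact: norm_continuous.
apply: Lfun2P => //.
apply: (@le_lt_trans _ _ (\int[P]_w ((`|u| ^+ 2)%:E * (`|X w| ^+ 2)%:E))%E).
  apply: ge0_ae_le_integral.
  - by move=> w; rewrite lee_fin sqr_ge0.
  - by move=> w; rewrite -EFinM lee_fin mulr_ge0// sqr_ge0.
  - apply: nearW => w; rewrite -EFinM lee_fin -[leLHS]real_normK ?num_real//.
    by rewrite -exprMn ler_pXn2r ?nnegrE ?mulr_ge0// mulrC; exact: Cauchy_Schwarz.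
rewrite ge0_integralZl//.
- by rewrite lte_mul_pinfty ?lee_fin ?sqr_ge0.
- by apply/measurable_EFinP; exact: measurable_funX.
Qed.

Lemma Lfun2_integrable (f : Omega -> R) : f \in Lfun P 2%:E ->
  P.-integrable setT (EFin \o f).
Proof.
move=> fL; apply/Lfun1_integrable; apply: (Lfun_subset12 _ fL).
exact: fin_num_measure.
Qed.

Lemma Lfun2_mul_integrable (f g : Omega -> R) : f \in Lfun P 2%:E -> g \in Lfun P 2%:E ->
  P.-integrable setT (EFin \o (fun w => f w * g w)).
Proof. by move=> fL gL; apply/Lfun1_integrable; exact: Lfun2_mul_Lfun1. Qed.

Lemma scaled_indic_integrable (a : R) (B : set Omega) : measurable B ->
  P.-integrable setT (EFin \o (fun w => a * \1_B w)).
Proof.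
move=> mB; rewrite (_ : EFin \o _ = fun w => (a%:E * (EFin \o \1_B) w)%E)//.
by apply: integrableZl => //; exact: integrable_indic.
Qed.

Lemma simple_innerE s u : simple s ->
  (fun w => inner (s w) u) = (fun w => \sum_(v <- fset_set (range s))
     inner v u * \1_(s @^-1` [set v]) w).
Proof.
move=> [fs _]; apply/funext => w.
have sw : s w \in fset_set (range s) by rewrite in_fset_set// mem_set//; exists w.
rewrite (big_fsetD1 (s w) sw)/=.
rewrite indicE mem_set// mulr1 big_seq big1 ?addr0// => v.
rewrite in_fsetD1 => /andP[vs _]; rewrite indicE memNset ?mulr0//=.
by move=> swv; move: vs; rewrite swv eqxx.
Qed.

Lemma simple_inner_integrable s u : simple s ->
  P.-integrable setT (EFin \o (fun w => inner (s w) u)).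
Proof.
move=> ss; rewrite simple_innerE//.
rewrite (_ : EFin \o _ = fun w => (\sum_(v <- fset_set (range s))
    (EFin \o (fun w => (inner v u * \1_(s @^-1` [set v]) w)%R)) w)%E).
  by apply: integrable_sum => // v _; exact: (scaled_indic_integrable _ (ss.2 v)).
by apply/funext => w /=; rewrite sumEFin.
Qed.

Lemma simple_integral_inner s u : simple s ->
  inner (simple_integral P s) u = \int[P]_w inner (s w) u.
Proof.
move=> ss; rewrite simple_innerE// /simple_integral fsbig_finite/=; last exact: ss.1.
have iv v : P.-integrable setT (EFin \o \1_(s @^-1` [set v])).
  by apply: integrable_indic => //; exact: ss.2.
rewrite (big_morph (inner^~ u) (fun a b => innerDl a b u) (inner0l u)).
rewrite Rintegral_sum => [|v]; last first.
  exact: (scaled_indic_integrable _ (ss.2 v)).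
apply: eq_bigr => v _; rewrite innerZl (RintegralZl (inner v u) measurableT (iv v)).
rewrite mulrC; congr (_ * _); rewrite /Rintegral integral_indic ?setIT//.
exact: ss.2.
Qed.

(** The integrals of the inner products with the approximating simple functions tend to both sides:
    to the right by continuity of the inner product, to the left because the error is at most |u|
    times the integral of |X - s_k|. *)
Lemma bochner_mean_inner X m u : bochner_L2 P X -> bochner_mean P X m ->
  \int[P]_w inner (X w) u = inner m u.
Proof.
move=> X2 [s [ss Xs sm]].
have cI : inner (simple_integral P (s k)) u @[k --> \oo] --> inner m u.
  exact: (continuous_cvg _ (@continuous_inner _ _ u m) sm).
apply: (cvg_unique _ _ cI) => //; apply/cvgrPdist_le => e e0.
have e1 : 0 < e / (`|u| + 1) by rewrite divr_gt0// ltr_wpDl.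
have : \forall k \near \oo, (\int[P]_w (`|X w - s k w|)%:E < (e / (`|u| + 1))%:E)%E.
  apply: (Xs [set y | (y < (e / (`|u| + 1))%:E)%E]); apply: open_nbhs_nbhs; split => /=.
    exact: open_ereal_lt_ereal.
  by rewrite lte_fin.
apply: filterS => k ke.
have iX : P.-integrable setT (EFin \o (fun w => inner (X w) u)).
  exact/Lfun2_integrable/bochner_L2_inner.
rewrite simple_integral_inner// -RintegralB//; last exact: simple_inner_integrable.
have iD : P.-integrable setT (EFin \o (fun w => inner (X w) u - inner (s k w) u)).
  exact: (integrableB measurableT iX (simple_inner_integrable u (ss k))).
rewrite -lee_fin EFin_normr_Rintegral//.
apply: le_trans (le_abse_integral _ _ _) _ => //; first by case/integrableP: iD.
have K0 : 0 < `|u| + 1 by rewrite ltr_wpDl.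
apply: (@le_trans _ _ (\int[P]_w ((`|u| + 1)%:E * (`|X w - s k w|)%:E))%E).
  apply: ge0_ae_le_integral => [//|w|].
    by rewrite -EFinM lee_fin mulr_ge0// ltW.
  apply: nearW => w; rewrite /= -EFinM lee_fin -innerBl.
  apply: le_trans (Cauchy_Schwarz _ _) _; rewrite mulrC ler_wpM2r// lerDl//.
have mD : measurable_fun setT (fun w => `|X w - s k w|).
  apply: (@strongly_measurable_simple_comp X (s k) (fun a b => `|a - b|)) => //.
    exact: X2.1.
  by move=> v x; apply: cvg_norm; apply: cvgB; [exact: cvg_id|exact: cvg_cst].
rewrite ge0_integralZl//; last first.
- exact/measurable_EFinP.
apply: le_trans (lee_pmul _ _ (lexx _) (ltW ke)) _.
- by rewrite lee_fin ltW.
- exact: integral_ge0.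
- by rewrite -EFinM lee_fin mulrCA divff ?mulr1// gt_eqF.
Qed.

End bochner_theory.

Section second_moments.
Context d (Omega : measurableType d) (R : realType) (P : probability Omega R).

Lemma continuous_quadratic (H : preHilbertType R) (Q : {linear H -> H}) :
  bounded_op Q -> selfadjoint Q -> continuous (fun v => inner (Q v) v).
Proof.
move=> /bounded_op_ge0[K K0 QK] Qsa u; apply/cvgrPdist_le => e e0.
pose C := K + 2 * `|Q u|.
have C0 : 0 <= C by rewrite addr_ge0// mulr_ge0.
have d0 : 0 < Num.min 1 (e / (C + 1)) by rewrite lt_min ltr01 divr_gt0// ltr_wpDl.
near=> v.
have : `|u - v| < Num.min 1 (e / (C + 1)).
  by near: v; apply: (@cvgr_dist_lt _ _ _ (nbhs u) _ id).
rewrite lt_min => /andP[uv1 uve].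
have [w vE] : exists w, v = u + w by exists (v - u); rewrite addrC subrK.
have nw : `|u - v| = `|w| by rewrite vE opprD addrA subrr sub0r normrN.
rewrite nw in uv1 uve; rewrite vE linearD innerDl !innerDr (Qsa w u) (innerC w).
rewrite (_ : _ - _ = - (inner (Q u) w *+ 2 + inner (Q w) w)); last by ring.
rewrite normrN; apply: le_trans (ler_normD _ _) _; rewrite normrMn.
have h1 := Cauchy_Schwarz (Q u) w.
have h2 : `|inner (Q w) w| <= K * `|w|.
  apply: le_trans (Cauchy_Schwarz _ _) _; rewrite -[leRHS]mulr1.
  by apply: ler_pM => //; exact: ltW.
have h3 : C * `|w| <= e.
  apply: le_trans (ler_wpM2l C0 (ltW uve)) _.
  by rewrite mulrCA ler_piMr ?(ltW e0)// ler_pdivrMr ?ltr_wpDl// mul1r lerDl.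
by move: h3; rewrite /C; lra.
Unshelve. all: by end_near. Qed.

(** Pointwise (X, u)^2 = (Q X, Q^-1 u)^2 <= (Q X, X) (Q^-1 u, u) by Cauchy-Schwarz in the [Q]-form;
    the expectation of the first factor is at most 1. *)
Lemma second_moment_le (H : preHilbertType R) (Q Qinv : {linear H -> H}) (X : Omega -> H) u :
  bounded_op Q -> selfadjoint Q -> positive_op Q -> cancel Qinv Q ->
  bochner_L2 P X -> ('E_P[fun w => inner (Q (X w)) (X w)] <= 1)%E ->
  ('E_P[fun w => (inner (X w) u ^+ 2)%R] <= (inner (Qinv u) u)%:E)%E.
Proof.
move=> bQ Qsa Q0 QK [mX _]; rewrite unlock => QX.
have Nu : inner (Qinv u) u = inner (Q (Qinv u)) (Qinv u) by rewrite QK innerC.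
have N0 : 0 <= inner (Qinv u) u by rewrite Nu; exact: positive_op_ge0.
apply: (@le_trans _ _ (\int[P]_w ((inner (Qinv u) u)%:E * (inner (Q (X w)) (X w))%:E))%E).
  apply: ge0_ae_le_integral => [w|w|].
  - by rewrite lee_fin sqr_ge0.
  - by rewrite -EFinM lee_fin mulr_ge0// positive_op_ge0.
  - apply: nearW => w; rewrite -EFinM lee_fin mulrC.
    have := positive_op_Cauchy_Schwarz Qsa Q0 (X w) (Qinv u).
    by rewrite Qsa QK [inner u _]innerC.
rewrite ge0_integralZl//.
- rewrite -[leRHS]mule1; apply: lee_pmul => //.
  by apply: integral_ge0 => w _; rewrite lee_fin positive_op_ge0.
- apply/measurable_EFinP.
  exact: (strongly_measurable_comp mX (continuous_quadratic bQ Qsa)).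
- by move=> w _; rewrite lee_fin positive_op_ge0.
Qed.

(** Bias-variance decomposition: centring kills the terms linear in X and Y, and uncorrelatedness
    kills the product XY. *)
Lemma expectation_quadratic (X Y : Omega -> R) (a : R) :
  X \in Lfun P 2%:E -> Y \in Lfun P 2%:E ->
  \int[P]_w X w = 0 -> \int[P]_w Y w = 0 -> \int[P]_w (X w * Y w) = 0 ->
  ('E_P[fun w => (`|a - X w - Y w| ^+ 2)%R] =
   (a ^+ 2)%:E + 'E_P[fun w => (X w ^+ 2)%R] + 'E_P[fun w => (Y w ^+ 2)%R])%E.
Proof.
move=> X2 Y2 X0 Y0 XY0; rewrite unlock.
have iXX := Lfun2_mul_integrable X2 X2.
have iYY := Lfun2_mul_integrable Y2 Y2.
have iXY := Lfun2_mul_integrable X2 Y2.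
have iX := Lfun2_integrable X2.
have iY := Lfun2_integrable Y2.
have i1 : P.-integrable setT (EFin \o (fun w => a ^+ 2)).
  by apply: finite_measure_integrable_cst.
have iZ (f : Omega -> R) k : P.-integrable setT (EFin \o f) ->
    P.-integrable setT (EFin \o (fun w => k * f w)).
  by move=> fi; exact: (integrableZl measurableT k fi).
have iD (f g : Omega -> R) : P.-integrable setT (EFin \o f) ->
    P.-integrable setT (EFin \o g) ->
    P.-integrable setT (EFin \o (fun w => f w + g w)).
  by move=> fi gi; exact: (integrableD measurableT fi gi).
have toR (f : Omega -> R) : P.-integrable setT (EFin \o f) ->
    (\int[P]_w (f w)%:E = (\int[P]_w f w)%:E)%E.
  by move=> fi; rewrite fineK//; exact: integrable_fin_num.
rewrite (eq_integral (fun w => ((a ^+ 2 + (X w * X w + Y w * Y w)) +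
  (2 * (X w * Y w) + ((- 2 * a) * X w + (- 2 * a) * Y w)))%:E)); last first.
  by move=> w _; rewrite real_normK ?num_real//; congr EFin; ring.
have sq (f : Omega -> R) : P.-integrable setT (EFin \o (fun w => f w * f w)) ->
    (\int[P]_w ((f w) ^+ 2)%:E = (\int[P]_w (f w * f w))%:E)%E.
  by move=> fi; rewrite -toR//; apply: eq_integral => w _; rewrite expr2.
rewrite (sq X iXX) (sq Y iYY) toR; last first.
  by apply: (iD _ _); [apply: (iD _ _) => //; exact: (iD _ _)|apply: (iD _ _); [exact: (iZ _ _)|apply: (iD _ _); exact: (iZ _ _)]].
rewrite -!EFinD; congr EFin.
rewrite RintegralD//; first last.
- by apply: (iD _ _); [exact: (iZ _ _)|apply: (iD _ _); exact: (iZ _ _)].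
- by apply: (iD _ _) => //; exact: (iD _ _).
rewrite RintegralD//; last exact: (iD _ _).
rewrite RintegralD//.
rewrite [X in _ + X = _]RintegralD//; first last.
- by apply: (iD _ _); exact: (iZ _ _).
- exact: (iZ _ _).
rewrite [X in _ + (_ + X) = _]RintegralD//; [|exact: (iZ _ _)|exact: (iZ _ _)].
rewrite (RintegralZl _ measurableT iXY) (RintegralZl _ measurableT iX).
rewrite (RintegralZl _ measurableT iY) X0 Y0 XY0 !mulr0 !addr0 addrA; congr (_ + _ + _).
by rewrite Rintegral_cst// -[fine _]/(fine (P setT)) probability_setT/= mulr1.
Qed.

Import HBSimple.

Lemma sfun_scaled_simple (H : preHilbertType R) (g : {sfun Omega >-> R}) (v : H) :
  simple (fun w => g w *: v).
Proof.
split.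
  have -> : range (fun w => g w *: v) = (fun r => r *: v) @` range g.
    apply/seteqP; split => [_ [w _ <-]|_ [_ [w _ <-] <-]]; last by exists w.
    by exists (g w) => //; exists w.
  exact/finite_image/fimfunP.
move=> u; rewrite (_ : _ @^-1` _ =
    \bigcup_(r in [set r | range g r /\ r *: v = u]) g @^-1` [set r]).
  apply: fin_bigcup_measurable => //.
  by apply: sub_finite_set (@fimfunP _ _ g) => r [].
apply/seteqP; split => [w gw|w [r [_ ru] /= gr]]; last by rewrite /preimage/= gr.
by exists (g w) => //; split => //; exists w.
Qed.

(** Both strong measurability and the mean demand explicit simple functions. They are g_k v, where
    the real simple functions g_k approximate xi pointwise and in L^1. *)
Lemma bochner_L2_scaled (H : preHilbertType R) (xi : Omega -> R) (v : H) :
  xi \in Lfun P 2%:E -> \int[P]_w xi w = 0 ->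
  bochner_L2 P (fun w => xi w *: v) /\ bochner_mean P (fun w => xi w *: v) 0.
Proof.
move=> xi2 xi0.
have ixi := Lfun2_integrable xi2.
have [g [ig gxi gL1]] := approximation_sfun_integrable measurableT ixi.
have mxi : measurable_fun setT xi by have /andP[/[!inE]] := xi2.
have mxg k : measurable_fun setT (fun w => xi w - g k w) by apply: measurable_funB.
have xi2fin : (\int[P]_w ((xi w) ^+ 2)%:E < +oo)%E.
  exact: (integrable_lty measurableT (Lfun2_integrable_sqr xi2)).
split; [split|].
- exists (fun k w => g k w *: v) => [k|w]; first exact: sfun_scaled_simple.
  by apply: cvgZr_tmp; exact: (fine_cvg (gxi w I)).
- apply: (@le_lt_trans _ _ (\int[P]_w ((`|v| ^+ 2)%:E * (xi w ^+ 2)%:E))%E).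
    apply: ge0_ae_le_integral => [w|w|].
    + by rewrite lee_fin sqr_ge0.
    + by rewrite -EFinM lee_fin mulr_ge0// sqr_ge0.
    + apply: nearW => w; rewrite -EFinM lee_fin normrZ exprMn real_normK ?num_real//.
      by rewrite mulrC.
  rewrite ge0_integralZl//.
    by rewrite lte_mul_pinfty ?lee_fin ?sqr_ge0.
  by apply/measurable_EFinP; exact: measurable_funX.
  by move=> w _; rewrite lee_fin sqr_ge0.
- exists (fun k w => g k w *: v); split.
  + by move=> k; exact: sfun_scaled_simple.
  + rewrite (_ : (fun k => _) = (fun k => (`|v|%:E *
        \int[P]_w (`|(xi w)%:E - (g k w)%:E|))%E)).
      by rewrite -(mule0 `|v|%:E); apply: cvgeZl.
    apply/funext => k; rewrite -ge0_integralZl//; last first.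
      by apply: measurableT_comp => //; exact/measurable_EFinP.
    by apply: eq_integral => w _; rewrite -scalerBl normrZ mulrC EFinM.
  + have -> : (fun k => simple_integral P (fun w => g k w *: v)) =
        (fun k => (\int[P]_w g k w) *: v).
      (* The vector-valued simple integral is identified weakly, through its inner products. *)
      apply/funext => k; apply: inner_inj => u.
      rewrite (simple_integral_inner P u (sfun_scaled_simple (g k) v)) innerZl.
      under eq_Rintegral do rewrite innerZl.
      by rewrite (RintegralZr _ measurableT (ig k)).
    rewrite -(scale0r v); apply: cvgZr_tmp; rewrite -xi0.
    apply/cvgrPdist_le => e e0.
    have : \forall k \near \oo, (\int[P]_w (`|(xi w)%:E - (g k w)%:E|) < e%:E)%E.
      apply: (gL1 [set y | (y < e%:E)%E]); apply: open_nbhs_nbhs; split => /=.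
        exact: open_ereal_lt_ereal.
      by rewrite lte_fin.
    apply: filterS => k /ltW ke; rewrite -(RintegralB measurableT ixi (ig k)).
    have iD : P.-integrable setT (EFin \o (fun w => xi w - g k w)).
      exact: (integrableB measurableT ixi (ig k)).
    rewrite -lee_fin EFin_normr_Rintegral//.
    apply: le_trans (le_abse_integral _ _ _) ke => //.
    exact/measurable_EFinP.
Qed.

End second_moments.

Section noise.
Context d (Omega : measurableType d) (R : realType) (P : probability Omega R).
Context (H1 H2 : hilbertType R).
Variables (Q1 Q1inv : {linear H1 -> H1}) (Q2 Q2inv : {linear H2 -> H2}).
Hypotheses (Q1_bounded : bounded_op Q1) (Q1_sa : selfadjoint Q1) (Q1_pos : positive_op Q1).
Hypotheses (Q2_bounded : bounded_op Q2) (Q2_sa : selfadjoint Q2) (Q2_pos : positive_op Q2).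
Hypotheses (Q1K : cancel Q1inv Q1) (Q2K : cancel Q2inv Q2).

Lemma expectation_Rintegral0 (f : Omega -> R) : ('E_P[f] = 0)%E -> \int[P]_w f w = 0.
Proof. by rewrite unlock /Rintegral => ->. Qed.

Lemma G1_expectation eta1 eta2 (u1 : H1) (u2 : H2) a1 a2 l k : G1 P Q1 Q2 eta1 eta2 ->
  ('E_P[fun w => (`|l - inner (a1 + eta1 w) u1 - inner (a2 + eta2 w) u2 - k| ^+ 2)%R] =
   ((l - inner a1 u1 - inner a2 u2 - k) ^+ 2)%:E +
   'E_P[fun w => (inner (eta1 w) u1 ^+ 2)%R] + 'E_P[fun w => (inner (eta2 w) u2 ^+ 2)%R])%E.
Proof.
move=> [[b1 b2] [m1 m2] unc _]; rewrite -expectation_quadratic.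
- by rewrite unlock; apply: eq_integral => w _; congr (`|_| ^+ 2)%:E; rewrite !innerDl; ring.
- exact: bochner_L2_inner.
- exact: bochner_L2_inner.
- by rewrite (bochner_mean_inner _ b1 m1) inner0l.
- by rewrite (bochner_mean_inner _ b2 m2) inner0l.
- exact/expectation_Rintegral0/unc.
Qed.

Lemma G1_moments eta1 eta2 (u1 : H1) (u2 : H2) : G1 P Q1 Q2 eta1 eta2 ->
  ('E_P[fun w => (inner (eta1 w) u1 ^+ 2)%R] <= (inner (Q1inv u1) u1)%:E)%E /\
  ('E_P[fun w => (inner (eta2 w) u2 ^+ 2)%R] <= (inner (Q2inv u2) u2)%:E)%E.
Proof.
move=> [[b1 b2] _ _ [e1 e2]]; split.
  exact: (second_moment_le u1 Q1_bounded Q1_sa Q1_pos Q1K).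
exact: (second_moment_le u2 Q2_bounded Q2_sa Q2_pos Q2K).
Qed.

Lemma expectation_scaled (f : Omega -> R) k : f \in Lfun P 1%E ->
  ('E_P[fun w => (k * f w)%R] = k%:E * 'E_P[f])%E.
Proof.
move=> f1; rewrite -expectationZl//; congr expectation.
by apply/funext => w /=; rewrite mulrC.
Qed.

(* [xi_i Q_i^-1 u_i] suitably normalised is the least favourable noise for [u_i]. *)
Lemma worst_noise (u1 : H1) (u2 : H2) : uncorrelated_pair P ->
  exists eta1 eta2, [/\ G1 P Q1 Q2 eta1 eta2,
    'E_P[fun w => (inner (eta1 w) u1 ^+ 2)%R] = (inner (Q1inv u1) u1)%:E &
    'E_P[fun w => (inner (eta2 w) u2 ^+ 2)%R] = (inner (Q2inv u2) u2)%:E]%E.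
Proof.
move=> [x1 [x2 [[L1 L2] [E1 E2] [V1 V2] C12]]].
have norm (H : hilbertType R) (Q Qinv : {linear H -> H}) (u : H) : cancel Qinv Q ->
    positive_op Q ->
    exists v, inner (Q v) v <= 1 /\ inner v u ^+ 2 = inner (Qinv u) u.
  move=> QK Qpos; pose N := inner (Qinv u) u.
  have NE : N = inner (Q (Qinv u)) (Qinv u) by rewrite QK innerC.
  have N0 : 0 <= N by rewrite NE; exact: positive_op_ge0.
  (* Normalised so that (Q v, v) = 1. If N = 0 the scalar is [0^-1 = 0], so v = 0 and both claims
     still hold. *)
  exists ((Num.sqrt N)^-1 *: Qinv u); rewrite linearZ/= !innerZl innerZr -NE.
  rewrite exprMn exprVn sqr_sqrtr// -/N mulrA -expr2 exprVn sqr_sqrtr//.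
  by have [->|N1] := eqVneq N 0; rewrite ?invr0 ?mul0r ?expr0n/= ?mulr0 ?ler01// mulVf// expr2 mulKf.
have [v1 [n1 i1]] := norm _ Q1 Q1inv u1 Q1K Q1_pos.
have [v2 [n2 i2]] := norm _ Q2 Q2inv u2 Q2K Q2_pos.
have Z1 := expectation_Rintegral0 E1; have Z2 := expectation_Rintegral0 E2.
have [b1 m1] := bochner_L2_scaled v1 L1 Z1.
have [b2 m2] := bochner_L2_scaled v2 L2 Z2.
have sq (x : Omega -> R) k : x \in Lfun P 2%:E -> ('E_P[(x \* x)%R] = 1)%E ->
    ('E_P[fun w => (k * (x \* x) w)%R] = k%:E)%E.
  move=> xL x1E; rewrite expectation_scaled ?x1E ?mule1//.
  exact: Lfun2_mul_Lfun1.
exists (fun w => x1 w *: v1), (fun w => x2 w *: v2); split.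
- split => //.
    move=> w1 w2; rewrite (_ : (fun w => _) =
      (fun w => (inner v1 w1 * inner v2 w2) * (x1 \* x2) w)).
      by rewrite expectation_scaled ?C12 ?mule0//; exact: Lfun2_mul_Lfun1.
    by apply/funext => w; rewrite !innerZl /=; ring.
  split.
    rewrite (_ : (fun w => _) = (fun w => inner (Q1 v1) v1 * (x1 \* x1) w)).
      by rewrite sq// lee_fin.
    by apply/funext => w; rewrite linearZ/= innerZl innerZr /=; ring.
  rewrite (_ : (fun w => _) = (fun w => inner (Q2 v2) v2 * (x2 \* x2) w)).
    by rewrite sq// lee_fin.
  by apply/funext => w; rewrite linearZ/= innerZl innerZr /=; ring.
- rewrite (_ : (fun w => _) = (fun w => (inner v1 u1 ^+ 2) * (x1 \* x1) w)).
    by rewrite sq// i1.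
  by apply/funext => w; rewrite innerZl /=; ring.
- rewrite (_ : (fun w => _) = (fun w => (inner v2 u2 ^+ 2) * (x2 \* x2) w)).
    by rewrite sq// i2.
  by apply/funext => w; rewrite innerZl /=; ring.
Qed.

End noise.

(** * The guaranteed error *)

Section guaranteed_estimation.
Context {R : realType} {n : nat} (D : lipschitzDomain R n).
Local Notation mu := (lebesgue_on D).
Local Notation LD := (nfold (L2 mu : hilbertType R) n : hilbertType R).
Local Notation MD := (L2 mu : hilbertType R).
Context d (Omega : measurableType d) (P : probability Omega R).
Context (H1 H2 : hilbertType R).
Variables (A : 'rV[R]_n -> 'M[R]_n) (c : 'rV[R]_n -> R).
Variables (Q Qinv : {linear MD -> MD}) (f0 l0 : MD).
Variables (Q1 Q1inv : {linear H1 -> H1}) (Q2 Q2inv : {linear H2 -> H2}).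
Variables (C1 : {linear LD -> H1}) (C2 : {linear MD -> H2}).
Hypothesis P_rich : uncorrelated_pair P.
Hypotheses (Q_sa : selfadjoint Q) (Q_pos : positive_op Q) (Q_inv : cancel Qinv Q).
Hypotheses (Q1_bounded : bounded_op Q1) (Q1_sa : selfadjoint Q1) (Q1_pos : positive_op Q1).
Hypotheses (Q2_bounded : bounded_op Q2) (Q2_sa : selfadjoint Q2) (Q2_pos : positive_op Q2).
Hypotheses (Q1K : cancel Q1 Q1inv) (Q1invK : cancel Q1inv Q1).
Hypotheses (Q2K : cancel Q2 Q2inv) (Q2invK : cancel Q2inv Q2).
Hypothesis state_wp : forall f : L2D D,
  exists! s : Hdiv D * L2D D, is_state A c f s.1 s.2.
Hypothesis state_lin : forall a (f f' : MD) (j j' : Hdiv D) (phi phi' : MD),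
  is_state A c f j phi -> is_state A c f' j' phi' ->
  exists2 j2 : Hdiv D, field_of j2 = a *: (field_of j : LD) + field_of j' :> LD &
    is_state A c (a *: f + f') j2 (a *: phi + phi').
Variables (z2 : MD) (p1 : Hdiv D) (p2 : MD).
Hypothesis state_p : is_state A c (Qinv (l0 - z2)) p1 p2.
Hypothesis state_identity : forall (f : MD) (j : Hdiv D) (phi : MD),
  is_state A c f j phi ->
  inner z2 f = inner (C1 (field_of j)) (Q1 (C1 (field_of p1))) +
               inner (C2 phi) (Q2 (C2 p2)).

Local Notation r := (Qinv (l0 - z2)).
Local Notation y1 := (C1 (field_of p1)).
Local Notation y2 := (C2 p2).
Local Notation rho := (inner (Q r) r).
Local Notation sig := (sigma P A c Q f0 l0 Q1 Q2 C1 C2).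

Let Qr : Q r = l0 - z2. Proof. exact: Q_inv. Qed.

(** l0 is split as (l0 - z2) + z2 = Q r + z2, and the state identity is evaluated at the state (p1,
    p2) of r itself. *)
Lemma functional_l_split :
  functional_l l0 r = rho + inner y1 (Q1 y1) + inner y2 (Q2 y2).
Proof.
rewrite -[LHS]/(inner l0 r) -addrA -(state_identity state_p) Qr.
by rewrite -innerDl subrK.
Qed.

Lemma functional_l_ge0 : 0 <= functional_l l0 r.
Proof.
rewrite functional_l_split !addr_ge0// ?positive_op_ge0//.
  by rewrite innerC positive_op_ge0.
by rewrite innerC positive_op_ge0.
Qed.

(** The three terms of [functional_l_split] bound, one by one, the squared bias, which is (Q r, f -
    f0)^2, and the two noise variances, where Q_i^-1 (Q_i y_i) = y_i. *)
Lemma sigma_optimal_le :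
  (sig (Q1 y1) (Q2 y2) (inner (l0 - z2)%R f0) <= (functional_l l0 r)%:E)%E.
Proof.
apply: ge_ereal_sup => _ [f [eta1 [eta2 [j [phi [fG0 etaG1 sj ->]]]]]].
rewrite (G1_expectation _ _ _ _ _ _ etaG1).
have [e1 e2] := G1_moments Q1_bounded Q1_sa Q1_pos Q2_bounded Q2_sa Q2_pos
  Q1invK Q2invK (Q1 y1) (Q2 y2) etaG1.
rewrite functional_l_split !EFinD; apply: leeD; first apply: leeD.
- rewrite lee_fin -[functional_l l0 f]/(inner l0 f).
  have -> : inner l0 f - inner (C1 (field_of j)) (Q1 y1) - inner (C2 phi) (Q2 y2)
      - inner (l0 - z2) f0 = inner (Q r) (f - f0).
    rewrite Qr innerBr; have := state_identity sj; rewrite !innerBl; lra.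
  apply: le_trans (positive_op_Cauchy_Schwarz Q_sa Q_pos r (f - f0)) _.
  by rewrite -[leRHS]mulr1; apply: ler_wpM2l => //; exact: positive_op_ge0.
- by move: e1; rewrite Q1K.
- by move: e2; rewrite Q2K.
Qed.

(** Completion of the square around u = S y. The middle term, linear in u, is what the perturbation
    of the data compensates in [sigma_ge]. *)
Lemma inverse_form_shift (H : hilbertType R) (S Sinv : {linear H -> H}) (u y : H) :
  selfadjoint S -> cancel S Sinv -> cancel Sinv S ->
  inner (Sinv u) u = inner (Sinv (u - S y)) (u - S y) +
    (inner y u - inner y (S y)) *+ 2 + inner y (S y).
Proof.
move=> Ssa SK SinvK; rewrite linearB SK !innerBl !innerBr.
by rewrite -Ssa SinvK (innerC u y) -Ssa (innerC (S y)); ring.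
Qed.

(** Here r = 0, so (p1, p2) and the combination of it with its own negative are both states for 0.
    Uniqueness identifies them, and the latter has zero flux and potential. *)
Lemma null_state : rho = 0 -> y1 = 0 /\ y2 = 0.
Proof.
move=> rho0; have r0 : r = 0.
  by apply/eqP/negPn/negP => /Q_pos; rewrite rho0 ltxx.
have [j jE sj] := state_lin (-1) state_p state_p.
have [s [_ us]] := state_wp 0.
have sp0 : is_state A c 0 p1 p2 by move: state_p; rewrite r0.
have sj0 : is_state A c 0 j (-1 *: p2 + p2) by move: sj; rewrite r0 scaler0 addr0.
have e : (p1, p2) = (j, -1 *: p2 + p2).
  by rewrite -(us (p1, p2) sp0) -(us (j, -1 *: p2 + p2) sj0).
have [-> ->] : p1 = j /\ p2 = -1 *: p2 + p2 by case: e.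
by rewrite jE !scaleN1r !addNr !linear0.
Qed.

Lemma sigma_ge (u1 : H1) (u2 : H2) (kappa : R) (j0 : Hdiv D) (phi0 : MD) :
  is_state A c f0 j0 phi0 ->
  ((functional_l l0 r + inner (Q1inv (u1 - Q1 y1)) (u1 - Q1 y1)
    + inner (Q2inv (u2 - Q2 y2)) (u2 - Q2 y2)
    + (inner l0 f0 - inner (C1 (field_of j0)) u1 - inner (C2 phi0) u2 - kappa) ^+ 2)%:E
   <= sig u1 u2 kappa)%E.
Proof.
move=> s0; set D0 := inner l0 f0 - _ - _ - _.
have [eta1 [eta2 [etaG1 e1 e2]]] :=
  worst_noise Q1_pos Q2_pos Q1invK Q2invK u1 u2 P_rich.
(* If [rho = 0] then [s = 0] since [0^-1 = 0], and [null_state] applies below. *)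
pose s := (Num.sqrt rho)^-1.
pose e := functional_l l0 r - inner y1 u1 - inner y2 u2.
have rho0 : 0 <= rho by exact: positive_op_ge0.
have s2 : s ^+ 2 = rho^-1 by rewrite /s exprVn sqr_sqrtr.
(* When rho is nonzero, t^2 = 1 / rho puts f0 + t r on the boundary of the ellipsoid [G0]. By
   linearity of the state, the error without noise moves from [D0] to [D0 + t * e]. *)
have adversary t : t ^+ 2 = s ^+ 2 ->
    (((D0 + t * e) ^+ 2 + inner (Q1inv u1) u1 + inner (Q2inv u2) u2)%:E <= sig u1 u2 kappa)%E.
  move=> ts; have [j jE sj] := state_lin t state_p s0.
  apply: ereal_sup_ubound; exists (t *: r + f0), eta1, eta2, j, (t *: p2 + phi0); split => //.
    rewrite /G0 addrK linearZ/= innerZl innerZr mulrA -expr2 ts s2.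
    by have [->|rn0] := eqVneq rho 0; rewrite ?mulr0 ?ler01// mulVf.
  rewrite (G1_expectation _ _ _ _ _ _ etaG1) e1 e2 -!EFinD; congr (_ ^+ 2 + _ + _)%:E.
  rewrite -[functional_l _ _]/(inner l0 (t *: r + f0)) jE !linearP/=.
  rewrite innerDr innerZr !innerDl !innerZl /D0 /e -[functional_l l0 r]/(inner l0 r).
  ring.
have key : ((D0 ^+ 2 + s ^+ 2 * e ^+ 2 + inner (Q1inv u1) u1 + inner (Q2inv u2) u2)%:E
    <= sig u1 u2 kappa)%E.
  (* The sign of [t] makes the cross term nonnegative. *)
  have [De|De] := leP 0 (D0 * (s * e)).
    apply: le_trans (adversary s erefl); rewrite lee_fin !lerD2r.
    rewrite (_ : (D0 + s * e) ^+ 2 = D0 ^+ 2 + s ^+ 2 * e ^+ 2 + D0 * (s * e) *+ 2).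
      by rewrite lerDl mulrn_wge0.
    by ring.
  have ts : (- s) ^+ 2 = s ^+ 2 by rewrite sqrrN.
  apply: le_trans (adversary (- s) ts); rewrite lee_fin !lerD2r.
  rewrite (_ : (D0 + - s * e) ^+ 2 = D0 ^+ 2 + s ^+ 2 * e ^+ 2 - D0 * (s * e) *+ 2).
    by rewrite lerDl oppr_ge0 mulrn_wle0// ltW.
  by ring.
apply: le_trans key; rewrite lee_fin.
rewrite (inverse_form_shift u1 y1 Q1_sa Q1K Q1invK).
rewrite (inverse_form_shift u2 y2 Q2_sa Q2K Q2invK).
set N1 := inner (Q1inv (_ - _)) _; set N2 := inner (Q2inv (_ - _)) _.
(* By [functional_l_split], e = rho - del, so e^2 / rho = rho - 2 del + del^2 / rho. The term - 2
   del cancels the linear terms produced by [inverse_form_shift]. For rho = 0 the observations [y1]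
   and [y2] vanish, and so does del. *)
pose del := inner y1 u1 - inner y1 (Q1 y1) + (inner y2 u2 - inner y2 (Q2 y2)).
have h : rho - del *+ 2 <= s ^+ 2 * e ^+ 2.
  have [rz|rn0] := eqVneq rho 0.
    have [y10 y20] := null_state rz.
    by rewrite rz /del y10 y20 !inner0l !subrr addr0 mul0rn subrr mulr_ge0// sqr_ge0.
  have -> : e = rho - del by rewrite /e /del functional_l_split; ring.
  have rp : 0 < rho by rewrite lt_neqAle eq_sym rn0.
  rewrite s2 mulrC ler_pdivlMr// -subr_ge0.
  rewrite (_ : _ - _ = del ^+ 2) ?sqr_ge0//; ring.
by rewrite functional_l_split; move: h; rewrite /del; lra.
Qed.

Lemma inverse_form_eq0 (H : hilbertType R) (S Sinv : {linear H -> H}) (u : H) :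
  positive_op S -> cancel Sinv S ->
  0 <= inner (Sinv u) u /\ (inner (Sinv u) u <= 0 -> u = 0).
Proof.
move=> Spos SinvK; have E : inner (Sinv u) u = inner (S (Sinv u)) (Sinv u).
  by rewrite SinvK innerC.
rewrite E; split; first exact: positive_op_ge0.
move=> h; rewrite -(SinvK u); have [->|/Spos] := eqVneq (Sinv u) 0.
  exact: linear0.
by rewrite ltNge h.
Qed.

Lemma sigma_optimalE :
  sig (Q1 y1) (Q2 y2) (inner (l0 - z2) f0) = (functional_l l0 r)%:E.
Proof.
apply/eqP; rewrite eq_le sigma_optimal_le/=.
have [[j0 phi0] [s0 _]] := state_wp f0.
apply: le_trans (sigma_ge _ _ _ s0); rewrite lee_fin !subrr !inner0r !addr0.
by rewrite lerDl sqr_ge0.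
Qed.

Lemma optimal_estimate :
  optimal P A c Q f0 l0 Q1 Q2 C1 C2 (Q1 y1) (Q2 y2) (inner (l0 - z2) f0).
Proof.
rewrite /optimal; apply/eqP; rewrite eq_le; apply/andP; split; last first.
  by apply: ereal_inf_lbound; exists (Q1 y1), (Q2 y2), (inner (l0 - z2) f0).
apply: le_ereal_inf_tmp => _ [v1 [v2 [k ->]]].
have [[j0 phi0] [s0 _]] := state_wp f0.
rewrite sigma_optimalE; apply: le_trans (sigma_ge _ _ _ s0); rewrite lee_fin.
have [N1 _] := inverse_form_eq0 (v1 - Q1 y1) Q1_pos Q1invK.
have [N2 _] := inverse_form_eq0 (v2 - Q2 y2) Q2_pos Q2invK.
by rewrite -!addrA lerDl !addr_ge0// sqr_ge0.
Qed.

(** The value of [sigma] at an optimum equals the leading term of the lower bound, so all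
    nonnegative remainders vanish. The first two fix [v1] and [v2]; the squared error at f0,
    rewritten with the state identity, fixes [k]. *)
Lemma optimal_unique v1 v2 k : optimal P A c Q f0 l0 Q1 Q2 C1 C2 v1 v2 k ->
  [/\ v1 = Q1 y1, v2 = Q2 y2 & k = inner (l0 - z2) f0].
Proof.
rewrite /optimal -optimal_estimate sigma_optimalE => sE.
have [[j0 phi0] [s0 _]] := state_wp f0.
have := sigma_ge v1 v2 k s0; rewrite sE lee_fin.
set D0 := _ - k.
have [N1 E1] := inverse_form_eq0 (v1 - Q1 y1) Q1_pos Q1invK.
have [N2 E2] := inverse_form_eq0 (v2 - Q2 y2) Q2_pos Q2invK.
have D2 := sqr_ge0 D0.
rewrite -!addrA gerDl => h.
have v1E : v1 = Q1 y1 by apply/subr0_eq/E1; lra.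
have v2E : v2 = Q2 y2 by apply/subr0_eq/E2; lra.
have D00 : D0 = 0 by apply/eqP; rewrite -sqrf_eq0 eq_le D2 andbT; lra.
split => //; move: D00; rewrite /D0 v1E v2E innerBl (state_identity s0); lra.
Qed.

End guaranteed_estimation.

Theorem theorem6 (R : realType) (n : nat) (n_gt0 : (0 < n)%N)
  (D : lipschitzDomain R n)
  (* coefficients *)
  (A : 'rV[R]_n -> 'M[R]_n) (hA : elliptic D A)
  (c : 'rV[R]_n -> R) (hc : piecewise_continuous (dom D) c)
  (c0 c1 : R) (hc0 : 0 <= c0) (hc01 : forall x, dom D x -> c0 <= c x <= c1)
  (* the state is the unique solution of the mixed problem *)
  (state_wp : forall f : L2D D,
     exists! s : Hdiv D * L2D D, is_state A c f s.1 s.2)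
  (* uncertainty set of the right-hand sides *)
  (f0 : L2D D)
  (Q Qinv : {linear L2D D -> L2D D})
  (Q_bounded : bounded_op Q) (Q_sa : selfadjoint Q) (Q_pos : positive_op Q)
  (Q_inv : bounded_inverse Q Qinv)
  (* Hilbert spaces of observations *)
  (H1 H2 : hilbertType R) (H1_sep : separable H1) (H2_sep : separable H2)
  (* probability space *)
  (dO : measure_display) (Omega : measurableType dO) (P : probability Omega R)
  (P_rich : uncorrelated_pair P)
  (* uncertainty set of the noises *)
  (Q1 Q1inv : {linear H1 -> H1}) (Q2 Q2inv : {linear H2 -> H2})
  (Q1_bounded : bounded_op Q1) (Q1_sa : selfadjoint Q1)
  (Q1_pos : positive_definite_op Q1) (Q1_inv : bounded_inverse Q1 Q1inv)
  (Q2_bounded : bounded_op Q2) (Q2_sa : selfadjoint Q2)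
  (Q2_pos : positive_definite_op Q2) (Q2_inv : bounded_inverse Q2 Q2inv)
  (* observation operators *)
  (C1 : {linear L2Dn D n -> H1}) (C1_bounded : bounded_op C1)
  (C2 : {linear L2D D -> H2}) (C2_bounded : bounded_op C2)
  (l0 : L2D D) :
  [/\ exists! e : H1 -> H2 -> R,
        guaranteed_estimate P A c Q f0 l0 Q1 Q2 C1 C2 e,
      exists! s : (Hdiv D * L2D D) * (Hdiv D * L2D D),
        optimality_system A c l0 Q1 Q2 C1 C2 Qinv s.1.1 s.1.2 s.2.1 s.2.2 &
      forall (z1 : Hdiv D) (z2 : L2D D)
             (p1 : Hdiv D) (p2 : L2D D),
        optimality_system A c l0 Q1 Q2 C1 C2 Qinv z1 z2 p1 p2 ->
        let u1 := Q1 (C1 (field_of p1)) in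
        let u2 := Q2 (C2 p2) in
        let kappa := \int[lebesgue_on D]_x ((l0 x - z2 x) * f0 x) in
        [/\ optimal P A c Q f0 l0 Q1 Q2 C1 C2 u1 u2 kappa,
            guaranteed_estimate P A c Q f0 l0 Q1 Q2 C1 C2
              (fun y1 y2 => inner y1 u1 + inner y2 u2 + kappa),
            0 <= functional_l l0 (Qinv (l0 - z2)) &
            estimation_error P A c Q f0 l0 Q1 Q2 C1 C2 u1 u2 kappa =
              (Num.sqrt (functional_l l0 (Qinv (l0 - z2))))%:E]].
Proof.
have [oA [oB [oAt [oBt [oc [[bA bAt bc pA pAt] [BA AtBt BBt] [csa cge0] formaE formmE]]]]]] :=
  mixed_operators hA hc hc0 hc01.
have q1pos := positive_definite_positive Q1_pos.
have q2pos := positive_definite_positive Q2_pos.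
have [_ QinvK _] := Q_inv; have [Q1K Q1invK _] := Q1_inv.
have [Q2K Q2invK _] := Q2_inv.
have state_lin := is_state_lin formaE formmE.
have [z1 [p1 [z2 [p2 os]]]] :=
  optimality_system_exists bA bAt bc pA pAt BA AtBt BBt csa cge0 formaE formmE
    l0 C1_bounded C2_bounded state_wp Q_bounded Q_sa Q_pos Q_inv
    Q1_bounded Q1_sa q1pos Q2_bounded Q2_sa q2pos.
have [[j0 phi0] [s0 _]] := state_wp f0.
(* The integrand uses the difference of representatives, which agrees only almost everywhere with a
   representative of the difference of classes. *)
have kappaE (z : L2D D) :
    \int[lebesgue_on D]_x ((l0 x - z x) * f0 x) = inner (l0 - z) f0.
  by apply/esym/L2_innerE; apply: filterS (L2_subE l0 z) => x ->.
have idq f j phi y1 y2 q1 q2 (osq : optimality_system A c l0 Q1 Q2 C1 C2 Qinv y1 y2 q1 q2) :=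
  @optimality_system_identity _ _ _ _ _ _ _ _ BBt csa formaE formmE
    _ _ _ _ _ _ _ _ C1_bounded C2_bounded _ _ j _ _ f phi osq.
(* Stated for an arbitrary solution of the system, as the last clause quantifies over all of them;
   the first clause uses the solution just obtained. *)
have main y1 y2 q1 q2 : optimality_system A c l0 Q1 Q2 C1 C2 Qinv y1 y2 q1 q2 ->
    let u1 := Q1 (C1 (field_of q1)) in let u2 := Q2 (C2 q2) in
    let kappa := inner (l0 - y2) f0 in
    [/\ 0 <= functional_l l0 (Qinv (l0 - y2)),
        sigma P A c Q f0 l0 Q1 Q2 C1 C2 u1 u2 kappa = (functional_l l0 (Qinv (l0 - y2)))%:E,
        optimal P A c Q f0 l0 Q1 Q2 C1 C2 u1 u2 kappa &
        forall v1 v2 k, optimal P A c Q f0 l0 Q1 Q2 C1 C2 v1 v2 k ->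
          [/\ v1 = u1, v2 = u2 & k = kappa]].
  move=> osq u1 u2 kappa.
  have /(optimality_systemP BBt formaE formmE)[_ sq] := osq.
  have idf f j phi := idq f j phi _ _ _ _ osq.
  split.
  - exact: (functional_l_ge0 Q_pos QinvK q1pos q2pos sq idf).
  - exact: (sigma_optimalE f0 P_rich Q_sa Q_pos QinvK Q1_bounded Q1_sa q1pos
      Q2_bounded Q2_sa q2pos Q1K Q1invK Q2K Q2invK state_wp state_lin sq idf).
  - exact: (optimal_estimate f0 P_rich Q_sa Q_pos QinvK Q1_bounded Q1_sa q1pos
      Q2_bounded Q2_sa q2pos Q1K Q1invK Q2K Q2invK state_wp state_lin sq idf).
  - move=> v1 v2 k; exact: (optimal_unique P_rich Q_sa Q_pos QinvK Q1_bounded Q1_sa q1pos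
      Q2_bounded Q2_sa q2pos Q1K Q1invK Q2K Q2invK state_wp state_lin sq idf).
split.
- have [_ _ opt uniq] := main _ _ _ _ os.
  exists (estimate (Q1 (C1 (field_of p1))) (Q2 (C2 p2)) (inner (l0 - z2) f0)); split.
    by do 3 eexists; split; first exact: opt.
  by move=> e [v1 [v2 [k [/uniq[-> -> ->] ->]]]].
- exists ((z1, z2), (p1, p2)); split => // -[[y1 y2] [q1 q2]] /= osq.
  have [-> -> -> ->] := optimality_system_unique pA BA BBt csa formaE formmE
    C1_bounded C2_bounded state_wp Q_pos Q_inv Q1_sa q1pos Q2_sa q2pos os osq.
  by [].
- move=> y1 y2 q1 q2 osq u1 u2 kappa.
  have [l_ge0 sE opt _] := main _ _ _ _ osq.
  rewrite /kappa kappaE; split => //.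
    by exists u1, u2, (inner (l0 - y2) f0); split.
  by rewrite /estimation_error sE.
Qed.
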